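(* Let $N\in\mathbb N^+$, $c>0$ and $\gamma>0$ be arbitrary, and let $T=\{t_k:k\in\mathbb N\}$ with $t_0=0$ and $t_k=Nk+ck^\gamma$ for $k\ge1$. Then $T\in\mathfrak U$ if and only if $0<\gamma\le1$. (In particular, for $0<\gamma\le 1$ there is no smallness restriction on $c$.)
   Context: $\mathbb N=\{0,1,2,\dots\}$, $\mathbb N^+=\{1,2,\dots\}$. A set $T\subset[0,\infty)$ is locally finite if $T\cap[0,R]$ is finite for every $R>0$. For a positive operator $A$ on a Hilbert space, $A^t$ is defined by continuous functional calculus for $t>0$ and $A^0=I$. The family $\{CA^t\}_{t\in T}$ is exactly observable if there are $0<a\le b<\infty$ with $a\|x\|^2\le\sum_{t\in T}\|CA^tx\|^2\le b\|x\|^2$ for all $x\in H$. $\mathfrak U$ is the class of universal time sets: locally finite $T\subset[0,\infty)$ such that for all separable complex Hilbert spaces $H,Y$, every positive $A\in\mathcal B(H)$ and every $C\in\mathcal B(H,Y)$, exact observability of $\{CA^n\}_{n\in\mathbb N}$ implies exact observability of $\{CA^t\}_{t\in T}$. *)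

(* Defs.v *)
From HB Require Import structures.
From mathcomp Require Import all_boot all_order all_algebra.
From mathcomp Require Import complex.
From mathcomp Require Import all_classical all_reals all_analysis.

Set Implicit Arguments.
Unset Strict Implicit.
Unset Printing Implicit Defensive.

Import Order.TTheory GRing.Theory Num.Theory.
Import numFieldNormedType.Exports.

Local Open Scope classical_set_scope.
Local Open Scope ring_scope.
Local Open Scope complex_scope.

(* Complex Hilbert spaces: the norm of the complete normed module is the one
   induced by the inner product, which is linear in its first argument. *)
HB.mixin Record isHilbert (R : realType) H
    & CompleteNormedModule R[i] H := {
  inner : {dot H for Num.conj};
  innerE : forall x : H, inner x x = `|x| ^+ 2
}.

#[short(type="hilbertType")]
HB.structure Definition Hilbert (R : realType) :=
  {H of isHilbert R H & CompleteNormedModule R[i] H}.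

Definition separable (T : topologicalType) : Prop :=
  exists2 D : set T, countable D & dense D.

Section operators.
Context {R : realType}.
Implicit Types H Y : hilbertType R.

(* The norm of a module over R[i] takes its values in R[i]. *)
Definition rnorm H (x : H) : R := complex.Re `|x|.

(* In R[i], [0 <= z] means that z is real and nonnegative; on a complex
   Hilbert space this makes A self-adjoint. *)
Definition positive_op H (A : H -> H) : Prop :=
  forall x, 0 <= inner (A x) x.

Definition resolvent_set H (A : H -> H) : set R[i] :=
  [set z | exists B : {linear H -> H},
     [/\ continuous B, cancel (fun x => A x - z *: x) B
       & cancel B (fun x => A x - z *: x)]].

Definition spectrum H (A : H -> H) : set R[i] := ~` resolvent_set A.

Definition poly_op H (p : {poly R[i]}) (A : H -> H) (x : H) : H :=
  \sum_(k < size p) p`_k *: iter k A x.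

(* [cfc A f B]: B is the value f(A) of the continuous functional calculus of
   the self-adjoint operator A, the unique continuous extension, from
   polynomials to continuous functions on the spectrum (with the supremum
   norm), of the map p |-> p(A) (with the operator norm). *)
Definition cfc H (A : H -> H) (f : R[i] -> R[i]) (B : H -> H) : Prop :=
  exists p : nat -> {poly R[i]},
    (forall e : R, 0 < e -> \forall n \near \oo,
       forall z, spectrum A z -> `|(p n).[z] - f z| <= e%:C) /\
    (forall e : R, 0 < e -> \forall n \near \oo,
       forall x, rnorm (poly_op (p n) A x - B x) <= e * rnorm x).

(* A^t for A positive, bounded and t >= 0. For such A and t > 0 exactly one B
   satisfies [cfc], so that the default value of [xget] is irrelevant; the
   spectrum lies in the nonnegative half-line, where [z] is [Re z]; and
   [0 `^ t = 0] for t > 0. *)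
Definition op_power H (A : H -> H) (t : R) : H -> H :=
  if t == 0 then id
  else xget (fun=> 0) [set B | cfc A (fun z => (complex.Re z `^ t)%:C) B].

Definition exactly_observable (I : choiceType) (J : set I) H Y
    (F : I -> H -> Y) : Prop :=
  exists a b : R, [/\ 0 < a, a <= b & forall x : H,
    ((a * rnorm x ^+ 2)%:E <= \esum_(j in J) (rnorm (F j x) ^+ 2)%:E
       <= (b * rnorm x ^+ 2)%:E)%E].

Definition locally_finite (T : set R) : Prop :=
  forall r : R, 0 < r -> finite_set (T `&` `[0, r]).

Definition universal_time_set (T : set R) : Prop :=
  [/\ T `<=` `[0, +oo[,
      locally_finite T
    & forall (H Y : hilbertType R) (A : {linear H -> H}) (C : {linear H -> Y}),
        separable H -> separable Y ->
        continuous A -> positive_op A -> continuous C ->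
        exactly_observable [set: nat] (fun n x => C (iter n A x)) ->
        exactly_observable T (fun t x => C (op_power A t x))].

Definition time_seq (N : nat) (c gamma : R) (k : nat) : R :=
  if k is 0%N then 0 else N%:R * k%:R + c * k%:R `^ gamma.

End operators.

(* Main.v *)
(* For gamma > 1 the times are sparse: t_k >= M k eventually, for every M. Let A
   be the diagonal operator on l2 with eigenvalues l_j = 1 - 1/(j+1), and
   C = (I - A^2)^(1/2). Then sum_n |C A^n x|^2 telescopes to |x|^2, while for the
   eigenvector e_j the sum over T is (1 - l_j^2) sum_k l_j^(2 t_k), which tends
   to 0.

   For gamma <= 1 the gaps t_(k+1) - t_k are at least 1 and tend to some tau.
   Observability makes A a positive contraction. The expansion of
   A^(1+d) - A in powers of I - A has coefficients O(d) with a summable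
   majorant, so small perturbations of the times are harmless, and {C A^t} is
   Bessel along T. For the lower bound, suppose the observation of x along T is
   small. As sum 1/t_k diverges, Muntz's theorem approximates A^s by
   combinations of the A^(t_k), so |C A^s x| is small for each s. Since
   t_k + tau is close to t_(k+1) for large k, the observation along T + m tau is
   small for every m; by Muntz's theorem again, so is the one along T + s for
   every s >= 0. Finitely many such shifts come close to all integers, so
   sum_n |C A^n x|^2 is small, and hence so is x. *)

Require Import Defs.
From HB Require Import structures.
From mathcomp Require Import all_boot all_order all_algebra.
From mathcomp Require Import complex.
From mathcomp Require Import all_classical all_reals all_analysis.
From mathcomp Require Import ring lra zify.

Set Implicit Arguments.
Unset Strict Implicit.
Unset Printing Implicit Defensive.

Import Order.TTheory GRing.Theory Num.Theory.
Import numFieldNormedType.Exports.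

Local Open Scope classical_set_scope.
Local Open Scope ring_scope.

(** * Uniform approximation on the unit interval *)

Section Approximation.
Context {R : realType}.
Implicit Types (f g : R -> R) (x M : R).

(** The expansion concerns A^(1 + d) - A and not A^d - I for a reason: if 0 lies in the spectrum,
    A^d does not tend to I in norm as d -> 0, and the coefficients of (1 - y)^d have absolute sum 2
    for every d in (0, 1). One factor A cures this, so that every perturbation consumes one unit of
    time; this explains the recurring offset 1 and the separate treatment of time 0. In place of the
    spectral theorem stands one estimate: the norm of p(A) is at most the supremum of |p| on the
    spectrum. Every identity between powers of A is then obtained by approximation with polynomials
    on [0, 1]. Muntz's theorem is needed in the uniform norm, and its coefficients enter the
    constants, which must be the same for all vectors x. *)

Definition interior_derivable f f' :=
  [/\ forall x, 0 < x < 1 -> is_derive x 1 f (f' x),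
      f x @[x --> 0^'+] --> f 0 & f x @[x --> 1^'-] --> f 1].

Lemma max_principle_le f f' M : interior_derivable f f' ->
  (forall x, 0 < x < 1 -> f' x = 0 -> f x <= M) -> f 0 <= M -> f 1 <= M ->
  forall x, 0 <= x <= 1 -> f x <= M.
Proof.
move=> [df f0 f1] fM M0 M1 x x01.
have cf : {within `[0, 1], continuous f}.
  apply/(continuous_within_itvP _ ltr01); split => // y; rewrite in_itv/= => y01.
  have := df _ y01 => dfy.
  by apply: differentiable_continuous; apply/derivable1_diffP; exact: ex_derive.
have [c c01 cM] := EVT_max ler01 cf.
apply: (le_trans (cM x _)); first by rewrite in_itv.
move: c01; rewrite in_itv/= => /andP[c0 c1].
have [->//|cn0] := eqVneq c 0.
have [->//|cn1] := eqVneq c 1.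
have ci : 0 < c < 1 by rewrite !lt_neqAle c0 c1 cn1 eq_sym cn0.
apply: fM => //.
have := df _ ci => dfc.
have dfc0 : is_derive c 1 f 0.
  apply: (@derive1_at_max _ f 0 1) => // t; rewrite in_itv/= => t01.
    by have := df _ t01 => dft; exact: ex_derive.
  by apply: cM; rewrite in_itv/=; case/andP: t01 => /ltW-> /ltW->.
by rewrite -(@derive_val _ _ _ _ _ _ _ dfc) (@derive_val _ _ _ _ _ _ _ dfc0).
Qed.

Lemma interior_derivableN f f' : interior_derivable f f' ->
  interior_derivable (fun x => - f x) (fun x => - f' x).
Proof.
move=> [df f0 f1]; split; [|exact: cvgN|exact: cvgN].
by move=> x /df dfx; exact: is_deriveN.
Qed.

Lemma interior_derivableD f f' g g' :
  interior_derivable f f' -> interior_derivable g g' ->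
  interior_derivable (fun x => f x + g x) (fun x => f' x + g' x).
Proof.
move=> [df f0 f1] [dg g0 g1]; split; [|exact: cvgD|exact: cvgD].
by move=> x x01; have dfx := df _ x01; have dgx := dg _ x01; exact: is_deriveD.
Qed.

Lemma interior_derivableZ f f' (a : R) : interior_derivable f f' ->
  interior_derivable (fun x => a * f x) (fun x => a * f' x).
Proof.
move=> [df f0 f1]; split; [|exact: cvgMr|exact: cvgMr].
by move=> x /df dfx; exact: is_deriveZ.
Qed.

Lemma interior_derivable_sum n (F F' : nat -> R -> R) :
  (forall k, (k < n)%N -> interior_derivable (F k) (F' k)) ->
  interior_derivable (fun x => \sum_(k < n) F k x) (fun x => \sum_(k < n) F' k x).
Proof.
elim: n => [|n IH] Fn.
  under eq_fun do rewrite big_ord0.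
  under [X in interior_derivable _ X]eq_fun do rewrite big_ord0.
  split; [|exact: cvg_cst|exact: cvg_cst].
  by move=> x _; exact: is_derive_cst.
under eq_fun do rewrite big_ord_recr/=.
under [X in interior_derivable _ X]eq_fun do rewrite big_ord_recr/=.
by apply: interior_derivableD; [apply: IH => k kn; apply: Fn; exact: ltnW|exact: Fn].
Qed.

(** For s < 1 the derivative is unbounded near 0; hence [interior_derivable] asks only for one-sided
    continuity at the end points. *)
Lemma interior_derivable_powR (s : R) : 0 < s ->
  interior_derivable (fun x => x `^ s) (fun x => s * x `^ (s - 1)).
Proof.
move=> s0; split.
- by move=> x /andP[x0 _]; exact: is_derive1_powR.
- by rewrite powR0 ?gt_eqF//; exact: powR_cvg0.
- have d1 := @is_derive1_powR _ s 1 ltr01.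
  have /derivable1_diffP/differentiable_continuous c1 := @ex_derive _ _ _ _ _ _ _ d1.
  exact: cvg_at_left_filter c1.
Qed.

Lemma interior_derivable_horner (p : {poly R}) :
  interior_derivable (fun x => p.[x]) (fun x => p^`().[x]).
Proof.
split.
- by move=> x _; exact: is_derive_poly.
- by apply: cvg_at_right_filter; exact: continuous_horner.
- by apply: cvg_at_left_filter; exact: continuous_horner.
Qed.

(* At an interior extremum f' vanishes, so a first-order differential equation
   satisfied by f bounds f there. *)
Lemma max_principle f f' M : interior_derivable f f' ->
  (forall x, 0 < x < 1 -> f' x = 0 -> `|f x| <= M) -> `|f 0| <= M ->
  `|f 1| <= M -> forall x, 0 <= x <= 1 -> `|f x| <= M.
Proof.
move=> df fM M0 M1 x x01; rewrite ler_norml lerNl; apply/andP; split.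
  apply: (max_principle_le (interior_derivableN df)) => //.
  - move=> y y01 /eqP; rewrite oppr_eq0 => /eqP fy.
    by apply: le_trans (fM _ y01 fy); rewrite -normrN ler_norm.
  - by apply: le_trans M0; rewrite -normrN ler_norm.
  - by apply: le_trans M1; rewrite -normrN ler_norm.
apply: (max_principle_le df) => //.
- by move=> y y01 fy; apply: le_trans (fM _ y01 fy); rewrite ler_norm.
- by apply: le_trans M0; rewrite ler_norm.
- by apply: le_trans M1; rewrite ler_norm.
Qed.

Lemma powR_derivM (s x : R) : 0 < x -> x * (s * x `^ (s - 1)) = s * x `^ s.
Proof.
move=> x0; rewrite mulrCA; congr (_ * _).
by rewrite -{1}(powRr1 (ltW x0)) -powRD ?(gt_eqF x0) ?implybT// addrC subrK.
Qed.

Lemma powR_le1 (x s : R) : 0 <= x <= 1 -> 0 <= s -> x `^ s <= 1.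
Proof.
move=> /andP[x0 x1] s0; have : x `^ s <= 1 `^ s by rewrite ge0_ler_powR ?nnegrE.
by rewrite powR1.
Qed.

(* Von Golitschek's recursion: Q_n solves x Q_n' = tau_n Q_n - (tau_n - q) Q_(n-1)
   with Q_n(1) = 0, so that |Q_n| <= |1 - q / tau_n| sup |Q_(n-1)|. *)
Lemma muntz_bound (q : R) (tau : nat -> R) n :
  0 < q -> (forall k, 0 < tau k) -> injective tau ->
  exists a : nat -> R, forall x, 0 <= x <= 1 ->
    `|x `^ q - \sum_(k < n) a k * x `^ tau k| <= \prod_(k < n) `|1 - q / tau k|.
Proof.
move=> q0 tau0 tauI; elim: n => [|n [a IH]].
  exists (fun=> 0) => x x01; rewrite !big_ord0 subr0 ger0_norm ?powR_ge0//.
  exact: (powR_le1 _ (ltW q0)).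
(* Comparing the coefficients of x^(tau_k) in the differential equation gives [b0]. The power
   x^(tau_n) solves the homogeneous equation, so its coefficient is free and is fixed by Q(1) =
   0. *)
pose b0 k := a k * (tau n - q) / (tau n - tau k).
pose b k := if k == n then 1 - \sum_(k < n) b0 k else b0 k.
exists b => x x01; rewrite big_ord_recr/= [in leRHS]big_ord_recr/=.
pose P y := y `^ q - \sum_(k < n) a k * y `^ tau k.
have bE y : \sum_(i < n) b i * y `^ tau i = \sum_(i < n) b0 i * y `^ tau i.
  by apply: eq_bigr => i _; rewrite /b ltn_eqF.
pose Q y := y `^ q + (- 1) * (\sum_(k < n.+1) b k * y `^ tau k).
pose Q' y := q * y `^ (q - 1) +
  (- 1) * (\sum_(k < n.+1) b k * (tau k * y `^ (tau k - 1))).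
rewrite -[`|_ - _|]/(`|x `^ q - _|) (_ : x `^ q - _ = Q x); last first.
  by rewrite /Q big_ord_recr/= mulN1r.
have dQ : interior_derivable Q Q'.
  apply: interior_derivableD; first exact: interior_derivable_powR.
  apply: interior_derivableZ; apply: (@interior_derivable_sum _
    (fun k y => b k * y `^ tau k) (fun k y => b k * (tau k * y `^ (tau k - 1)))).
  by move=> k _; apply: interior_derivableZ; exact: interior_derivable_powR.
have M0 : 0 <= \prod_(i < n) `|1 - q / tau i| * `|1 - q / tau n|.
  by rewrite mulr_ge0// prodr_ge0.
apply: (max_principle dQ) => //.
- move=> y y01 Q'y; case/andP: (y01) => y0 y1.
  have ode : y * Q' y = tau n * Q y - (tau n - q) * P y.
    rewrite /Q' mulrDr powR_derivM// mulrCA mulr_sumr.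
    under eq_bigr do rewrite mulrCA powR_derivM//.
    rewrite /Q !big_ord_recr/= bE.
    rewrite [in LHS](eq_bigr (fun k : 'I_n => b0 k * (tau k * y `^ tau k))); last first.
      by move=> i _; rewrite /b ltn_eqF.
    rewrite /P.
    have E : (\sum_(k < n) a k * y `^ tau k) * (tau n - q) =
        tau n * (\sum_(k < n) b0 k * y `^ tau k) -
        \sum_(k < n) b0 k * (tau k * y `^ tau k).
      rewrite mulr_suml mulr_sumr -sumrB; apply: eq_bigr => i _; rewrite /b0.
      have : tau n - tau i != 0.
        by rewrite subr_eq0; apply/eqP => /tauI/eqP; rewrite gtn_eqF.
      by move=> ?; field.
    by rewrite mulrBr [(_ - q) * (\sum_(_ < _) _)]mulrC E; ring.
  have /eqP : tau n * Q y - (tau n - q) * P y = 0 by rewrite -ode Q'y mulr0.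
  rewrite subr_eq0 => /eqP Qy.
  have -> : Q y = P y * (1 - q / tau n).
    apply: (mulfI (lt0r_neq0 (tau0 n))); rewrite Qy; field.
    exact: lt0r_neq0.
  by rewrite normrM ler_wpM2r// IH// ltW//= ltW.
- rewrite /Q powR0 ?lt0r_neq0// add0r big1 ?mulr0 ?normr0// => i _.
  by rewrite powR0 ?mulr0// lt0r_neq0.
- rewrite /Q big_ord_recr/= bE powR1 /b eqxx /= mulr1.
  under eq_bigr do rewrite mulr1.
  by rewrite addrCA subrr addr0 mulr1 subrr normr0.
Qed.


(** Oresme's blocks: the first K + 1 terms are each at least 1 / (2 (K + 1)) and add up to 1/2; the
    induction continues from 2 K + 1. *)
Lemma harmonic_unbounded (j K : nat) :
  exists n, j%:R / 2 <= \sum_(k < n) (k + K).+1%:R^-1 :> R.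
Proof.
elim: j K => [|j IH] K; first by exists 0%N; rewrite big_ord0 mul0r.
have [n nj] := IH (K.+1 + K)%N; exists (K.+1 + n)%N.
rewrite big_split_ord/= -natr1 mulrDl mul1r addrC lerD//.
  apply: le_trans nj _; rewrite le_eqVlt; apply/orP; left; apply/eqP.
  by apply: eq_bigr => i _; rewrite addnCA addnA.
have -> : (2^-1 : R) = \sum_(k < K.+1) (2 * K.+1)%:R^-1.
  by rewrite sumr_const card_ord -mulr_natr natrM; field; rewrite nat1r pnatr_eq0.
apply: ler_sum => k _; rewrite lef_pV2 ?posrE ?ltr0n// ler_nat.
have := ltn_ord k; lia.
Qed.

(** Since (1 - u)(1 + S + u) <= 1 + S. A divergent sum thus forces the product to 0, without
    logarithms. *)
Lemma prod_1B_le (u : nat -> R) n : (forall k, 0 <= u k <= 1) ->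
  \prod_(k < n) (1 - u k) * (1 + \sum_(k < n) u k) <= 1.
Proof.
move=> u01; elim: n => [|n IH]; first by rewrite !big_ord0 addr0 mulr1.
rewrite !big_ord_recr/=; apply: le_trans IH; rewrite -mulrA ler_wpM2l//.
  by rewrite prodr_ge0// => k _; rewrite subr_ge0; case/andP: (u01 k).
have /andP[un0 _] := u01 n.
have S0 : 0 <= \sum_(k < n) u k by rewrite sumr_ge0// => k _; case/andP: (u01 k).
by nra.
Qed.

Lemma muntz (q m : R) (tau : nat -> R) (e : R) :
  0 < q -> injective tau -> (forall k, k.+1%:R <= tau k <= m * k.+1%:R) ->
  0 < e ->
  exists n (a : nat -> R), forall x, 0 <= x <= 1 ->
    `|x `^ q - \sum_(k < n) a k * x `^ tau k| <= e.
Proof.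
move=> q0 tauI taum e0.
have tau0 k : 0 < tau k by case/andP: (taum k) => + _; apply: lt_le_trans; rewrite ltr0n.
have m0 : 0 < m.
  by have /andP[_] := taum 0%N; rewrite mulr1; apply: lt_le_trans.
(* From index K on, q <= tau_k and the factors lie in [0, 1]. The K earlier factors may exceed 1 and
   are collected in [P0]. *)
pose K := `|Num.ceil q|%N.
have qK : q <= K%:R.
  by apply: le_trans (ceil_ge q) _; rewrite natr_absz ler_int ler_norm.
pose u k := q / tau (k + K)%N.
have u01 k : 0 <= u k <= 1.
  rewrite /u divr_ge0 ?(ltW q0) ?(ltW (tau0 _))//= ler_pdivrMr ?tau0// mul1r (le_trans qK)//.
  have /andP[+ _] := taum (k + K)%N; apply: le_trans.
  by rewrite ler_nat; lia.
pose P0 := \prod_(k < K) `|1 - q / tau k|.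
have P00 : 0 <= P0 by rewrite prodr_ge0.
(* Once the sum of the [u k] reaches [B], the product of all factors is at most P0 / (1 + B) <=
   e. *)
pose B := P0 / e.
have [n nB] := harmonic_unbounded `|Num.ceil (2 * (B * m / q))|%N K.
have {}nB : B * m / q <= \sum_(k < n) (k + K).+1%:R^-1.
  apply: le_trans nB; rewrite ler_pdivlMr// mulrC.
  by apply: le_trans (ceil_ge _) _; rewrite natr_absz ler_int ler_norm.
have uB : B <= \sum_(k < n) u k.
  apply: (@le_trans _ _ (q / m * \sum_(k < n) (k + K).+1%:R^-1)).
    have -> : B = q / m * (B * m / q) by field; rewrite !lt0r_neq0.
    by rewrite ler_wpM2l// divr_ge0// ltW.
  rewrite mulr_sumr; apply: ler_sum => k _; rewrite /u -mulrA ler_wpM2l//; first exact: ltW.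
  rewrite -invfM lef_pV2 ?posrE ?mulr_gt0 ?ltr0n//.
  by case/andP: (taum (k + K)%N).
have [a aP] := muntz_bound (K + n) q0 tau0 tauI.
exists (K + n)%N, a => x x01; apply: le_trans (aP x x01) _.
rewrite big_split_ord/= -/P0.
have -> : \prod_(i < n) `|1 - q / tau (K + i)%N| = \prod_(k < n) (1 - u k).
  apply: eq_bigr => i _; rewrite addnC ger0_norm//.
  by rewrite subr_ge0; case/andP: (u01 i).
have P1 := prod_1B_le n u01.
set p := \prod_(k < n) (1 - u k) in P1 *; set S := \sum_(k < n) u k in P1 uB.
have p0 : 0 <= p by rewrite prodr_ge0// => k _; rewrite subr_ge0; case/andP: (u01 k).
have : p * B <= 1 by apply: le_trans P1; rewrite ler_wpM2l// (le_trans uB)// lerDr.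
by rewrite mulrC /B mulrAC ler_pdivrMr// mul1r.
Qed.

(* The coefficients of (1 - y)^(1 + d) as a power series in y. *)
Fixpoint binomial_coef (d : R) (i : nat) : R :=
  if i is j.+1 then binomial_coef d j * ((j%:R - 1 - d) / j.+1%:R) else 1.

Arguments binomial_coef : simpl never.

Definition binomial_poly (d : R) (n : nat) : {poly R} :=
  \sum_(i < n) binomial_coef d i *: (1 - 'X) ^+ i.

Lemma binomial_coefS (d : R) n : n.+1%:R * binomial_coef d n.+1 =
  (n%:R - (1 + d)) * binomial_coef d n.
Proof. by rewrite /binomial_coef -/binomial_coef; field; rewrite nat1r pnatr_eq0. Qed.

(** The factor d enters at index 2 and stays; afterwards the ratio of consecutive coefficients is (i
    + 1 - d) / (i + 3), at most the ratio of the telescoping majorants. *)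
Lemma binomial_coef_bound (d : R) i : 0 <= d <= 1 ->
  `|binomial_coef d i.+2| <= 2 * d / (i.+1 * i.+2)%:R.
Proof.
move=> /andP[d0 d1]; elim: i => [|i IH].
  have -> : binomial_coef d 2 = (1 + d) * d / 2 by rewrite /binomial_coef; field.
  rewrite ger0_norm; last by rewrite divr_ge0// mulr_ge0// addr_ge0.
  by rewrite mul1n ler_wpM2r ?invr_ge0// ler_wpM2r//; lra.
have -> : 2 * d / (i.+2 * i.+3)%:R = 2 * d / (i.+1 * i.+2)%:R * (i.+1%:R / i.+3%:R) :> R.
  by rewrite !natrM; field; rewrite -!natrD nat1r !pnatr_eq0.
have -> : binomial_coef d i.+3 =
  binomial_coef d i.+2 * ((i.+2%:R - 1 - d) / i.+3%:R) by [].
rewrite normrM ler_pM//.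
rewrite normrM (@ger0_norm _ (_^-1)) ?invr_ge0// ler_wpM2r ?invr_ge0//.
have -> : i.+2%:R - 1 - d = i.+1%:R - d by ring.
by rewrite ger0_norm ?subr_ge0 ?(le_trans d1) ?ler1n// lerBlDr lerDl.
Qed.

(** The power x^(1 + d) solves x f' = (1 + d) f; the truncated series misses this equation only by a
    term with the first omitted coefficient. *)
Lemma binomial_poly_ode (d : R) n (x : R) :
  x * (binomial_poly d n.+1)^`().[x] = (1 + d) * (binomial_poly d n.+1).[x] +
    n.+1%:R * binomial_coef d n.+1 * (1 - x) ^+ n.
Proof.
elim: n => [|n IH].
  rewrite /binomial_poly big_ord1 expr0 /binomial_coef scale1r -polyC1 derivC !hornerC.
  by field.
rewrite [binomial_poly d n.+2]/binomial_poly big_ord_recr.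
rewrite -/(binomial_poly d n.+1) derivD derivZ deriv_exp derivB -polyC1 derivC derivX.
rewrite sub0r !(hornerD, hornerZ, horner_exp, hornerN, hornerC, hornerX, hornerM, hornerMn).
rewrite mulrDr IH (binomial_coefS _ n.+1) /= -mulr_natr exprS.
set b1 := binomial_coef d n.+1; set P := (binomial_poly d n.+1).[x].
set X := (1 - x) ^+ n.
by ring.
Qed.


(** Where the derivative of the difference f vanishes, (1 + d) f equals the defect in
    [binomial_poly_ode], and so it does at x = 0; at x = 1 both functions are 1. The bound is
    uniform in d. *)
Lemma binomial_approx (d : R) n (x : R) : 0 <= d <= 1 -> 0 <= x <= 1 ->
  `|x `^ (1 + d) - (binomial_poly d n.+2).[x]| <= 2 / n.+1%:R.
Proof.
move=> d01 x01; case/andP: (d01) => d0 d1.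
have D0 : 0 < 1 + d by rewrite ltr_wpDr.
pose f y := y `^ (1 + d) + (-1) * (binomial_poly d n.+2).[y].
pose f' y := (1 + d) * y `^ (1 + d - 1) + (-1) * (binomial_poly d n.+2)^`().[y].
have -> : x `^ (1 + d) - (binomial_poly d n.+2).[x] = f x by rewrite /f mulN1r.
have df : interior_derivable f f'.
  apply: interior_derivableD; first exact: interior_derivable_powR.
  by apply: interior_derivableZ; exact: interior_derivable_horner.
have bound x0 : 0 <= x0 <= 1 ->
    `|n.+2%:R * binomial_coef d n.+2 * (1 - x0) ^+ n.+1 / (1 + d)| <= 2 / n.+1%:R.
  move=> /andP[y0 y1].
  have X1 : `|(1 - x0) ^+ n.+1| <= 1.
    by rewrite normrX exprn_ile1// ger0_norm ?subr_ge0// gerBl.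
  have bn : `|n.+2%:R * binomial_coef d n.+2| <= 2 / n.+1%:R.
    rewrite normrM (@ger0_norm _ n.+2%:R)//.
    apply: (@le_trans _ _ (n.+2%:R * (2 * d / (n.+1 * n.+2)%:R))).
      by rewrite ler_wpM2l// binomial_coef_bound.
    have -> : n.+2%:R * (2 * d / (n.+1 * n.+2)%:R) = d * (2 / n.+1%:R).
      by rewrite natrM; field; rewrite -natrD nat1r !pnatr_eq0.
    by rewrite ler_piMl// divr_ge0.
  have [D1 Di] : 0 <= (1 + d)^-1 /\ (1 + d)^-1 <= 1.
    by rewrite invr_ge0 ltW//= invf_le1//= lerDl.
  rewrite normrM normrM (@ger0_norm _ (_^-1))//.
  rewrite -[leRHS]mulr1 ler_pM ?mulr_ge0// -[leRHS]mulr1 ler_pM//.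
apply: (max_principle df) => //.
- move=> y y01 f'y; case/andP: (y01) => y0 y1.
  have := bound y; rewrite (ltW y0) (ltW y1) => /(_ isT).
  suff -> : f y = n.+2%:R * binomial_coef d n.+2 * (1 - y) ^+ n.+1 / (1 + d) by [].
  apply: (mulfI (lt0r_neq0 D0)); rewrite mulrC [RHS]mulrC divfK ?lt0r_neq0//.
  have : y * f' y = 0 by rewrite f'y mulr0.
  rewrite /f' mulrDr powR_derivM// mulrCA binomial_poly_ode /f => /eqP.
  by rewrite -subr_eq0 => /eqP E; apply/eqP; rewrite -subr_eq0 -E; apply/eqP; ring.
- have := bound 0; rewrite lexx ler01 => /(_ isT).
  suff -> : f 0 = n.+2%:R * binomial_coef d n.+2 * (1 - 0) ^+ n.+1 / (1 + d) by [].
  apply: (mulfI (lt0r_neq0 D0)); rewrite mulrC [RHS]mulrC divfK ?lt0r_neq0//.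
  have := binomial_poly_ode d n.+1 0; rewrite mul0r /f powR0 ?lt0r_neq0// => E.
  by apply/eqP; rewrite -subr_eq0 -[X in _ == X]oppr0 [in X in _ == X]E; apply/eqP; ring.
- have -> : f 1 = 0.
    rewrite /f powR1 /binomial_poly horner_sum big_ord_recl/= big1 => [|i _].
      by rewrite scale1r expr0 hornerC addr0 mulr1 subrr.
    by rewrite hornerZ horner_exp hornerD hornerN hornerX hornerC subrr expr0n mulr0.
  by rewrite normr0 divr_ge0.
Qed.


End Approximation.
Arguments binomial_coef {R} d i : simpl never.

(** * Operators on a Hilbert space *)

Local Open Scope complex_scope.

Lemma ReMr (R : realType) (a : R) (z : R[i]) :
  complex.Re (a%:C * z) = a * complex.Re z.
Proof. by case: z => x y /=; rewrite mul0r subr0. Qed.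

Lemma ReD (R : realType) (z w : R[i]) :
  complex.Re (z + w) = complex.Re z + complex.Re w.
Proof. by case: z => ? ?; case: w. Qed.

Lemma ReN (R : realType) (z : R[i]) : complex.Re (- z) = - complex.Re z.
Proof. by case: z. Qed.

(** This one inequality yields every Cauchy-Schwarz estimate of the proof: for positive forms, for
    weighted sums and for l2. *)
Lemma quadratic_ge0_discr (R : realType) (a b c : R) :
  (forall t, 0 <= a + 2 * b * t + c * t ^+ 2) -> b ^+ 2 <= a * c.
Proof.
move=> H; have a0 : 0 <= a by have := H 0; rewrite mulr0 expr0n/= mulr0 !addr0.
have [c0|c0|c0] := ltgtP c 0.
(* For c < 0 the chosen values of t make the quadratic negative, a contradiction; for c > 0 the
   vertex is taken. *)
- have [b0|bn0] := eqVneq b 0.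
    have := H ((a + 1) / - c + 1); rewrite b0.
    have cc : c * ((a + 1) / - c) = - (a + 1) by field; rewrite lt_eqF.
    have d0 : 0 <= (a + 1) / - c by rewrite divr_ge0 ?addr_ge0// oppr_ge0 ltW.
    set d := (a + 1) / - c in cc d0 *; nra.
  have := H (- (a + 1) / b).
  have cc : b * (- (a + 1) / b) = - (a + 1) by field.
  set d := - (a + 1) / b in cc *; nra.
- have := H (- b / c).
  have cc : c * (- b / c) = - b by field; rewrite gt_eqF.
  set d := - b / c in cc *; nra.
- rewrite c0 mulr0; have [->|bn0] := eqVneq b 0; first by rewrite expr0n.
  have := H (- (a + 1) / b); rewrite c0 mul0r addr0.
  have -> : a + 2 * b * (- (a + 1) / b) = - a - 2 by field.
  lra.
Qed.

Section HilbertBasics.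
Context {R : realType}.
Implicit Types H Y : hilbertType R.

Definition rip H (x y : H) : R := complex.Re (inner x y).

Lemma normE H (x : H) : `|x| = (rnorm x)%:C.
Proof.
have /ger0_Im := normr_ge0 x; rewrite /rnorm.
by case: `|x| => a b /= ->.
Qed.

Lemma rnorm_ge0 H (x : H) : 0 <= rnorm x.
Proof. by have := normr_ge0 x; rewrite normE ler0c. Qed.

Lemma rnormD H (x y : H) : rnorm (x + y) <= rnorm x + rnorm y.
Proof. by rewrite -lecR rmorphD/= -!normE ler_normD. Qed.

Lemma rnormZ H (a : R[i]) (x : H) : rnorm (a *: x) = complex.Re `|a| * rnorm x.
Proof. by rewrite {1}/rnorm normrZ normE mulrC ReMr mulrC. Qed.

Lemma rnormZr H (a : R) (x : H) : rnorm (a%:C *: x) = `|a| * rnorm x.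
Proof. by rewrite rnormZ normc_def /= expr0n addr0 sqrtr_sqr. Qed.

Lemma rnorm0 H : rnorm (0 : H) = 0.
Proof. by rewrite /rnorm normr0. Qed.

Lemma rnorm_eq0 H (x : H) : rnorm x = 0 -> x = 0.
Proof. by move=> x0; apply/normr0_eq0; rewrite normE x0. Qed.

Lemma rnormN H (x : H) : rnorm (- x) = rnorm x.
Proof. by rewrite /rnorm normrN. Qed.

Lemma rnormB H (x y : H) : rnorm (x - y) = rnorm (y - x).
Proof. by rewrite /rnorm distrC. Qed.

Lemma rnorm_sum H (I : Type) (r : seq I) (P : pred I) (F : I -> H) :
  rnorm (\sum_(i <- r | P i) F i) <= \sum_(i <- r | P i) rnorm (F i).
Proof.
elim/big_rec2: _ => [|i a b _ ab]; first by rewrite rnorm0.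
by apply: le_trans (rnormD _ _) _; rewrite lerD2l.
Qed.

Lemma sqr_rnorm H (x : H) : rnorm x ^+ 2 = rip x x.
Proof.
rewrite /rip innerE normE -rmorphXn /=.
by [].
Qed.

Lemma innerDl H (x y z : H) : inner (x + y) z = inner x z + inner y z.
Proof. by rewrite linearDl. Qed.
Lemma innerDr H (x y z : H) : inner z (x + y) = inner z x + inner z y.
Proof. by rewrite linearD. Qed.
Lemma innerZl H a (x y : H) : inner (a *: x) y = a * inner x y.
Proof. by rewrite linearZl_LR. Qed.
Lemma innerZr H a (x y : H) : inner x (a *: y) = conjc a * inner x y.
Proof. by rewrite linearZr_LR. Qed.
Lemma inner_conj H (x y : H) : inner x y = conjc (inner y x).
Proof. by rewrite hermC expr0 mul1r. Qed.

End HilbertBasics.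

Section Operators.
Context {R : realType} {H : hilbertType R}.
Implicit Types (x y z : H) (A : {linear H -> H}) (p q : {poly R[i]}).

Definition symmetric_op (A : H -> H) : Prop :=
  forall x y, inner (A x) y = inner x (A y).

Definition rbounded (Y : hilbertType R) (f : H -> Y) : Prop :=
  exists2 M : R, 0 <= M & forall x, rnorm (f x) <= M * rnorm x.

Lemma continuous_rbounded (Y : hilbertType R) (f : {linear H -> Y}) :
  continuous f -> rbounded f.
Proof.
move=> /linear_bounded_continuous /linear_boundedP /pinfty_ex_gt0 [M M0 fM].
exists (complex.Re M) => [|x].
  by move: M0; rewrite ltcE => /andP[_ /ltW].
have := fM x; rewrite !normE.
have -> : M = (complex.Re M)%:C.
  by move: (gtr0_real M0) => /RRe_real.
by rewrite -rmorphM /= lecR.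
Qed.

Lemma rbounded_continuous (f : {linear H -> H}) : rbounded f -> continuous f.
Proof.
move=> [M M0 fM]; apply/linear_bounded_continuous/linear_boundedP.
exists M%:C; split; first by rewrite complex_real.
move=> r Mr x; rewrite !normE; apply: le_trans (_ : (M * rnorm x)%:C <= _).
  by rewrite lecR.
by rewrite rmorphM/= ler_wpM2r ?ler0c ?rnorm_ge0// ltW.
Qed.

(** Polarization: the form is real at x + y and at x + i y, which gives one real equation each for
    the imaginary and the real parts. *)
Lemma positive_symmetric A : positive_op A -> symmetric_op A.
Proof.
move=> A0 x y; rewrite (inner_conj x).
have ImA u : complex.Im (inner (A u) u) = 0 by rewrite ger0_Im.
have := ImA (x + y); rewrite (linearD A) !innerDl !innerDr.
have := ImA (x + 'i *: y); rewrite (linearD A) (linearZZ A) !innerDl !innerDr !innerZl !innerZr.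
move: (ImA x) (ImA y).
case: (inner (A x) x) => a1 b1; case: (inner (A y) y) => a2 b2.
case: (inner (A x) y) => a3 b3; case: (inner (A y) x) => a4 b4 /= -> ->.
rewrite !(mul0r, mulr0, mul1r, addr0, add0r, mulr1, subr0, sub0r, oppr0, mulN1r, mulrN1) => e1 e2.
by congr Complex; lra.
Qed.

Lemma sym_rip A x y : symmetric_op A -> rip (A x) y = rip (A y) x.
Proof. by move=> Asym; rewrite /rip Asym inner_conj; case: (inner _ _). Qed.

Lemma ripDl x y z : rip (x + y) z = rip x z + rip y z.
Proof. by rewrite /rip innerDl ReD. Qed.
Lemma ripDr x y z : rip z (x + y) = rip z x + rip z y.
Proof. by rewrite /rip innerDr ReD. Qed.
Lemma ripZl (a : R) x y : rip (a%:C *: x) y = a * rip x y.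
Proof. by rewrite /rip innerZl ReMr. Qed.
Lemma ripZr (a : R) x y : rip x (a%:C *: y) = a * rip x y.
Proof. by rewrite /rip innerZr conjc_real ReMr. Qed.
Lemma ripNl x y : rip (- x) y = - rip x y.
Proof. by rewrite -scaleN1r /rip innerZl mulN1r ReN. Qed.
Lemma ripC x y : rip x y = rip y x.
Proof. by rewrite /rip inner_conj; case: (inner _ _). Qed.

Lemma form_Cauchy_Schwarz A x y : symmetric_op A ->
  (forall u, 0 <= rip (A u) u) -> rip (A x) y ^+ 2 <= rip (A x) x * rip (A y) y.
Proof.
move=> Asym A0; apply: quadratic_ge0_discr => t.
have := A0 (x + t%:C *: y).
rewrite (linearD A) (linearZZ A) ripDl !ripDr !ripZl !ripZr (sym_rip y x)//.
by congr (0 <= _); ring.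
Qed.

Lemma Cauchy_Schwarz x y : rip x y <= rnorm x * rnorm y.
Proof.
have := @form_Cauchy_Schwarz idfun x y (fun _ _ => erefl).
rewrite /= -!sqr_rnorm => /(_ _) h.
have {}h : rip x y ^+ 2 <= (rnorm x * rnorm y) ^+ 2.
  by rewrite exprMn h// => u; rewrite -sqr_rnorm exprn_ge0// rnorm_ge0.
rewrite leNgt; apply/negP => xy.
have n0 : 0 <= rnorm x * rnorm y by rewrite mulr_ge0// rnorm_ge0.
by move: h; rewrite leNgt ltrXn2r.
Qed.

(** Cauchy-Schwarz for the form of A with y = A x, divided by |A x|^2. It turns bounds on the form
    into bounds on the norm. *)
Lemma form_norm_le A x (m : R) : symmetric_op A ->
  (forall u, 0 <= rip (A u) u <= m * rnorm u ^+ 2) ->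
  rnorm (A x) ^+ 2 <= m * rip (A x) x.
Proof.
move=> Asym Am.
have := @form_Cauchy_Schwarz A x (A x) Asym.
rewrite -sqr_rnorm => /(_ (fun u => proj1 (andP (Am u)))) h.
have /andP[_ h2] := Am (A x); have /andP[h0 h1] := Am x.
have [->|n0] := eqVneq (rnorm (A x)) 0.
  have [m0|m0] := leP 0 m; first by rewrite expr0n/= mulr_ge0.
  rewrite expr0n/=; have : rip (A x) x = 0; last by move=> ->; rewrite mulr0.
  apply/eqP; rewrite eq_le h0 andbT; apply: le_trans h1 _.
  by rewrite mulr_le0_ge0// ?(ltW m0)// exprn_ge0// rnorm_ge0.
have n1 : 0 < rnorm (A x) ^+ 2 by rewrite exprn_gt0// lt0r n0 rnorm_ge0.
rewrite -(ler_pM2r n1) -expr2; apply: le_trans h _.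
by rewrite mulrAC mulrC ler_wpM2r.
Qed.

Lemma poly_opE n p (A : H -> H) x : (size p <= n)%N ->
  poly_op p A x = \sum_(k < n) p`_k *: iter k A x.
Proof.
move=> pn; rewrite /poly_op (big_ord_widen n (fun k => p`_k *: iter k A x) pn) big_mkcond/=.
apply: eq_bigr => i _; case: ltnP => // h.
by rewrite nth_default// scale0r.
Qed.

Lemma poly_opD p q (A : H -> H) x : poly_op (p + q) A x = poly_op p A x + poly_op q A x.
Proof.
pose n := maxn (size p) (size q).
rewrite (@poly_opE n (p + q)) ?size_polyD// (@poly_opE n p) ?leq_maxl//.
rewrite (@poly_opE n q) ?leq_maxr// -big_split/=.
by apply: eq_bigr => i _; rewrite coefD scalerDl.
Qed.

Lemma poly_opZ a p (A : H -> H) x : poly_op (a *: p) A x = a *: poly_op p A x.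
Proof.
rewrite (@poly_opE (size p) (a *: p)) ?size_scale_leq// /poly_op scaler_sumr.
by apply: eq_bigr => i _; rewrite coefZ scalerA.
Qed.

Lemma poly_opC a (A : H -> H) x : poly_op a%:P A x = a *: x.
Proof.
by rewrite (@poly_opE 1) ?size_polyC_leq1// big_ord1 coefC.
Qed.

Lemma poly_opXM p A x : poly_op (p * 'X) A x = A (poly_op p A x).
Proof.
have pn : (size (p * 'X)%R <= (size p).+1)%N.
  by apply: leq_trans (size_polyMleq _ _) _; rewrite size_polyX addn2.
rewrite (@poly_opE (size p).+1)// big_ord_recl coefMX /= scale0r add0r /poly_op linear_sum.
by apply: eq_bigr => i _; rewrite coefMX /= linearZ.
Qed.

Lemma poly_opM p q A x : poly_op (p * q) A x = poly_op p A (poly_op q A x).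
Proof.
elim/poly_ind: p => [|p c IH]; first by rewrite mul0r /poly_op size_poly0 !big_ord0.
rewrite mulrDl mulrAC poly_opD poly_opXM IH mul_polyC poly_opZ.
by rewrite poly_opD poly_opXM poly_opC.
Qed.

Lemma poly_opX A x : poly_op 'X A x = A x.
Proof. by rewrite -['X]mul1r poly_opXM -polyC1 poly_opC scale1r. Qed.

Lemma poly_op_comm p A x : poly_op p A (A x) = A (poly_op p A x).
Proof. by rewrite -[A x in LHS]poly_opX -poly_opM poly_opXM. Qed.

Lemma poly_opB p q (A : H -> H) x : poly_op (p - q) A x = poly_op p A x - poly_op q A x.
Proof. by rewrite poly_opD -scaleN1r poly_opZ scaleN1r. Qed.

Lemma poly_opXn n A x : poly_op 'X^n A x = iter n A x.
Proof. by elim: n => [|n IH]; rewrite ?expr0 -?polyC1 ?poly_opC ?scale1r// exprSr poly_opXM IH. Qed.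

Lemma poly_op_is_linear p A : linear (poly_op p A).
Proof.
elim/poly_ind: p => [a x y|p c IH a x y].
  by rewrite /poly_op size_poly0 !big_ord0 scaler0 addr0.
rewrite !poly_opD !poly_opXM !poly_opC IH linearP scalerDr scalerA mulrC -scalerA.
by rewrite !scalerDr !addrA; congr (_ + _); rewrite -!addrA; congr (_ + _); rewrite addrC.
Qed.

HB.instance Definition _ p A := GRing.isLinear.Build _ _ _ _ _ (poly_op_is_linear p A).

Lemma poly_op_bounded p A : rbounded A -> rbounded (poly_op p A).
Proof.
move=> [M M0 AM]; elim/poly_ind: p => [|p c [N N0 IH]].
  by exists 0 => // x; rewrite /poly_op size_poly0 big_ord0 rnorm0 mul0r.
have c0 : 0 <= complex.Re `|c| by rewrite normc_def /= sqrtr_ge0.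
exists (M * N + complex.Re `|c|) => [|x]; first by rewrite addr_ge0// mulr_ge0.
rewrite poly_opD poly_opXM poly_opC (le_trans (rnormD _ _))// rnormZ mulrDl lerD2r.
by rewrite (le_trans (AM _))// -mulrA ler_wpM2l.
Qed.

Lemma poly_op_adjoint p A x y : symmetric_op A ->
  inner (poly_op p A x) y = inner x (poly_op (map_poly conjc p) A y).
Proof.
move=> Asym; elim/poly_ind: p x y => [|p c IH] x y.
  by rewrite rmorph0 /poly_op size_poly0 !big_ord0 linear0l linear0.
rewrite rmorphD rmorphM /= map_polyX map_polyC/= !poly_opD !poly_opXM !poly_opC.
rewrite innerDl innerDr innerZl innerZr conjcK Asym IH.
by rewrite poly_op_comm.
Qed.

End Operators.

(** * Neumann series and invertibility *)

Lemma geometric_sum_le (R : realType) (rho : R) k : 0 <= rho < 1 ->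
  \sum_(i < k) rho ^+ i <= (1 - rho)^-1.
Proof.
move=> /andP[r0 r1]; have r1' : 0 < 1 - rho by rewrite subr_gt0.
rewrite -(ler_pM2l r1') divff ?lt0r_neq0// -opprB mulNr -subrX1 opprB.
by rewrite gerBl exprn_ge0.
Qed.

Lemma expr_small (R : realType) (r e : R) : 0 <= r < 1 -> 0 < e -> exists n, r ^+ n <= e.
Proof.
move=> /andP[r0 r1] e0.
have := @cvg_expr R r; rewrite ger0_norm// => /(_ r1) cv.
have [n _ /(_ n (leqnn n))] := @cvgr_dist_le _ _ _ _ _ _ _ cv _ e0.
by rewrite /= sub0r normrN ger0_norm ?exprn_ge0//; exists n.
Qed.

Section Resolvent.
Context {R : realType} {H : hilbertType R}.
Implicit Types (x y : H) (A S : {linear H -> H}) (p q : {poly R[i]}).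

Lemma rnorm_complete (u : nat -> H) :
  (forall e : R, 0 < e -> exists N, forall m n, (N <= m)%N -> (N <= n)%N ->
     rnorm (u m - u n) <= e) ->
  exists l, forall e : R, 0 < e -> exists N, forall n, (N <= n)%N ->
     rnorm (u n - l) <= e.
Proof.
move=> cu.
have : cvg (u @ \oo).
  apply: cauchy_cvg; apply: cauchy_exP => e e0.
  have re0 : 0 < complex.Re e by move: e0; rewrite ltcE => /andP[].
  have eE : e = (complex.Re e)%:C by rewrite RRe_real// gtr0_real.
  have [N uN] := cu (complex.Re e / 2) (divr_gt0 re0 (ltr0n _ 2)).
  exists (u N); exists N => // n /= Nn.
  rewrite -ball_normE /= normE eE ltcR (le_lt_trans (uN _ _ _ _))//.
  by rewrite ltr_pdivrMr// ltr_pMr// ltr1n.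
move=> /cvg_ex[l ul]; exists l => e e0.
have e0' : 0 < e%:C by rewrite ltcR.
have := @cvgr_dist_le _ _ _ _ _ _ _ ul _ e0'.
move=> [N _ uN]; exists N => n Nn.
by have := uN n Nn; rewrite /= normE lecR rnormB.
Qed.

(** The iterates of x |-> S x + w from 0 are the partial sums of the Neumann series of S applied to
    w. *)
Lemma contraction_solve S (rho : R) (w : H) : 0 <= rho < 1 ->
  (forall x, rnorm (S x) <= rho * rnorm x) -> exists l, l = S l + w.
Proof.
move=> /andP[r0 r1] Sr.
pose u n : H := iter n (fun x => S x + w) 0.
have uS n : u n.+1 = S (u n) + w by [].
have du n : rnorm (u n.+1 - u n) <= rho ^+ n * rnorm w.
  elim: n => [|n IH]; first by rewrite uS linear0 add0r subr0 expr0 mul1r.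
  rewrite uS [X in _ - X]uS opprD addrACA subrr addr0 -linearB.
  by rewrite (le_trans (Sr _))// exprS -mulrA ler_wpM2l.
have r1' : 0 < 1 - rho by rewrite subr_gt0.
have dun n k : rnorm (u (n + k)%N - u n) <= rho ^+ n * (rnorm w / (1 - rho)).
  have -> : u (n + k)%N - u n = \sum_(i < k) (u (n + i.+1)%N - u (n + i)%N).
    elim: k => [|k IH]; first by rewrite addn0 subrr big_ord0.
    by rewrite big_ord_recr/= -IH addrC subrKA addnS.
  apply: le_trans (rnorm_sum _ _ _) _.
  apply: (@le_trans _ _ (\sum_(i < k) rho ^+ n * rnorm w * rho ^+ i)).
    apply: ler_sum => i _; rewrite addnS (le_trans (du _))//.
    by rewrite exprD mulrAC.
  rewrite -mulr_sumr -mulrA ler_wpM2l ?exprn_ge0// ler_wpM2l ?rnorm_ge0//.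
  by apply: geometric_sum_le; rewrite r0.
have [l ul] : exists l, forall e : R, 0 < e -> exists N, forall n, (N <= n)%N ->
     rnorm (u n - l) <= e.
  apply: rnorm_complete => e e0.
  pose W := rnorm w / (1 - rho).
  have W0 : 0 <= W by rewrite divr_ge0 ?rnorm_ge0// ltW.
  have [N NW] : exists N, rho ^+ N * W <= e / 2.
    have e2 : 0 < e / 2 / (W + 1) by rewrite !divr_gt0// ltr_wpDl.
    have [N rN] := expr_small (introT andP (conj r0 r1)) e2.
    exists N; apply: (@le_trans _ _ (rho ^+ N * (W + 1))).
      by rewrite ler_wpM2l ?exprn_ge0// lerDl.
    by rewrite -ler_pdivlMr// ltr_wpDl.
  exists N => m n Nm Nn.
  have -> : u m - u n = (u m - u N) - (u n - u N) by rewrite opprB addrA subrK.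
  rewrite (le_trans (rnormD _ _))// rnormN -[leRHS](@divfK _ 2)// mulr_natr mulr2n.
  rewrite lerD// (le_trans _ NW)//.
    by rewrite -(subnKC Nm) dun.
  by rewrite -(subnKC Nn) dun.
exists l; apply/eqP; rewrite -subr_eq0; apply/eqP/rnorm_eq0/eqP.
rewrite eq_le rnorm_ge0 andbT; apply/ler_addgt0Pl => e e0; rewrite addr0.
have e2 : 0 < e / 2 by rewrite divr_gt0.
have [N uN] := ul _ e2.
have -> : l - (S l + w) = - (u N.+1 - l) + S (u N - l).
  rewrite (linearB S) uS opprB !opprD -addrA; congr (_ + _).
  by rewrite addrACA addNr add0r addrC.
rewrite (le_trans (rnormD _ _))// rnormN -[leRHS](@divfK _ 2)// mulr_natr mulr2n.
rewrite lerD ?uN// (le_trans (Sr _))// (le_trans _ (uN N (leqnn N)))//.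
by rewrite ler_piMl ?rnorm_ge0// ltW.
Qed.

Lemma linear_inverse (f : H -> H) (d : R) : linear f -> 0 < d ->
  (forall x, d * rnorm x <= rnorm (f x)) -> (forall y, exists x, f x = y) ->
  exists B : {linear H -> H}, [/\ continuous B, cancel f B & cancel B f].
Proof.
move=> flin d0 fd fsurj.
have finj x y : f x = f y -> x = y.
  move=> fxy; apply/eqP; rewrite -subr_eq0; apply/eqP/rnorm_eq0/eqP.
  rewrite eq_le rnorm_ge0 andbT -(ler_pM2l d0) mulr0 (le_trans (fd _))//.
  by rewrite addrC -scaleN1r flin fxy scaleN1r addrC subrr rnorm0.
have /choice[g gf] := fsurj.
have glin : linear g by move=> a x y; apply: finj; rewrite flin !gf.
pose gL := GRing.isLinear.Build _ _ _ _ _ glin.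
pose B : {linear H -> H} := HB.pack g gL.
exists B; split => [|x|y]; [|exact: finj|exact: gf].
apply: rbounded_continuous; exists d^-1; first by rewrite invr_ge0 ltW.
by move=> x; rewrite -(ler_pM2l d0) mulrA divff ?lt0r_neq0// mul1r (le_trans (fd _))//= gf.
Qed.

Lemma shift_linear A z : linear (fun x => A x - z *: x).
Proof.
move=> a x y; rewrite linearP scalerDr scalerBr opprD !scalerA mulrC.
by rewrite addrACA.
Qed.

Definition shift_poly (z : R[i]) : {poly R[i]} := 'X - z%:P.

Lemma shift_polyE A z x : poly_op (shift_poly z) A x = A x - z *: x.
Proof. by rewrite poly_opB poly_opX poly_opC. Qed.

Lemma conj_shift_poly z : map_poly conjc (shift_poly z) = shift_poly (conjc z).
Proof. by rewrite rmorphB /= map_polyX map_polyC. Qed.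

Lemma sqr_rnorm_poly A p x : symmetric_op A ->
  rnorm (poly_op p A x) ^+ 2 = rip (poly_op (map_poly conjc p * p) A x) x.
Proof.
move=> Asym; rewrite sqr_rnorm poly_opM /rip poly_op_adjoint//.
by rewrite [in LHS]inner_conj; case: (inner _ _).
Qed.

Lemma poly_op_symmetric A p : symmetric_op A -> map_poly conjc p = p ->
  symmetric_op (poly_op p A).
Proof. by move=> Asym pp x y; rewrite poly_op_adjoint// pp. Qed.

Lemma conj_poly_norm p : map_poly conjc (map_poly conjc p * p) = map_poly conjc p * p.
Proof.
rewrite rmorphM /= mulrC; congr (_ * _).
by rewrite -map_poly_comp map_poly_id// => z _ /=; rewrite conjcK.
Qed.

End Resolvent.

(** * The spectrum of a symmetric operator *)

Section Spectrum.
Context {R : realType} {H : hilbertType R}.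
Implicit Types (x y : H) (A : {linear H -> H}) (p q : {poly R[i]}).

Definition bounded_below (Y : hilbertType R) (f : H -> Y) : Prop :=
  exists2 d : R, 0 < d & forall x, d * rnorm x <= rnorm (f x).

(** p splits into linear factors, and a composition of maps bounded below is bounded below. Read
    contrapositively, the lemma finds a root z with A - z not bounded below. *)
Lemma bounded_below_poly A p : p != 0 ->
  (forall z, root p z -> bounded_below (poly_op (shift_poly z) A)) ->
  bounded_below (poly_op p A).
Proof.
move=> p0; have [r pE] := closed_field_poly_normal p.
have l0 : lead_coef p != 0 by rewrite lead_coef_eq0.
have rootE z : root p z = (z \in r).
  by rewrite pE rootZ ?l0// root_prod_XsubC.
move=> rp; have {}rp : forall z, z \in r -> bounded_below (poly_op (shift_poly z) A).
  by move=> z; rewrite -rootE; exact: rp.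
suff [d d0 dP] : bounded_below (poly_op (\prod_(z <- r) ('X - z%:P)) A).
  exists (complex.Re `|lead_coef p| * d).
    rewrite mulr_gt0//; have : 0 < `|lead_coef p| by rewrite normr_gt0.
    by rewrite ltcE => /andP[].
  move=> x; rewrite [in leRHS]pE poly_opZ rnormZ -mulrA ler_wpM2l//.
  by rewrite normc_def /= sqrtr_ge0.
elim: r rp {pE rootE} => [|z r IH] rp.
  by exists 1 => // x; rewrite big_nil -polyC1 poly_opC scale1r mul1r.
have [d d0 dP] := rp z (mem_head _ _).
have [|e e0 eP] := IH; first by move=> w wr; apply: rp; rewrite inE wr orbT.
exists (d * e) => [|x]; first by rewrite mulr_gt0.
by rewrite big_cons poly_opM (le_trans _ (dP _))// -mulrA ler_wpM2l// ltW.
Qed.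

(** A - Re z is symmetric, so the skew part i Im z contributes no cross term. This keeps the
    spectrum on the real line. *)
Lemma sqr_rnorm_shift A z x : symmetric_op A ->
  rnorm (poly_op (shift_poly z) A x) ^+ 2 =
  rnorm (poly_op (shift_poly (complex.Re z)%:C) A x) ^+ 2 +
  complex.Im z ^+ 2 * rnorm x ^+ 2.
Proof.
move=> Asym; rewrite !sqr_rnorm_poly// !conj_shift_poly conjc_real.
have -> : shift_poly (conjc z) * shift_poly z =
    shift_poly (complex.Re z)%:C * shift_poly (complex.Re z)%:C +
    ((complex.Im z ^+ 2)%:C)%:P.
  rewrite /shift_poly.
  have -> : (complex.Im z ^+ 2)%:C = conjc z * z - (complex.Re z)%:C ^+ 2.
    case: z => a b; rewrite -[in RHS]rmorphXn; apply/eqP; rewrite eq_complex.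
    apply/andP; split; apply/eqP; rewrite /=; ring.
  have -> : (complex.Re z)%:C ^+ 2 = (complex.Re z)%:C * (complex.Re z)%:C by [].
  rewrite rmorphB !rmorphM /=.
  have : z%:P + (conjc z)%:P = (complex.Re z)%:C%:P + (complex.Re z)%:C%:P :> {poly R[i]}.
    by rewrite -!polyCD addcJ mulr_natl mulr2n.
  move=> E.
  transitivity ('X * 'X - 'X * (z%:P + (conjc z)%:P) + (conjc z)%:P * z%:P).
    by ring.
  by rewrite E; ring.
rewrite poly_opD poly_opC ripDl; congr (_ + _).
by rewrite ripZl sqr_rnorm.
Qed.

(* (A - z)^*(A - z) is bounded above and below, hence invertible by a Neumann
   series. *)
Lemma bounded_below_resolvent A z : symmetric_op A -> rbounded A ->
  bounded_below (poly_op (shift_poly z) A) -> resolvent_set A z.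
Proof.
move=> Asym Abd [d d0 dP].
have [N N0 NP] := poly_op_bounded (shift_poly z) Abd.
(* The form of [q] lies between d^2 and N^2 times |x|^2. With this K, the form of 1 - q / K lies
   between 0 and rho < 1, and no comparison of d with N is required. *)
pose K := N ^+ 2 + d ^+ 2.
have K0 : 0 < K by rewrite ltr_wpDl ?exprn_gt0// exprn_ge0.
pose s := shift_poly z; pose q := map_poly conjc s * s.
pose sigma : {poly R[i]} := 1 - (K^-1)%:C *: q.
have qE x : rip (poly_op q A x) x = rnorm (poly_op s A x) ^+ 2 by rewrite sqr_rnorm_poly.
have SE x : poly_op sigma A x = x - (K^-1)%:C *: poly_op q A x.
  by rewrite poly_opB poly_opZ -polyC1 poly_opC scale1r.
have ripS x : rip (poly_op sigma A x) x = rnorm x ^+ 2 - K^-1 * rnorm (poly_op s A x) ^+ 2.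
  by rewrite SE ripDl ripNl ripZl qE (sqr_rnorm x).
pose rho := 1 - d ^+ 2 / K.
have r01 : 0 <= rho < 1.
  rewrite subr_ge0 ler_pdivrMr// mul1r lerDr exprn_ge0//=.
  by rewrite gtrBl divr_gt0// exprn_gt0.
have K1 : 0 <= K^-1 by rewrite invr_ge0 ltW.
have Ssym : symmetric_op (poly_op sigma A).
  apply: poly_op_symmetric => //.
  by rewrite rmorphB rmorph1 /= map_polyZ [X in X *: _]conjc_real conj_poly_norm.
have Sb x : 0 <= rip (poly_op sigma A x) x <= rho * rnorm x ^+ 2.
  rewrite ripS; apply/andP; split.
    rewrite subr_ge0 mulrC ler_pdivrMr// mulrC (@le_trans _ _ (N ^+ 2 * rnorm x ^+ 2))//.
      rewrite -exprMn ler_pXn2r// ?nnegrE ?rnorm_ge0// mulr_ge0// rnorm_ge0//.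
    by rewrite ler_wpM2r ?exprn_ge0 ?rnorm_ge0// lerDl exprn_ge0// ltW.
  rewrite mulrBl mul1r lerD2l lerN2 -mulrA mulrCA ler_wpM2l// -exprMn.
  by rewrite ler_pXn2r// nnegrE ?rnorm_ge0// mulr_ge0 ?rnorm_ge0// ltW.
have Sc x : rnorm (poly_op sigma A x) <= rho * rnorm x.
  have /andP[rho0 _] := r01.
  rewrite -(@ler_pXn2r _ 2)// ?nnegrE ?rnorm_ge0 ?mulr_ge0 ?rnorm_ge0//.
  rewrite (le_trans (form_norm_le x Ssym Sb))// exprMn expr2 -mulrA ler_wpM2l//.
  by case/andP: (Sb x).
have surj y : exists x, A x - z *: x = y.
  have [l lE] := contraction_solve ((K^-1)%:C *: y) r01 Sc.
  (* s(A) commutes with its adjoint, so s(A) applied to s(A)^* l is q(A) l = y. *)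
  exists (poly_op (map_poly conjc s) A l).
  rewrite -shift_polyE -poly_opM mulrC -/q.
  have {lE} : l = poly_op sigma A l + (K^-1)%:C *: y := lE.
  rewrite SE -addrA => /eqP; rewrite -[X in X == _]addr0 (inj_eq (addrI l)).
  rewrite eq_sym addrC subr_eq0 => /eqP /(congr1 (fun u => K%:C *: u)).
  rewrite !scalerA -rmorphM divff ?lt0r_neq0//= !scale1r => ->.
  by [].
have bel x : d * rnorm x <= rnorm (A x - z *: x) by rewrite -shift_polyE.
have [B [Bc B1 B2]] := linear_inverse (shift_linear A z) d0 bel surj.
by exists B.
Qed.

Lemma resolvent_bounded_below A z : resolvent_set A z ->
  bounded_below (poly_op (shift_poly z) A).
Proof.
move=> [B [/continuous_rbounded[N N0 NB] AB _]].
have N1 : 0 < N + 1 by rewrite ltr_wpDl.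
exists (N + 1)^-1 => [|x]; first by rewrite invr_gt0.
rewrite shift_polyE -(ler_pM2l N1) mulrA divff ?lt0r_neq0// mul1r.
rewrite -[in leLHS](AB x) (le_trans (NB _))// ler_wpM2r ?rnorm_ge0// lerDl//.
Qed.

Lemma not_bounded_below_spectrum A z : symmetric_op A ->
  ~ bounded_below (poly_op (shift_poly z) A) ->
  spectrum A z /\ z = (complex.Re z)%:C.
Proof.
move=> Asym nb; split; first by move=> /resolvent_bounded_below.
apply/eqP; rewrite eq_complex /= eqxx /=; apply: contra_notT nb => z0.
exists `|complex.Im z| => [|x]; first by rewrite normr_gt0.
rewrite -(@ler_pXn2r _ 2)// ?nnegrE ?rnorm_ge0 ?mulr_ge0 ?rnorm_ge0//.
rewrite sqr_rnorm_shift// exprMn real_normK ?num_real// lerDr.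
by rewrite exprn_ge0// rnorm_ge0.
Qed.

(* With m = |p(A)|^2, the operator m - p(A)^* p(A) is not bounded below, hence
   neither is A - z for some root z of m - |p|^2. *)
Lemma poly_spectrum_attains_nonconst A p x0 : symmetric_op A -> rbounded A ->
  x0 != 0 -> (1 < size p)%N ->
  exists2 z, spectrum A z &
    forall x, rnorm (poly_op p A x) <= complex.Re `|p.[z]| * rnorm x.
Proof.
move=> Asym Abd x00 p1.
have [N N0 NP] := poly_op_bounded p Abd.
pose E := [set rnorm (poly_op p A x) ^+ 2 | x in [set x : H | rnorm x = 1]].
have normalize x : x != 0 -> exists2 u, rnorm u = 1 & x = (rnorm x)%:C *: u.
  move=> xn0; have r0 : rnorm x != 0 by apply: contra_neq xn0 => /rnorm_eq0.
  exists ((rnorm x)^-1%:C *: x).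
    by rewrite rnormZr ger0_norm ?invr_ge0 ?rnorm_ge0// mulVf.
  by rewrite scalerA -rmorphM divff//= scale1r.
have Esup : has_sup E.
  split; first by have [u u1 _] := normalize _ x00; exists (rnorm (poly_op p A u) ^+ 2), u.
  exists (N ^+ 2) => _ [x /= x1 <-].
  by rewrite ler_pXn2r// ?nnegrE ?rnorm_ge0// (le_trans (NP x))// x1 mulr1.
pose m := sup E.
have pm x : rnorm (poly_op p A x) ^+ 2 <= m * rnorm x ^+ 2.
  have [->|/normalize[u u1 ->]] := eqVneq x 0.
    by rewrite linear0 rnorm0 expr0n mulr0.
  rewrite linearZZ !rnormZr u1 mulr1 exprMn mulrC ler_wpM2r ?exprn_ge0//.
  by apply: ub_le_sup; [case: Esup | exists u].
have m0 : 0 <= m.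
  have [u u1 _] := normalize _ x00.
  by have := pm u; rewrite u1 expr1n mulr1; apply: le_trans; rewrite exprn_ge0// rnorm_ge0.
pose r := map_poly conjc p * p.
pose d := (m%:C)%:P - r.
have dE x : rip (poly_op d A x) x = m * rnorm x ^+ 2 - rnorm (poly_op p A x) ^+ 2.
  by rewrite poly_opB ripDl ripNl poly_opC ripZl -sqr_rnorm -sqr_rnorm_poly.
have dsym : symmetric_op (poly_op d A).
  by apply: poly_op_symmetric => //; rewrite rmorphB /= map_polyC [X in X%:P]conjc_real conj_poly_norm.
have dn : ~ bounded_below (poly_op d A).
  move=> [e e0 eP].
  (* By [form_norm_le], |d(A) x|^2 is at most m times the form of d(A). A lower bound e then keeps
     |p(A) x|^2 below m - e^2 / m on unit vectors, against the choice of m as supremum. *)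
  have up x : rnorm x = 1 -> e ^+ 2 <= m * (m - rnorm (poly_op p A x) ^+ 2).
    move=> x1; have := @form_norm_le _ _ (poly_op d A) x m dsym.
    rewrite dE x1 expr1n mulr1 => h.
    apply: le_trans (h _); first by have := eP x; rewrite x1 mulr1 => ex;
      rewrite ler_pXn2r// nnegrE ?rnorm_ge0// ltW.
    by move=> u; rewrite dE subr_ge0 pm gerBl exprn_ge0// rnorm_ge0.
  have e20 : 0 < e ^+ 2 by rewrite exprn_gt0.
  have [mE|mn0] := eqVneq m 0.
    have [u u1 _] := normalize _ x00; have := up u u1.
    by rewrite mE mul0r leNgt e20.
  have mp : 0 < m by rewrite lt0r mn0.
  have : m <= m - e ^+ 2 / m.
    apply: ge_sup; first by case: Esup.
    move=> _ [x /= x1 <-]; have := up x x1.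
    rewrite -ler_pdivrMl// mulrC => ?.
    by rewrite lerBrDl -lerBrDr.
  by rewrite leNgt gtrBl divr_gt0.
(* The product of p with its conjugate has positive degree, as p is not constant, so it cannot equal
   m. *)
have dn0 : d != 0.
  apply/negP; rewrite subr_eq0 => /eqP dr.
  have : (size r <= 1)%N by rewrite -dr size_polyC_leq1.
  have pn0 : p != 0 by rewrite -size_poly_gt0; exact: ltn_trans p1.
  rewrite /r size_mul ?map_poly_eq0// size_map_poly.
  by move: (size p) p1 => n; clear; lia.
have [z rz zn] : exists2 z, root d z & ~ bounded_below (poly_op (shift_poly z) A).
  apply: contrapT => h; apply: dn; apply: bounded_below_poly => // z rz.
  by apply: contrapT => zn; apply: h; exists z.
have [zs zr] := not_bounded_below_spectrum Asym zn.
exists z => // x.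
(* The root z is real, hence the conjugate polynomial takes the conjugate value at z and the
   equation d(z) = 0 reads |p(z)|^2 = m. *)
have pz : complex.Re `|p.[z]| ^+ 2 = m.
  move: rz; rewrite /root /d hornerD hornerN hornerC hornerM subr_eq0 => /eqP.
  have -> : (map_poly conjc p).[z] = conjc p.[z].
    by rewrite {1}zr -[(complex.Re z)%:C](@conjc_real R) -zr horner_map.
  rewrite mulrC -sqr_normc normc_def -rmorphXn => /complexI ->.
  by [].
rewrite -(@ler_pXn2r _ 2)// ?nnegrE ?rnorm_ge0//.
  by rewrite exprMn pz.
by rewrite mulr_ge0 ?rnorm_ge0// normc_def /= sqrtr_ge0.
Qed.

(** For constant p any spectral point serves; the case of ['X] supplies one. *)
Lemma poly_spectrum_attains A p x0 : symmetric_op A -> rbounded A -> x0 != 0 ->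
  exists2 z, spectrum A z &
    forall x, rnorm (poly_op p A x) <= complex.Re `|p.[z]| * rnorm x.
Proof.
move=> Asym Abd x00; have [p1|p1] := ltnP 1 (size p).
  exact: poly_spectrum_attains_nonconst Asym Abd x00 p1.
have [|z zs _] := @poly_spectrum_attains_nonconst A 'X x0 Asym Abd x00.
  by rewrite size_polyX.
exists z => // x; rewrite (size1_polyC p1) hornerC poly_opC rnormZ.
by [].
Qed.

Lemma poly_op_norm_le A p (M : R) : symmetric_op A -> rbounded A ->
  (forall z, spectrum A z -> `|p.[z]| <= M%:C) ->
  forall x, rnorm (poly_op p A x) <= M * rnorm x.
Proof.
move=> Asym Abd pM x.
have [->|x0] := eqVneq x 0; first by rewrite linear0 rnorm0 mulr0.
have [z zs zp] := poly_spectrum_attains p Asym Abd x0.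
rewrite (le_trans (zp x))// ler_wpM2r ?rnorm_ge0//.
by have := pM z zs; rewrite normc_def lecR.
Qed.

Lemma spectrum_unit_interval A z : symmetric_op A -> rbounded A ->
  (forall x, 0 <= rip (A x) x <= rnorm x ^+ 2) -> spectrum A z ->
  exists2 l : R, 0 <= l <= 1 & z = l%:C.
Proof.
move=> Asym Abd A01 zs.
have nb : ~ bounded_below (poly_op (shift_poly z) A).
  by move=> /(bounded_below_resolvent Asym Abd).
have [_ zr] := not_bounded_below_spectrum Asym nb.
exists (complex.Re z) => //; set a := complex.Re z in zr *.
(* If the form of s (A - a) is at least e |x|^2, Cauchy-Schwarz makes A - a bounded below, which is
   excluded. The sign s is 1 for a < 0 and -1 for a > 1. *)
have below (e : R) (s : R) : 0 < e -> `|s| = 1 ->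
    (forall x, e * rnorm x ^+ 2 <= s * (rip (A x) x - a * rnorm x ^+ 2)) -> False.
  move=> e0 s1 h; apply: nb; exists e => // x; rewrite shift_polyE zr.
  have [->|x0] := eqVneq x 0; first by rewrite rnorm0 mulr0 rnorm_ge0.
  have r0 : 0 < rnorm x by rewrite lt0r rnorm_ge0 andbT; apply: contra_neq x0 => /rnorm_eq0.
  rewrite -(ler_pM2r r0) -mulrA -expr2 (le_trans (h x))//.
  rewrite sqr_rnorm -ripZl -ripNl -ripDl -ripZl (le_trans (Cauchy_Schwarz _ _))//.
  by rewrite rnormZr s1 mul1r.
apply/andP; split; rewrite leNgt; apply/negP => az.
  apply: (@below (- a) 1); rewrite ?oppr_gt0 ?normr1// => x.
  by rewrite mul1r mulNr lerDr; case/andP: (A01 x).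
apply: (@below (a - 1) (-1)); rewrite ?subr_gt0 ?normrN1// => x.
by have /andP[_] := A01 x; rewrite mulN1r opprB mulrBl mul1r lerD2l lerN2.
Qed.

End Spectrum.

(** * Functional calculus of a positive contraction *)

Lemma normcR (R : realType) (a : R) : `|a%:C| = `|a|%:C.
Proof. by rewrite normc_def /= expr0n addr0 sqrtr_sqr. Qed.

Lemma natSinv_small (R : realType) (e : R) : 0 < e ->
  exists N, forall n, (N <= n)%N -> n.+1%:R^-1 <= e.
Proof.
move=> e0; exists `|Num.ceil (e^-1)|%N => n Nn.
rewrite -[leRHS]invrK lef_pV2 ?posrE ?invr_gt0 ?ltr0n//.
apply: le_trans (ceil_ge _) _; rewrite (@le_trans _ _ `|Num.ceil e^-1|%N%:R)//.
  by rewrite natr_absz ler_int ler_norm.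
by rewrite ler_nat (leq_trans Nn).
Qed.

Section Calculus.
Context {R : realType} {H : hilbertType R}.
Implicit Types (x y : H) (A : {linear H -> H}) (f g : R -> R) (B : H -> H).

Definition positive_contraction A : Prop :=
  [/\ symmetric_op A, rbounded A & forall x, 0 <= rip (A x) x <= rnorm x ^+ 2].

(* B = f(A) for f continuous on [0, 1]: [cfc] with the spectrum replaced by
   [0, 1] and a single polynomial for each precision. *)
Definition calculus (A : H -> H) f B : Prop := forall e : R, 0 < e ->
  exists p : {poly R[i]},
    (forall l : R, 0 <= l <= 1 -> `|p.[l%:C] - (f l)%:C| <= e%:C) /\
    (forall x, rnorm (poly_op p A x - B x) <= e * rnorm x).

Lemma poly_op_unit_le A (p : {poly R[i]}) (M : R) : positive_contraction A ->
  (forall l : R, 0 <= l <= 1 -> `|p.[l%:C]| <= M%:C) ->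
  forall x, rnorm (poly_op p A x) <= M * rnorm x.
Proof.
move=> [Asym Abd A01] pM; apply: poly_op_norm_le => // z zs.
by have [l l01 ->] := spectrum_unit_interval Asym Abd A01 zs; exact: pM.
Qed.

Lemma eps_le (a c : R) : 0 <= c -> (forall e, 0 < e -> a <= e * c) -> a <= 0.
Proof.
move=> c0 h; apply/ler_addgt0Pl => e e0; rewrite addr0.
have c1 : 0 < c + 1 by rewrite ltr_wpDl.
apply: le_trans (h (e / (c + 1)) (divr_gt0 e0 c1)) _.
by rewrite mulrAC ler_pdivrMr// ler_pM2l// lerDl.
Qed.

Lemma eq_rnorm_le x y (c : R) : 0 <= c ->
  (forall e, 0 < e -> rnorm (x - y) <= e * c) -> x = y.
Proof.
move=> c0 h; apply/eqP; rewrite -subr_eq0; apply/eqP/rnorm_eq0/eqP.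
by rewrite eq_le rnorm_ge0 (eps_le c0 h).
Qed.

Lemma rnorm_le_trans x y z (a b : R) :
  rnorm (x - y) <= a -> rnorm (y - z) <= b -> rnorm (x - z) <= a + b.
Proof. by move=> xy yz; rewrite -(subrKA y) (le_trans (rnormD _ _))// lerD. Qed.

Lemma calculus_norm_le A f B (M : R) : positive_contraction A -> calculus A f B ->
  (forall l : R, 0 <= l <= 1 -> `|f l| <= M) ->
  forall x, rnorm (B x) <= M * rnorm x.
Proof.
move=> Apc fB fM x; rewrite -subr_le0; apply: (@eps_le _ (2 * rnorm x)).
  by rewrite mulr_ge0 ?rnorm_ge0.
move=> e e0; have [p [pf pB]] := fB _ e0.
have pM : rnorm (poly_op p A x) <= (M + e) * rnorm x.
  apply: poly_op_unit_le => // l l01.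
  rewrite -(subrK (f l)%:C p.[_]) (le_trans (ler_normD _ _))// rmorphD/= addrC.
  by rewrite lerD ?pf// normcR lecR fM.
rewrite lerBlDr -[B x](subKr (poly_op p A x)) (le_trans (rnormD _ _))// rnormN.
by have := pB x; lra.
Qed.

Lemma calculus_ext A f g B B' : (forall l : R, 0 <= l <= 1 -> f l = g l) ->
  (forall x, B x = B' x) -> calculus A f B -> calculus A g B'.
Proof.
move=> fg BB fB e /fB[p [pf pB]]; exists p; split=> [l l01|x].
  by rewrite -fg// pf.
by rewrite -BB.
Qed.

Lemma calculusD A f g B B' : calculus A f B -> calculus A g B' ->
  calculus A (fun l => f l + g l) (fun x => B x + B' x).
Proof.
move=> fB gB e e0; have e2 : 0 < e / 2 by rewrite divr_gt0.
have [p [pf pB]] := fB _ e2; have [q [qg qB]] := gB _ e2.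
exists (p + q); split=> [l l01|x].
  rewrite hornerD rmorphD/= opprD addrACA (le_trans (ler_normD _ _))//.
  have -> : e%:C = (e / 2)%:C + (e / 2)%:C by rewrite -rmorphD -splitr.
  by rewrite lerD ?pf ?qg.
rewrite poly_opD opprD addrACA (le_trans (rnormD _ _))//.
by have := pB x; have := qB x; lra.
Qed.

Lemma calculusZ A f B (a : R) : calculus A f B ->
  calculus A (fun l => a * f l) (fun x => a%:C *: B x).
Proof.
move=> fB e e0; have a1 : 0 < `|a| + 1 by rewrite ltr_wpDl.
have [p [pf pB]] := fB _ (divr_gt0 e0 a1).
have ae : `|a| * (e / (`|a| + 1)) <= e.
  by rewrite mulrCA ler_piMr ?(ltW e0)// ler_pdivrMr// mul1r lerDl.
exists (a%:C *: p); split=> [l l01|x].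
  rewrite hornerZ rmorphM/= -mulrBr normrM normcR.
  apply: (@le_trans _ _ (`|a|%:C * (e / (`|a| + 1))%:C)).
    by rewrite ler_wpM2l ?ler0c ?pf.
  by rewrite -rmorphM lecR.
rewrite poly_opZ -scalerBr rnormZr.
apply: (@le_trans _ _ (`|a| * (e / (`|a| + 1) * rnorm x))).
  by rewrite ler_wpM2l.
by rewrite mulrA ler_wpM2r ?rnorm_ge0.
Qed.

Lemma calculus_poly A (p : {poly R}) :
  calculus A (fun l => p.[l]) (poly_op (map_poly (real_complex R) p) A).
Proof.
move=> e e0; exists (map_poly (real_complex R) p); split=> [l _|x].
  by rewrite horner_map subrr normr0 ler0c ltW.
by rewrite subrr rnorm0 mulr_ge0 ?rnorm_ge0// ltW.
Qed.

Lemma calculus_sum A n (F : nat -> R -> R) (B : nat -> H -> H) :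
  (forall k, (k < n)%N -> calculus A (F k) (B k)) ->
  calculus A (fun l => \sum_(k < n) F k l) (fun x => \sum_(k < n) B k x).
Proof.
elim: n => [|n IH] FB.
  move=> e e0; exists 0; split=> [l _|x].
    by rewrite horner0 big_ord0 subrr normr0 ler0c ltW.
  rewrite /poly_op size_poly0 !big_ord0 subrr rnorm0.
  by rewrite mulr_ge0 ?rnorm_ge0// ltW.
have hn : calculus A (fun l => \sum_(k < n) F k l) (fun x => \sum_(k < n) B k x).
  by apply: IH => k kn; apply: FB; exact: ltnW.
by apply: (calculus_ext _ _ (calculusD hn (FB n (ltnSn n)))) => u; rewrite big_ord_recr.
Qed.

Lemma calculus_linear A f B : calculus A f B -> linear B.
Proof.
move=> fB a x y.
have a0 : 0 <= complex.Re `|a| by rewrite normc_def sqrtr_ge0.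
apply: (@eq_rnorm_le _ _ (rnorm (a *: x + y) + (complex.Re `|a| * rnorm x + rnorm y))).
  by rewrite !addr_ge0 ?mulr_ge0 ?rnorm_ge0.
move=> e e0; have [p [_ pB]] := fB _ e0.
rewrite mulrDr; apply: (@rnorm_le_trans _ (poly_op p A (a *: x + y))).
  by rewrite rnormB.
rewrite linearP opprD addrACA -scalerBr (le_trans (rnormD _ _))// mulrDr lerD//; last exact: pB.
by rewrite rnormZ mulrCA ler_wpM2l//; exact: pB.
Qed.

Lemma calculusM A f g B B' : positive_contraction A ->
  calculus A f B -> calculus A g B' ->
  (forall l : R, 0 <= l <= 1 -> `|f l| <= 1) ->
  (forall l : R, 0 <= l <= 1 -> `|g l| <= 1) ->
  calculus A (fun l => f l * g l) (fun x => B (B' x)).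
Proof.
move=> Apc fB gB f1 g1 e e0.
(* The error of p q is at most |p| |q - g| + |p - f| |g| <= 2 d + d, where |p| <= 1 + d <= 2. *)
have [d [d0 d1 d3]] : exists d, [/\ 0 < d, d <= 1 & 3 * d <= e].
  exists (Num.min 1 (e / 3)); split.
  - by rewrite lt_min ltr01 divr_gt0.
  - by rewrite ge_min lexx.
  - rewrite mulrC -ler_pdivlMr//; by rewrite ge_min lexx orbT.
have [p [pf pB]] := fB _ d0; have [q [qg qB]] := gB _ d0.
have p2 l : 0 <= l <= 1 -> `|p.[l%:C]| <= 2%:C.
  move=> l01; rewrite -(subrK (f l)%:C p.[_]) (le_trans (ler_normD _ _))//.
  apply: (@le_trans _ _ (d%:C + 1%:C)); first by rewrite lerD ?pf// normcR lecR f1.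
  by rewrite -rmorphD lecR; lra.
exists (p * q); split=> [l l01|x].
  rewrite hornerM rmorphM/=.
  have -> : p.[l%:C] * q.[l%:C] - (f l)%:C * (g l)%:C =
    p.[l%:C] * (q.[l%:C] - (g l)%:C) + (p.[l%:C] - (f l)%:C) * (g l)%:C by ring.
  rewrite (le_trans (ler_normD _ _))// !normrM.
  apply: (@le_trans _ _ (2%:C * d%:C + d%:C * 1%:C)).
    rewrite lerD// ler_pM// ?p2 ?qg ?pf//.
    by rewrite normcR lecR g1.
  by rewrite -!rmorphM -rmorphD lecR; lra.
have B'x := calculus_norm_le Apc gB g1 x.
rewrite poly_opM.
apply: (@le_trans _ _ (2 * d * rnorm x + d * rnorm x)); last first.
  by rewrite -mulrDl ler_wpM2r ?rnorm_ge0//; lra.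
apply: (@rnorm_le_trans _ (poly_op p A (B' x))).
  rewrite -linearB -mulrA.
  apply: le_trans (poly_op_unit_le Apc p2 _) _.
  by rewrite ler_wpM2l//; exact: qB.
by apply: le_trans (pB _) _; rewrite ler_wpM2l ?(ltW d0)//; rewrite mul1r in B'x.
Qed.

Lemma calculus_unique A f g B B' : positive_contraction A ->
  calculus A f B -> calculus A g B' ->
  (forall l : R, 0 <= l <= 1 -> f l = g l) -> B = B'.
Proof.
move=> Apc fB gB fg; apply/funext => x; apply/eqP; rewrite -subr_eq0; apply/eqP/rnorm_eq0/eqP.
rewrite eq_le rnorm_ge0 andbT -(mul0r (rnorm x)).
have := calculusD fB (calculusZ (-1) gB).
move=> /(calculus_norm_le Apc) h.
have {}h : rnorm (B x + (-1)%:C *: B' x) <= 0 * rnorm x.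
  by apply: h => l l01; rewrite fg// mulN1r subrr normr0.
by move: h; rewrite rmorphN rmorph1 scaleN1r.
Qed.

(** Polynomials that are close on [0, 1] give operators close in norm. The limit is chosen
    pointwise, but the Cauchy rate is proportional to |x|, so the convergence is in norm. *)
Lemma calculus_exists A f : positive_contraction A ->
  (forall e : R, 0 < e -> exists p : {poly R}, forall l, 0 <= l <= 1 -> `|f l - p.[l]| <= e) ->
  exists B, calculus A f B.
Proof.
move=> Apc fp.
have /choice[p pP] : forall n : nat, exists p : {poly R},
    forall l, 0 <= l <= 1 -> `|f l - p.[l]| <= n.+1%:R^-1.
  by move=> n; apply: fp; rewrite invr_gt0.
pose P n := map_poly (real_complex R) (p n).
have Pdiff m n l : 0 <= l <= 1 ->
    `|(P m - P n).[l%:C]| <= (m.+1%:R^-1 + n.+1%:R^-1)%:C.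
  move=> l01; rewrite hornerD hornerN !horner_map -rmorphB /= normcR lecR.
  have -> : (p m).[l] - (p n).[l] = (f l - (p n).[l]) - (f l - (p m).[l]) by ring.
  by rewrite (le_trans (ler_normB _ _))// addrC lerD// pP.
have diff m n x : rnorm (poly_op (P m) A x - poly_op (P n) A x) <=
    (m.+1%:R^-1 + n.+1%:R^-1) * rnorm x.
  by rewrite -poly_opB; apply: poly_op_unit_le => // l; exact: Pdiff.
have /choice[B Bl] : forall x, exists l, forall e : R, 0 < e ->
    exists N, forall n, (N <= n)%N -> rnorm (poly_op (P n) A x - l) <= e.
  move=> x; apply: rnorm_complete => e e0.
  have c1 : 0 < 2 * (rnorm x + 1).
    by rewrite mulr_gt0// ltr_wpDl// rnorm_ge0.
  have [N Ne] := natSinv_small (divr_gt0 e0 c1).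
  exists N => m n Nm Nn; apply: le_trans (diff _ _ _) _.
  apply: (@le_trans _ _ ((e / (2 * (rnorm x + 1)) + e / (2 * (rnorm x + 1))) * (rnorm x + 1))).
    rewrite ler_pM ?rnorm_ge0 ?addr_ge0 ?invr_ge0 ?lerDl//.
    by rewrite lerD// Ne.
  have n1 : rnorm x + 1 != 0 by rewrite gt_eqF// ltr_wpDl// rnorm_ge0.
  rewrite le_eqVlt; apply/orP; left; apply/eqP; field.
  by [].
exists B => e e0.
have e2 : 0 < e / 2 by rewrite divr_gt0.
have [N Ne] := natSinv_small e2.
exists (P N); split=> [l l01|x].
  rewrite horner_map -rmorphB /= normcR lecR distrC (le_trans (pP N l l01))//.
  by rewrite (le_trans (Ne N (leqnn N)))// ler_pdivrMr// ler_pMr// ler1n.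
rewrite -subr_le0; apply: (@eps_le _ 1) => // d d0; rewrite mulr1.
have [M Md] := Bl x _ d0.
have h1 := Ne N (leqnn N); have h2 := Ne (maxn M N) (leq_maxr _ _).
apply: le_trans (lerB (rnorm_le_trans (diff N (maxn M N) x) (Md _ (leq_maxl _ _))) (lexx _)) _.
rewrite addrAC gerDr subr_le0 ler_wpM2r ?rnorm_ge0// [leRHS]splitr lerD//.
Qed.

(** Muntz's theorem with the exponents 1, 2, 3, ... takes the place of Weierstrass's theorem. *)
Lemma powR_poly_approx (t e : R) : 0 < t -> 0 < e ->
  exists p : {poly R}, forall l, 0 <= l <= 1 -> `|l `^ t - p.[l]| <= e.
Proof.
move=> t0 e0.
have [||n [a aP]] := @muntz R t 1 (fun k => k.+1%:R) e t0 _ _ e0.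
- by move=> i j /eqP; rewrite eqr_nat => /eqP[].
- by move=> k; rewrite mul1r !lexx.
exists (\sum_(k < n) a k *: 'X^(k.+1)) => l l01.
have -> : (\sum_(k < n) a k *: 'X^(k.+1)).[l] = \sum_(k < n) a k * l `^ k.+1%:R.
  rewrite horner_sum; apply: eq_bigr => k _.
  by rewrite hornerZ hornerXn powR_mulrn//; case/andP: l01.
exact: aP.
Qed.

Lemma op_power_calculus A (t : R) : positive_contraction A -> 0 <= t ->
  calculus A (fun l => l `^ t) (op_power A t).
Proof.
move=> Apc t0; have [Asym Abd A01] := Apc.
rewrite /op_power; case: eqVneq => [->|tn0].
  move=> e e0; exists 1; split=> [l _|x].
    by rewrite powRr0 -polyC1 hornerC subrr normr0 ler0c ltW.
  by rewrite -polyC1 poly_opC scale1r subrr rnorm0 mulr_ge0 ?rnorm_ge0// ltW.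
have {tn0}t0 : 0 < t by rewrite lt0r tn0.
have [B fB] := calculus_exists Apc (fun e => @powR_poly_approx t e t0).
have cB : cfc A (fun z => (complex.Re z `^ t)%:C) B.
  have e1 n : 0 < n.+1%:R^-1 :> R by rewrite invr_gt0.
  have /choice[p pP] := fun n : nat => fB _ (e1 n).
  exists p; split=> e e0.
    have [N Ne] := natSinv_small e0; exists N => // n /= Nn z zs.
    have [l l01 ->] := spectrum_unit_interval Asym Abd A01 zs.
    by apply: le_trans ((pP n).1 l l01) _; rewrite lecR Ne.
  have [N Ne] := natSinv_small e0; exists N => // n /= Nn x.
  by apply: le_trans ((pP n).2 x) _; rewrite ler_wpM2r ?rnorm_ge0// Ne.
(* [cB] rules out the default of [xget]. The chosen [B'] comes with polynomials controlled on the
   spectrum only, so they are compared with those of [B] there; the errors add up to e + 2 e + e. *)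
case: xgetP => [B' _ [p [pf pB']]|/(_ B)/(_ cB)//].
suff -> : B' = B by [].
apply/funext => x; apply: (@eq_rnorm_le _ _ (4 * rnorm x)).
  by rewrite mulr_ge0// rnorm_ge0.
move=> e e0; have [q [qf qB]] := fB _ e0.
have [N _ pfN] := pf _ e0; have [M _ pBM] := pB' _ e0.
pose n := maxn M N.
have pq : rnorm (poly_op (p n) A x - poly_op q A x) <= 2 * e * rnorm x.
  rewrite -poly_opB; apply: poly_op_norm_le => // z zs.
  have := pfN n (leq_maxr _ _) z zs.
  have [l l01 zE] := spectrum_unit_interval Asym Abd A01 zs.
  rewrite zE /= => h; rewrite hornerD hornerN.
  rewrite -(subrKA (l `^ t)%:C) (le_trans (ler_normD _ _))//.
  have -> : (2 * e)%:C = e%:C + e%:C by rewrite mulr_natl mulr2n rmorphD.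
  by rewrite lerD// distrC qf.
have h1 : rnorm (B' x - poly_op (p n) A x) <= e * rnorm x.
  by rewrite rnormB; apply: pBM; exact: leq_maxl.
have := rnorm_le_trans (rnorm_le_trans h1 pq) (qB x).
lra.
Qed.

End Calculus.

(** * Observation at well-spaced times *)

Section RealSums.
Context {R : realType}.
Implicit Types (u w y : nat -> R).

Lemma weighted_sqr_sum n w y : (forall i, 0 <= w i) ->
  (\sum_(i < n) w i * y i) ^+ 2 <= (\sum_(i < n) w i) * \sum_(i < n) w i * y i ^+ 2.
Proof.
move=> w0; rewrite mulrC; apply: quadratic_ge0_discr => t.
have -> : \sum_(i < n) w i * y i ^+ 2 + 2 * (\sum_(i < n) w i * y i) * t +
    (\sum_(i < n) w i) * t ^+ 2 = \sum_(i < n) w i * (y i + t) ^+ 2.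
  rewrite mulr_sumr !mulr_suml -!big_split /=.
  by apply: eq_bigr => i _; ring.
by apply: sumr_ge0 => i _; rewrite mulr_ge0// sqr_ge0.
Qed.

Lemma sqrD_le (a b : R) : (a + b) ^+ 2 <= 2 * a ^+ 2 + 2 * b ^+ 2.
Proof. by have := sqr_ge0 (a - b); nra. Qed.

Lemma sqr_mono (a b : R) : 0 <= a -> a <= b -> a ^+ 2 <= b ^+ 2.
Proof. by move=> a0 ab; rewrite ler_pXn2r// nnegrE// (le_trans a0). Qed.

Lemma sum_widen_le u m n : (forall k, 0 <= u k) -> (m <= n)%N ->
  \sum_(k < m) u k <= \sum_(k < n) u k.
Proof.
move=> u0 /subnKC <-; rewrite big_split_ord /= lerDl.
by apply: sumr_ge0.
Qed.

Lemma sum_increasing_le u (nu : nat -> nat) L : (forall k, 0 <= u k) ->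
  (forall k, (nu k < nu k.+1)%N) ->
  \sum_(k < L) u (nu k) <= \sum_(m < nu L) u m.
Proof.
move=> u0 nuS; elim: L => [|L IH]; first by rewrite big_ord0 sumr_ge0.
rewrite big_ord_recr /= (le_trans _ (sum_widen_le u0 (nuS L)))//.
by rewrite big_ord_recr /= lerD2r.
Qed.

Lemma sum_injective_le (n m L : nat) (h1 h2 : nat -> nat) (u : nat -> R)
    (v : nat -> nat -> R) :
  (forall k, (k < n)%N -> (h1 k < m)%N /\ (h2 k < L)%N) ->
  (forall i j, h1 i = h1 j -> h2 i = h2 j -> i = j) ->
  (forall i k, 0 <= v i k) -> (forall k, u k = v (h1 k) (h2 k)) ->
  \sum_(k < n) u k <= \sum_(i < m) \sum_(k < L) v i k.
Proof.
move=> hlt hinj v0 uv.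
case: n hlt => [|n] hlt; first by rewrite big_ord0 sumr_ge0// => i _; exact: sumr_ge0.
have [m0 L0] := hlt 0%N isT.
case: m m0 hlt => // m _ hlt; case: L L0 hlt => // L _ hlt.
pose h (k : 'I_n.+1) : 'I_m.+1 * 'I_L.+1 := (inord (h1 k), inord (h2 k)).
have h1E (k : 'I_n.+1) : (h k).1 = h1 k :> nat by rewrite inordK//; case: (hlt k).
have h2E (k : 'I_n.+1) : (h k).2 = h2 k :> nat by rewrite inordK//; case: (hlt k).
have hI : injective h.
  by move=> i j hij; apply/val_inj/hinj; rewrite -?h1E -?h2E hij.
rewrite pair_bigA /=.
have -> : \sum_(k < n.+1) u k = \sum_(p in h @: [set: 'I_n.+1]) v p.1 p.2.
  rewrite big_imset /=; last by move=> i j _ _; exact: hI.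
  apply: eq_big => [i|i _]; first by rewrite in_setT.
  by rewrite uv h1E h2E.
by rewrite big_mkcond /=; apply: ler_sum => p _; case: ifP.
Qed.

Lemma sqr_small (M e : R) : 0 <= M -> 0 < e ->
  exists eta, [/\ 0 < eta, eta <= 1 & M * eta ^+ 2 <= e].
Proof.
move=> M0 e0; have M1 : 0 < M + 1 by rewrite ltr_wpDl.
have em : 0 < e / (M + 1) by rewrite divr_gt0.
exists (Num.min 1 (e / (M + 1))); set eta := Num.min _ _.
have eta0 : 0 < eta by rewrite lt_min ltr01.
have eta1 : eta <= 1 by rewrite ge_min lexx.
have etae : eta <= e / (M + 1) by rewrite ge_min lexx orbT.
split=> //; apply: (@le_trans _ _ (M * eta)).
  by rewrite ler_wpM2l// expr2 ler_piMl// ltW.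
apply: (@le_trans _ _ ((M + 1) * (e / (M + 1)))).
  by rewrite ler_pM ?(ltW eta0)// lerDl.
by rewrite mulrC divfK// gt_eqF.
Qed.

(** A majorant, uniform in d, of the change of the i-th binomial coefficient divided by d:
    coefficient 0 is constant, coefficient 1 changes by d, and the others obey
    [binomial_coef_bound]. The total mass is 1 + 2 = 3. *)
Definition shift_weight (i : nat) : R :=
  match i with 0 => 0 | 1 => 1 | j.+2 => 2 / (j.+1 * j.+2)%:R end.

Lemma shift_weight_ge0 i : 0 <= shift_weight i.
Proof. by case: i => [|[|i]] //=. Qed.

Lemma sum_shift_weight n : \sum_(i < n) shift_weight i <= 3.
Proof.
have H k : \sum_(i < k.+2) shift_weight i = 3 - 2 / k.+1%:R.
  elim: k => [|k IH]; first by rewrite !big_ord_recr big_ord0 /= divr1; ring.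
  rewrite big_ord_recr IH /= natrM.
  by field; rewrite -natrD nat1r !pnatr_eq0.
apply: (le_trans (sum_widen_le shift_weight_ge0 (leq_addr 2 n))).
by rewrite addn2 H gerBl divr_ge0.
Qed.

Lemma binomial_coef_shift_le (d : R) i : 0 <= d <= 1 ->
  `|binomial_coef d i - binomial_coef 0 i| <= d * shift_weight i.
Proof.
move=> d01; have /andP[d0 d1] := d01.
have b1 t : binomial_coef t 1 = - (1 + t) :> R by rewrite /binomial_coef; field.
case: i => [|[|i]] /=; first by rewrite /binomial_coef subrr normr0 mulr0.
  rewrite !b1; have -> : - (1 + d) - - (1 + 0) = - d by ring.
  by rewrite normrN ger0_norm// mulr1.
have -> : binomial_coef 0 i.+2 = 0 :> R.
  elim: i => [|i IH]; first by rewrite /binomial_coef; field.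
  by rewrite -[LHS]/(binomial_coef 0 i.+2 * _) IH mul0r.
by rewrite subr0 mulrCA mulrA binomial_coef_bound.
Qed.

End RealSums.

(** * The semigroup of powers of a positive contraction *)

Section Semigroup.
Context {R : realType} {H : hilbertType R} (A : {linear H -> H}).
Hypothesis Apc : positive_contraction A.
Implicit Types (x y : H) (s t d : R).

Local Notation E := (op_power A).

Let powR_norm_le1 t (l : R) : 0 <= t -> 0 <= l <= 1 -> `|l `^ t| <= 1.
Proof. by move=> t0 l01; rewrite ger0_norm ?powR_ge0// powR_le1. Qed.

Lemma op_power_linear t : 0 <= t -> linear (E t).
Proof. by move=> t0; exact: calculus_linear (op_power_calculus Apc t0). Qed.

Lemma op_powerB t x y : 0 <= t -> E t (x - y) = E t x - E t y.
Proof. by move=> t0; rewrite addrC -scaleN1r op_power_linear// scaleN1r addrC. Qed.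

Lemma op_powerZ t a x : 0 <= t -> E t (a *: x) = a *: E t x.
Proof.
move=> t0; have E0 : E t 0 = 0 by rewrite -(subrr x) op_powerB// !subrr.
by rewrite -[a *: x]addr0 op_power_linear// E0 addr0.
Qed.

Lemma op_power_sum t n (F : nat -> H) : 0 <= t ->
  E t (\sum_(k < n) F k) = \sum_(k < n) E t (F k).
Proof.
move=> t0; elim: n => [|n IH].
  by rewrite !big_ord0 -(subrr (0 : H)) op_powerB// !subrr.
by rewrite !big_ord_recr /= -IH -[X in X + _]scale1r op_power_linear// scale1r.
Qed.

Lemma op_power_norm_le t x : 0 <= t -> rnorm (E t x) <= rnorm x.
Proof.
move=> t0; rewrite -[leRHS]mul1r.
by apply: (calculus_norm_le Apc (op_power_calculus Apc t0)) => l; exact: powR_norm_le1.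
Qed.

Lemma op_powerD s t x : 0 <= s -> 0 <= t -> E s (E t x) = E (s + t) x.
Proof.
move=> s0 t0; have Es := op_power_calculus Apc s0; have Et := op_power_calculus Apc t0.
have Est := op_power_calculus Apc (addr_ge0 s0 t0).
have Em := calculusM Apc Es Et (fun l => @powR_norm_le1 s l s0)
  (fun l => @powR_norm_le1 t l t0).
suff <- : (fun x => E s (E t x)) = E (s + t) by [].
apply: (calculus_unique Apc Em Est) => l /andP[l0 l1].
have [->|sn0] := eqVneq s 0; first by rewrite powRr0 mul1r add0r.
by rewrite powRD// gt_eqF// ltr_wpDr// lt0r sn0.
Qed.

Lemma op_power_nat n x : E n%:R x = iter n A x.
Proof.
rewrite -poly_opXn.
suff -> : E n%:R = poly_op (map_poly (real_complex R) 'X^n) A by rewrite map_polyXn.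
apply: (calculus_unique Apc (op_power_calculus Apc (ler0n R n)) (calculus_poly _ _)).
by move=> l /andP[l0 _]; rewrite hornerXn powR_mulrn.
Qed.

Lemma op_power_approx s n (a tau : nat -> R) (eta : R) x : 0 <= s ->
  (forall k, 0 <= tau k) ->
  (forall l, 0 <= l <= 1 -> `|l `^ s - \sum_(k < n) a k * l `^ tau k| <= eta) ->
  rnorm (E s x - \sum_(k < n) (a k)%:C *: E (tau k) x) <= eta * rnorm x.
Proof.
move=> s0 tau0 approx.
have := calculusD (op_power_calculus Apc s0)
  (calculusZ (-1) (@calculus_sum _ _ A n (fun k l => a k * l `^ tau k)
     (fun k x => (a k)%:C *: E (tau k) x)
     (fun k _ => calculusZ (a k) (op_power_calculus Apc (tau0 k))))).
move=> /(calculus_norm_le Apc) h.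
have {}h : rnorm (E s x + (-1)%:C *: \sum_(k < n) (a k)%:C *: E (tau k) x) <= eta * rnorm x.
  by apply: h => l l01; rewrite mulN1r approx.
by move: h; rewrite rmorphN rmorph1 scaleN1r.
Qed.

Definition defect_op (i : nat) : H -> H :=
  poly_op (map_poly (real_complex R) ((1 - 'X) ^+ i)) A.

Lemma defect_op_norm_le i x : rnorm (defect_op i x) <= rnorm x.
Proof.
rewrite -[leRHS]mul1r; apply: (calculus_norm_le Apc (calculus_poly _ _)) => l /andP[l0 l1].
rewrite horner_exp hornerD hornerN hornerX hornerC normrX exprn_ile1//.
by rewrite ger0_norm ?subr_ge0// gerBl.
Qed.

(** Both powers are expanded, A itself as the case d = 0, each with error 2 / (n + 1). The norm
    estimate is then the scalar one on [0, 1]. *)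
Lemma op_power_shift_approx d n x : 0 <= d <= 1 ->
  rnorm (E (1 + d) x - E 1 x -
    \sum_(i < n.+2) (binomial_coef d i - binomial_coef 0 i)%:C *: defect_op i x)
  <= 4 / n.+1%:R * rnorm x.
Proof.
move=> d01; have /andP[d0 d1] := d01.
pose phi i := binomial_coef d i - binomial_coef 0 i.
have := calculusD (calculusD (op_power_calculus Apc (addr_ge0 ler01 d0))
  (calculusZ (-1) (op_power_calculus Apc ler01)))
  (calculusZ (-1) (@calculus_sum _ _ A n.+2 (fun k l => phi k * ((1 - 'X) ^+ k).[l])
     (fun k x => (phi k)%:C *: defect_op k x)
     (fun k _ => calculusZ (phi k) (calculus_poly A _)))).
move=> /(calculus_norm_le Apc) h.
have {}h : rnorm (E (1 + d) x + (-1)%:C *: E 1 x +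
    (-1)%:C *: \sum_(k < n.+2) (phi k)%:C *: defect_op k x) <= 4 / n.+1%:R * rnorm x.
  apply: h => l l01.
  have -> : \sum_(k < n.+2) phi k * ((1 - 'X) ^+ k).[l] =
      (binomial_poly d n.+2).[l] - (binomial_poly 0 n.+2).[l].
    rewrite /binomial_poly !horner_sum -sumrB; apply: eq_bigr => k _.
    by rewrite !hornerZ /phi mulrBl.
  have h1 := binomial_approx n d01 l01.
  have := @binomial_approx R 0 n l; rewrite lexx ler01 addr0 => /(_ isT l01) h0.
  have -> : l `^ (1 + d) + -1 * l `^ 1 +
    -1 * ((binomial_poly d n.+2).[l] - (binomial_poly 0 n.+2).[l]) =
    (l `^ (1 + d) - (binomial_poly d n.+2).[l]) -
    (l `^ 1 - (binomial_poly 0 n.+2).[l]) by ring.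
  rewrite (le_trans (ler_normB _ _))// (le_trans (lerD h1 h0))//.
  by rewrite -mulrDl ler_wpM2r ?invr_ge0//; lra.
by move: h; rewrite rmorphN rmorph1 !scaleN1r.
Qed.

End Semigroup.

(** * Perturbed times and the Bessel bound *)

Section Bessel.
Context {R : realType} {H Y : hilbertType R}.
Variables (A : {linear H -> H}) (C : {linear H -> Y}) (kappa b : R).
Hypothesis Apc : positive_contraction A.
Hypothesis kappa0 : 0 <= kappa.
Hypothesis Ckappa : forall x, rnorm (C x) <= kappa * rnorm x.
Hypothesis bessel : forall x L,
  \sum_(n < L) rnorm (C (iter n A x)) ^+ 2 <= b * rnorm x ^+ 2.
Implicit Types (x y : H) (s d e : R) (t : nat -> R).

Local Notation E := (op_power A).

Definition obs s x := rnorm (C (E s x)).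

Lemma obs_ge0 s x : 0 <= obs s x.
Proof. exact: rnorm_ge0. Qed.

Lemma obs_le s x : 0 <= s -> obs s x <= kappa * rnorm x.
Proof.
by move=> s0; rewrite (le_trans (Ckappa _))// ler_wpM2l// op_power_norm_le.
Qed.

Lemma obsD s s' x : 0 <= s -> 0 <= s' -> obs s (E s' x) = obs (s + s') x.
Proof. by move=> s0 s'0; rewrite /obs op_powerD. Qed.

Lemma obs_distrC s x y : 0 <= s -> obs s (x - y) = obs s (y - x).
Proof.
move=> s0; rewrite /obs (op_powerB Apc x y s0) (op_powerB Apc y x s0).
by rewrite (linearB C) (linearB C) rnormB.
Qed.

Lemma obs_triangle s x y : 0 <= s -> obs s x <= obs s y + obs s (x - y).
Proof.
move=> s0; rewrite /obs op_powerB// linearB.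
by rewrite -[in leLHS](subrK (C (E s y)) (C (E s x))) addrC rnormD.
Qed.

Lemma obs_sum s n (a : nat -> R) (F : nat -> H) : 0 <= s ->
  obs s (\sum_(k < n) (a k)%:C *: F k) <= \sum_(k < n) `|a k| * obs s (F k).
Proof.
move=> s0; rewrite /obs (op_power_sum Apc n (fun k => (a k)%:C *: F k))// linear_sum.
apply: le_trans (rnorm_sum _ _ _) _; apply: ler_sum => k _.
by rewrite op_powerZ// linearZZ rnormZr.
Qed.

Lemma obs_sqr_le s x y : 0 <= s ->
  obs s x ^+ 2 <= 2 * obs s y ^+ 2 + 2 * obs s (x - y) ^+ 2.
Proof.
move=> s0; apply: le_trans (sqrD_le _ _).
by apply: sqr_mono (obs_ge0 _ _) _; exact: obs_triangle.
Qed.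

Lemma obs_sum_sqr s n (a : nat -> R) (F : nat -> H) : 0 <= s ->
  obs s (\sum_(k < n) (a k)%:C *: F k) ^+ 2 <=
  (\sum_(k < n) `|a k|) * \sum_(k < n) `|a k| * obs s (F k) ^+ 2.
Proof.
move=> s0; apply: le_trans (@weighted_sqr_sum _ n (fun k => `|a k|) (fun k => obs s (F k)) _) => //.
by apply: sqr_mono (obs_ge0 _ _) _; exact: obs_sum.
Qed.

(* Expanding A^(1 + delta) - A in powers of I - A, with coefficients that are
   O(d) uniformly in delta <= d and summable, reduces the times
   s_k + 1 + delta_k to the times s_k. *)
Lemma obs_perturbation (s delta : nat -> R) (beta d : R) x L :
  (forall k, 0 <= s k) -> (forall y, \sum_(k < L) obs (s k) y ^+ 2 <= beta * rnorm y ^+ 2) ->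
  0 <= beta -> d <= 1 -> (forall k, 0 <= delta k <= d) ->
  \sum_(k < L) obs (s k) (E (1 + delta k) x - E 1 x) ^+ 2 <=
  18 * d ^+ 2 * beta * rnorm x ^+ 2.
Proof.
move=> s0 sb beta0 d1 dd.
have d0 : 0 <= d by case/andP: (dd 0%N); exact: le_trans.
have dk01 k : 0 <= delta k <= 1 by case/andP: (dd k) => -> /le_trans->.
pose phi k i := binomial_coef (delta k) i - binomial_coef 0 i.
pose v k n := \sum_(i < n.+2) (phi k i)%:C *: defect_op A i x.
pose u k := E (1 + delta k) x - E 1 x.
(* Cauchy-Schwarz with weights of total mass 3. The same weights are summed once more at the end,
   and splitting off the remainder costs a factor 2, whence 18 = 2 * 3 * 3. *)
have vle n k : obs (s k) (v k n) ^+ 2 <=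
    3 * d ^+ 2 * \sum_(i < n.+2) shift_weight i * obs (s k) (defect_op A i x) ^+ 2.
  have w0 i : 0 <= shift_weight i :> R := shift_weight_ge0 i.
  apply: (@le_trans _ _ ((d * \sum_(i < n.+2) shift_weight i * obs (s k) (defect_op A i x)) ^+ 2)).
    apply: sqr_mono (obs_ge0 _ _) _.
    apply: le_trans (obs_sum _ (phi k) (fun i => defect_op A i x) (s0 k)) _.
    rewrite mulr_sumr; apply: ler_sum => i _; rewrite mulrA ler_wpM2r ?obs_ge0//.
    apply: le_trans (binomial_coef_shift_le _ (dk01 k)) _.
    by rewrite ler_wpM2r//; case/andP: (dd k).
  have -> (S : R) : 3 * d ^+ 2 * S = d ^+ 2 * (3 * S) by ring.
  rewrite exprMn ler_wpM2l ?sqr_ge0//.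
  apply: le_trans (@weighted_sqr_sum _ n.+2 shift_weight
    (fun i => obs (s k) (defect_op A i x)) w0) _.
  rewrite ler_wpM2r ?sum_shift_weight// sumr_ge0// => i _.
  by rewrite mulr_ge0// sqr_ge0.
have uv n k : obs (s k) (u k - v k n) ^+ 2 <= kappa ^+ 2 * rnorm x ^+ 2 * 16 / n.+1%:R.
  apply: (@le_trans _ _ ((kappa * (4 / n.+1%:R * rnorm x)) ^+ 2)).
    apply: sqr_mono (obs_ge0 _ _) _; apply: le_trans (obs_le _ (s0 k)) _.
    by rewrite ler_wpM2l// op_power_shift_approx.
  have -> : (kappa * (4 / n.+1%:R * rnorm x)) ^+ 2 =
      kappa ^+ 2 * rnorm x ^+ 2 * 16 / n.+1%:R * n.+1%:R^-1.
    by field; rewrite nat1r pnatr_eq0.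
  rewrite ler_piMr ?invf_le1 ?ler1n//.
  by rewrite mulr_ge0// mulr_ge0// mulr_ge0// sqr_ge0.
(* L is fixed while the truncation order n grows, so the L truncation errors disappear from the
   bound. *)
rewrite -subr_le0; apply: (@eps_le _ _ (L%:R * (2 * (kappa ^+ 2 * rnorm x ^+ 2 * 16)))).
  by rewrite !mulr_ge0 ?sqr_ge0 ?rnorm_ge0.
move=> e e0; have [n /(_ n (leqnn n)) ne] := natSinv_small e0.
rewrite lerBlDr.
apply: (@le_trans _ _ (\sum_(k < L) (2 * (3 * d ^+ 2 *
    \sum_(i < n.+2) shift_weight i * obs (s k) (defect_op A i x) ^+ 2) +
    2 * (kappa ^+ 2 * rnorm x ^+ 2 * 16 / n.+1%:R)))).
  apply: ler_sum => k _; apply: le_trans (obs_sqr_le _ (v k n) (s0 k)) _.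
  by rewrite lerD// ler_wpM2l// ?vle ?uv.
rewrite big_split /= addrC lerD//.
  rewrite sumr_const card_ord -[_ *+ L]mulr_natl.
  set K := kappa ^+ 2 * rnorm x ^+ 2 * 16.
  have K0 : 0 <= K by rewrite !mulr_ge0 ?sqr_ge0 ?rnorm_ge0.
  have -> : L%:R * (2 * (K / n.+1%:R)) = n.+1%:R^-1 * (L%:R * (2 * K)) by ring.
  by rewrite ler_wpM2r// mulr_ge0// mulr_ge0.
have -> : \sum_(k < L) 2 * (3 * d ^+ 2 *
    \sum_(i < n.+2) shift_weight i * obs (s k) (defect_op A i x) ^+ 2) =
  6 * d ^+ 2 * \sum_(i < n.+2) shift_weight i *
    \sum_(k < L) obs (s k) (defect_op A i x) ^+ 2.
  under [in RHS]eq_bigr do rewrite mulr_sumr.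
  rewrite [in RHS]exchange_big /= mulr_sumr; apply: eq_bigr => k _.
  by rewrite mulrA; congr (_ * _); ring.
have -> : 18 * d ^+ 2 * beta * rnorm x ^+ 2 = 6 * d ^+ 2 * (3 * (beta * rnorm x ^+ 2)) by ring.
rewrite ler_wpM2l ?mulr_ge0 ?sqr_ge0//.
apply: (@le_trans _ _ (\sum_(i < n.+2) shift_weight i * (beta * rnorm x ^+ 2))).
  apply: ler_sum => i _; rewrite ler_wpM2l ?shift_weight_ge0//.
  rewrite (le_trans (sb _))// ler_wpM2l//.
  by apply: sqr_mono (rnorm_ge0 _) _; exact: defect_op_norm_le.
by rewrite -mulr_suml ler_wpM2r ?sum_shift_weight// mulr_ge0 ?sqr_ge0.
Qed.

Section Times.
Variables (t : nat -> R).
Hypothesis t0 : t 0%N = 0.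
Hypothesis tS : forall k, t k + 1 <= t k.+1.

Lemma times_ge k : k%:R <= t k.
Proof.
elim: k => [|k IH]; first by rewrite t0.
by rewrite -natr1 (le_trans _ (tS k))// lerD2r.
Qed.

Lemma times_ge0 k : 0 <= t k.
Proof. by rewrite (le_trans _ (times_ge k)). Qed.

Lemma times_lt i j : (i < j)%N -> t i < t j.
Proof.
elim: j => // j IH; rewrite ltnS leq_eqVlt => /predU1P[->|/IH ij].
  by rewrite (lt_le_trans _ (tS j))// ltrDl.
by rewrite (lt_trans ij)// (lt_le_trans _ (tS j))// ltrDl.
Qed.

Lemma times_inj : injective t.
Proof.
move=> i j tij; have [ij|ij|//] := ltngtP i j.
  by have := times_lt ij; rewrite tij ltxx.
by have := times_lt ij; rewrite tij ltxx.
Qed.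

(** Write t_(k+1) = nu_k + 1 + delta_k with nu_k an integer and 0 <= delta_k <= 1; the nu_k increase
    strictly because the gaps are at least 1. The perturbation with d = 1 gives 38 = 2 + 2 * 18, and
    kappa^2 accounts for t_0 = 0, which has no unit of time to spare. *)
Lemma times_bessel : 0 <= b -> forall x L,
  \sum_(k < L) obs (t k) x ^+ 2 <= (38 * b + kappa ^+ 2) * rnorm x ^+ 2.
Proof.
move=> b0 x L; apply: le_trans (sum_widen_le (fun k => sqr_ge0 (obs (t k) x)) (leqnSn L)) _.
rewrite big_ord_recl mulrDl addrC lerD//; last first.
  by rewrite -exprMn t0; apply: sqr_mono (obs_ge0 _ _) _; exact: obs_le.
pose fl k := Num.truncn (t k.+1).
have flP k : (fl k)%:R <= t k.+1 < (fl k).+1%:R by apply: truncn_itv; exact: times_ge0.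
have fl1 k : (0 < fl k)%N.
  have /andP[_ h] := flP k.
  have := le_lt_trans (times_ge k.+1) h; rewrite ltr_nat; lia.
pose nu k := (fl k).-1.
have flE k : (fl k)%:R = (nu k)%:R + 1 :> R by rewrite natr1 prednK.
have nuS k : (nu k < nu k.+1)%N.
  have : (fl k < fl k.+1)%N.
    rewrite -ltnS -(ltr_nat R) (le_lt_trans _ (andP (flP k.+1)).2)//.
    by rewrite -natr1 (le_trans _ (tS k.+1))// lerD2r; case/andP: (flP k).
  by have := fl1 k; have := fl1 k.+1; rewrite /nu; lia.
pose delta k := t k.+1 - (fl k)%:R.
have d01 k : 0 <= delta k <= 1.
  rewrite subr_ge0 lerBlDr; case/andP: (flP k) => -> /ltW h /=.
  by rewrite addrC natr1.
have nub y : \sum_(k < L) obs (nu k)%:R y ^+ 2 <= b * rnorm y ^+ 2.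
  apply: le_trans (bessel y (nu L)).
  apply: le_trans (@sum_increasing_le _ (fun n => rnorm (C (iter n A y)) ^+ 2) nu L _ nuS).
    by apply: ler_sum => k _; rewrite /obs op_power_nat.
  by move=> k; exact: sqr_ge0.
have nu0 k : 0 <= (nu k)%:R :> R by [].
apply: (@le_trans _ _ (\sum_(k < L) (2 * obs (nu k)%:R (E 1 x) ^+ 2 +
    2 * obs (nu k)%:R (E (1 + delta k) x - E 1 x) ^+ 2))).
  apply: ler_sum => k _; apply: le_trans _ (obs_sqr_le _ _ (nu0 k)).
  have d0 : 0 <= 1 + delta k by case/andP: (d01 k) => ? _; exact: addr_ge0.
  have tE : (nu k)%:R + (1 + delta k) = t k.+1 by rewrite /delta flE; ring.
  by rewrite (obsD x (nu0 k) d0) tE.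
rewrite big_split /= -!mulr_sumr.
have h1 := nub (E 1 x).
have h2 := @obs_perturbation (fun k => (nu k)%:R) delta b 1 x L nu0 nub b0 (lexx _) d01.
have h3 : b * rnorm (E 1 x) ^+ 2 <= b * rnorm x ^+ 2.
  by rewrite ler_wpM2l//; apply: sqr_mono (rnorm_ge0 _) _; exact: op_power_norm_le.
move: h2; rewrite expr1n mulr1 => h2.
apply: le_trans (lerD (ler_wpM2l _ (le_trans h1 h3)) (ler_wpM2l _ h2)) _ => //.
rewrite le_eqVlt; apply/orP; left; apply/eqP; ring.
Qed.

(** * Domination by the observation along the times *)

Variables (tau : R) (G : nat).
Hypothesis b0 : 0 <= b.
Hypothesis tau1 : 1 <= tau.
Hypothesis gap_ge : forall k, 0 <= t k.+1 - t k - tau.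
Hypothesis gap_lim : forall e, 0 < e ->
  exists K, forall k, (K <= k)%N -> t k.+1 - t k - tau <= e.
Hypothesis gap_le : forall k, t k.+1 - t k <= G%:R.

(* F is controlled by the observation at the times t, up to an arbitrarily
   small multiple of the squared norm: a quantitative form of "F tends to 0
   along every sequence of unit vectors whose observation tends to 0". *)
Definition dominated (F : H -> nat -> R) : Prop := forall e, 0 < e ->
  exists2 K : R, 0 <= K & forall x q,
    (forall L, \sum_(k < L) obs (t k) x ^+ 2 <= q) ->
    forall L, F x L <= K * q + e * rnorm x ^+ 2.

(** The error term in [dominated] absorbs approximations that are uniform on the unit sphere;
    letting L' differ from L leaves room for reindexing. *)
Lemma dominated_approx F : (forall e, 0 < e -> exists2 F', dominated F' &
    forall x L, exists L', F x L <= F' x L' + e * rnorm x ^+ 2) -> dominated F.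
Proof.
move=> approx e e0; have e2 : 0 < e / 2 by rewrite divr_gt0.
have [F' F'dom F'le] := approx _ e2; have [K K0 KP] := F'dom _ e2.
exists K => // x q xq L; have [L' FF'] := F'le x L.
apply: le_trans FF' _; apply: le_trans (lerD (KP x q xq L') (lexx _)) _.
by rewrite -addrA lerD2l -mulrDl -splitr.
Qed.

Lemma dominatedD F F' : dominated F -> dominated F' ->
  dominated (fun x L => F x L + F' x L).
Proof.
move=> Fd Fd' e e0; have e2 : 0 < e / 2 by rewrite divr_gt0.
have [K K0 KP] := Fd _ e2; have [K' K'0 KP'] := Fd' _ e2.
exists (K + K') => [|x q xq L]; first exact: addr_ge0.
apply: le_trans (lerD (KP x q xq L) (KP' x q xq L)) _.
by rewrite addrACA -mulrDl -(mulrDl (e / 2)) -splitr.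
Qed.

Lemma dominatedZ F (a : R) : 0 <= a -> dominated F -> dominated (fun x L => a * F x L).
Proof.
move=> a0 Fd e e0; have a1 : 0 < a + 1 by rewrite ltr_wpDl.
have [K K0 KP] := Fd _ (divr_gt0 e0 a1).
exists (a * K) => [|x q xq L]; first exact: mulr_ge0.
apply: le_trans (ler_wpM2l a0 (KP x q xq L)) _.
rewrite mulrDr mulrA lerD2l mulrA ler_wpM2r ?sqr_ge0//.
by rewrite mulrCA ler_piMr ?(ltW e0)// ler_pdivrMr// mul1r lerDl.
Qed.

Lemma dominated_sum n (F : nat -> H -> nat -> R) : (forall i, dominated (F i)) ->
  dominated (fun x L => \sum_(i < n) F i x L).
Proof.
move=> Fd; elim: n => [|n IH].
  move=> e e0; exists 0 => // x q xq L.
  by rewrite big_ord0 mul0r add0r mulr_ge0 ?sqr_ge0// ltW.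
apply: dominated_approx => e e0.
exists (fun x L => \sum_(i < n) F i x L + F n x L); first exact: dominatedD.
by move=> x L; exists L; rewrite big_ord_recr /= lerDl mulr_ge0 ?sqr_ge0// ltW.
Qed.

Let beta := 38 * b + kappa ^+ 2.
Let beta0 : 0 <= beta.
Proof. by rewrite addr_ge0 ?sqr_ge0// mulr_ge0. Qed.

Let tau0 : 0 <= tau.
Proof. exact: le_trans tau1. Qed.

Lemma times_le k : t k <= G%:R * k%:R.
Proof.
elim: k => [|k IH]; first by rewrite t0 mulr0.
by rewrite -natr1 mulrDr mulr1 -(subrK (t k) (t k.+1)) addrC lerD.
Qed.

(** Time 0 is t_0 itself. For s > 0 the Muntz exponents are the t_(k+1), since t_0 = 0 is not a
    positive exponent. *)
Lemma dominated_obs s : 0 <= s -> dominated (fun x _ => obs s x ^+ 2).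
Proof.
rewrite le_eqVlt => /predU1P[<-|s0].
  move=> e e0; exists 1 => // x q xq _; rewrite mul1r.
  apply: (@le_trans _ _ q); last by rewrite lerDl mulr_ge0 ?sqr_ge0// ltW.
  by have := xq 1%N; rewrite big_ord1 t0.
move=> e e0; have M0 : 0 <= 2 * kappa ^+ 2 by rewrite mulr_ge0 ?sqr_ge0.
have [eta [eta0 _ etae]] := sqr_small M0 e0.
have tinj : injective (fun k => t k.+1) by move=> i j /times_inj [].
have [|n [a aP]] := @muntz R s G%:R (fun k => t k.+1) eta s0 tinj _ eta0.
  by move=> k; rewrite times_ge times_le.
pose al := \sum_(k < n) `|a k|.
have al0 : 0 <= al by rewrite sumr_ge0.
exists (2 * (al * al)) => [|x q xq _]; first by rewrite !mulr_ge0.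
pose v := \sum_(k < n) (a k)%:C *: E (t k.+1) x.
have E0 y : E 0 y = y by have := op_power_nat Apc 0 y.
have -> : obs s x = obs 0 (E s x) by rewrite /obs E0.
apply: le_trans (obs_sqr_le (E s x) v (lexx 0)) _.
have -> : 2 * (al * al) * q = 2 * (al * (al * q)) by ring.
rewrite lerD//.
  rewrite ler_wpM2l//; apply: le_trans (obs_sum_sqr _ _ (fun k => E (t k.+1) x) (lexx 0)) _.
  rewrite ler_wpM2l// mulr_suml; apply: ler_sum => k _; rewrite ler_wpM2l//.
  (* A single term at t_(k+1) is bounded by the partial sum ending with it, which has k + 2
     terms. *)
  apply: le_trans (xq k.+2); rewrite big_ord_recr /= {1}/obs E0 -/(obs _ _).
  by rewrite lerDr sumr_ge0// => i _; rewrite sqr_ge0.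
apply: le_trans (ler_wpM2r (sqr_ge0 (rnorm x)) etae).
have -> : 2 * kappa ^+ 2 * eta ^+ 2 * rnorm x ^+ 2 = 2 * (kappa * (eta * rnorm x)) ^+ 2 by ring.
rewrite ler_wpM2l//.
apply: sqr_mono (obs_ge0 _ _) _; apply: le_trans (obs_le _ (lexx 0)) _.
rewrite ler_wpM2l//.
by apply: (op_power_approx Apc x (ltW s0) (fun k => times_ge0 k.+1) aP).
Qed.

Definition shifted_obs s x L := \sum_(k < L) obs (t k + s) x ^+ 2.

(** t_k + (s + tau) differs from t_(k+1) + s by the gap error, at most d for k >= K; the K earlier
    times are dominated one by one. *)
Lemma dominated_shift s : 0 <= s -> dominated (shifted_obs s) ->
  dominated (shifted_obs (s + tau)).
Proof.
move=> s0 sdom; apply: dominated_approx => e e0.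
have M0 : 0 <= 36 * beta by rewrite mulr_ge0.
have [d [d0 d1 de]] := sqr_small M0 e0.
have [K KP] := gap_lim d0.
exists (fun x L => \sum_(i < K) obs (t i + (s + tau)) x ^+ 2 + 2 * shifted_obs s x L).
  apply: dominatedD; last exact: dominatedZ.
  apply: (@dominated_sum K (fun i x _ => obs (t i + (s + tau)) x ^+ 2)) => i.
  by apply: dominated_obs; rewrite !addr_ge0 ?times_ge0.
(* The indices k < L turn into k + 1, hence [L.+1]. *)
move=> x L; exists L.+1.
(* [obs_perturbation] asks for the bound d at every index, so the gap errors before K are replaced
   by 0. *)
pose delta k := if (K <= k)%N then t k.+1 - t k - tau else 0.
have dd k : 0 <= delta k <= d.
  rewrite /delta; case: ifP => [Kk|_]; last by rewrite lexx ltW.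
  by rewrite gap_ge KP.
(* Here tau >= 1 supplies the unit of time that the perturbation consumes. *)
have s1 : 0 <= s + tau - 1 by rewrite -addrA addr_ge0// subr_ge0.
pose y := E (s + tau - 1) x.
have pert := @obs_perturbation t delta beta d y L times_ge0
  (fun z => times_bessel b0 z L) beta0 d1 dd.
have yx : rnorm y ^+ 2 <= rnorm x ^+ 2.
  by apply: sqr_mono (rnorm_ge0 _) _; exact: op_power_norm_le.
have {}pert : 2 * \sum_(k < L) obs (t k) (E (1 + delta k) y - E 1 y) ^+ 2 <= e * rnorm x ^+ 2.
  apply: (@le_trans _ _ (36 * beta * d ^+ 2 * rnorm y ^+ 2)).
    have -> : 36 * beta * d ^+ 2 * rnorm y ^+ 2 = 2 * (18 * d ^+ 2 * beta * rnorm y ^+ 2) by ring.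
    by rewrite ler_wpM2l.
  by apply: ler_pM => //; rewrite ?sqr_ge0// mulr_ge0// sqr_ge0.
have E1y k : obs (t k) (E 1 y) = obs (t k + (s + tau)) x.
  have tk := times_ge0 k.
  rewrite /y (op_powerD Apc x ler01 s1) (obsD x tk (addr_ge0 ler01 s1)).
  by congr (obs _ _); ring.
have Edy k : (K <= k)%N -> obs (t k) (E (1 + delta k) y) = obs (t k.+1 + s) x.
  move=> Kk; have tk := times_ge0 k; have /andP[dk _] := dd k.
  have dk1 : 0 <= 1 + delta k by exact: addr_ge0.
  rewrite /y (op_powerD Apc x dk1 s1) (obsD x tk (addr_ge0 dk1 s1)).
  by rewrite /delta Kk; congr (obs _ _); ring.
apply: (@le_trans _ _ (\sum_(k < L) ((if (k < K)%N then obs (t k + (s + tau)) x ^+ 2 else 0) +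
   2 * obs (t k.+1 + s) x ^+ 2 + 2 * obs (t k) (E (1 + delta k) y - E 1 y) ^+ 2))).
  apply: ler_sum => k _; case: ltnP => [kK|Kk].
    by rewrite -addrA lerDl addr_ge0// mulr_ge0// sqr_ge0.
  rewrite add0r -E1y -(Edy _ Kk) (obs_distrC (E (1 + delta k) y) _ (times_ge0 k)).
  exact: (obs_sqr_le _ (E (1 + delta k) y) (times_ge0 k)).
rewrite !big_split /= -!mulr_sumr lerD// lerD//.
  have [LK|KL] := leqP L K.
    apply: (@le_trans _ _ (\sum_(k < L) obs (t k + (s + tau)) x ^+ 2)).
      by apply: ler_sum => k _; rewrite (leq_trans (ltn_ord k)).
    by apply: (@sum_widen_le _ (fun k => obs (t k + (s + tau)) x ^+ 2)) => // k; rewrite sqr_ge0.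
  rewrite (big_ord_widen L (fun k => obs (t k + (s + tau)) x ^+ 2) (ltnW KL)).
  by rewrite [leRHS]big_mkcond.
by rewrite ler_wpM2l// /shifted_obs big_ord_recl /= lerDr sqr_ge0.
Qed.

(** Multiples of tau are reached by induction; the other s by Muntz's theorem with exponents tau (m
    + 1). The approximation error is a vector of small norm, and [times_bessel] makes its
    observation small at all times t_k together. *)
Lemma dominated_shifted s : 0 <= s -> dominated (shifted_obs s).
Proof.
move=> s0'; have dom_m m : dominated (shifted_obs (tau * m%:R)).
  elim: m => [|m IH].
    move=> e e0; exists 1 => // x q xq L; rewrite mul1r mulr0 /shifted_obs.
    under eq_bigr do rewrite addr0.
    by rewrite (le_trans (xq L))// lerDl mulr_ge0 ?sqr_ge0// ltW.
  have -> : tau * m.+1%:R = tau * m%:R + tau by rewrite -natr1 mulrDr mulr1.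
  by apply: dominated_shift IH; rewrite mulr_ge0.
move: s0'; rewrite le_eqVlt => /predU1P[<-|s0].
  by have := dom_m 0%N; rewrite mulr0.
apply: dominated_approx => e e0.
have M0 : 0 <= 2 * beta by rewrite mulr_ge0.
have [eta [eta0 _ etae]] := sqr_small M0 e0.
have tau0' : 0 < tau by exact: lt_le_trans tau1.
have tauinj : injective (fun k : nat => tau * k.+1%:R).
  by move=> i j /(mulfI (lt0r_neq0 tau0'))/eqP; rewrite eqr_nat => /eqP[].
have [|n [a aP]] := @muntz R s tau (fun k => tau * k.+1%:R) eta s0 tauinj _ eta0.
  by move=> k; rewrite lexx andbT ler_peMl.
pose al := \sum_(k < n) `|a k|.
have al0 : 0 <= al by rewrite sumr_ge0.
exists (fun x L => 2 * al * \sum_(m < n) `|a m| * shifted_obs (tau * m.+1%:R) x L).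
  apply: dominatedZ; first by rewrite mulr_ge0.
  apply: (@dominated_sum n (fun m x L => `|a m| * shifted_obs (tau * m.+1%:R) x L)) => m.
  exact: dominatedZ.
move=> x L; exists L.
have taum m : 0 <= tau * m.+1%:R by rewrite mulr_ge0.
pose v := \sum_(k < n) (a k)%:C *: E (tau * k.+1%:R) x.
apply: (@le_trans _ _ (\sum_(k < L) (2 * (al * \sum_(m < n) `|a m| * obs (t k + tau * m.+1%:R) x ^+ 2)
   + 2 * obs (t k) (E s x - v) ^+ 2))).
  apply: ler_sum => k _; rewrite -obsD ?times_ge0 ?(ltW s0)//.
  apply: le_trans (obs_sqr_le _ v (times_ge0 k)) _.
  rewrite lerD2r ler_wpM2l//.
  apply: le_trans (obs_sum_sqr _ _ (fun m => E (tau * m.+1%:R) x) (times_ge0 k)) _.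
  rewrite ler_wpM2l//; apply: ler_sum => m _.
  by rewrite obsD ?times_ge0.
rewrite big_split /= lerD//.
  rewrite -!mulr_sumr -mulrA ler_wpM2l// ler_wpM2l// exchange_big /=.
  by apply: ler_sum => m _; rewrite -mulr_sumr.
rewrite -mulr_sumr; apply: le_trans (ler_wpM2r (sqr_ge0 (rnorm x)) etae).
rewrite -!(mulrA 2) ler_wpM2l//; apply: le_trans (times_bessel b0 _ L) _.
rewrite -mulrA ler_wpM2l// -exprMn; apply: sqr_mono (rnorm_ge0 _) _.
exact: (op_power_approx Apc x (ltW s0) taum aP).
Qed.

(** The intervals are translated by 1, so that n + 1 - t_k contains the unit of time consumed by a
    perturbation. Time 0 lies in none of them. *)
Lemma times_locate n :
  exists2 k, (k <= n)%N & t k + 1 <= n.+1%:R < t k.+1 + 1.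
Proof.
have ex : exists k, n.+1%:R < t k.+1 + 1.
  by exists n; rewrite (le_lt_trans (times_ge n.+1))// ltrDl.
case: (ex_minnP ex) => k nk kmin; exists k.
  by apply: kmin; rewrite (le_lt_trans (times_ge n.+1))// ltrDl.
rewrite nk andbT; case: k nk kmin => [|k] nk kmin.
  by rewrite t0 add0r ler1n.
by rewrite leNgt; apply/negP => /kmin; rewrite ltnn.
Qed.

(* Each n >= 1 is t_k + 1 + i / M + delta with 0 <= delta <= 1 / M, for a unique
   pair (i, k) with i < M G. *)
Lemma dominated_orbit :
  dominated (fun x L => \sum_(n < L) rnorm (C (iter n A x)) ^+ 2).
Proof.
apply: dominated_approx => e e0.
have [K0 K1] : 0 <= 36 * G%:R * beta /\ 0 < 36 * G%:R * beta + 1.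
  have h : 0 <= 36 * G%:R * beta by rewrite !mulr_ge0.
  by split=> //; rewrite ltr_wpDl.
(* There are M G offsets i / M, each with perturbations of size 1 / M; the total error is M G * 36
   beta / M^2 = 36 G beta / M. *)
have [M M1n me] : exists2 M, (0 < M)%N & M%:R^-1 <= e / (36 * G%:R * beta + 1).
  have [m /(_ m (leqnn m)) me] := natSinv_small (divr_gt0 e0 K1).
  by exists m.+1.
have M0 : 0 < M%:R :> R by rewrite ltr0n.
have /choice[kk kkP] : forall n, exists k, (k <= n)%N /\ t k + 1 <= n.+1%:R < t k.+1 + 1.
  by move=> n; have [k kn kt] := times_locate n; exists k.
pose r n := n.+1%:R - t (kk n) - 1.
have r0 n : 0 <= r n < G%:R.
  have [_ /andP[h1 h2]] := kkP n; have h3 := gap_le (kk n).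
  by rewrite /r; apply/andP; split; lra.
have Mr0 n : 0 <= M%:R * r n by rewrite mulr_ge0//; case/andP: (r0 n).
pose ii n := Num.truncn (M%:R * r n).
have iiP n : (ii n)%:R / M%:R <= r n /\ r n - (ii n)%:R / M%:R <= M%:R^-1.
  have /andP[h1 h2] := truncn_itv (Mr0 n); split.
    by rewrite ler_pdivrMr// mulrC.
  rewrite lerBlDr -[X in X + _]mul1r -mulrDl ler_pdivlMr// mulrC addrC natr1.
  exact: ltW.
have iiG n : (ii n < M * G)%N.
  rewrite -(ltr_nat R) natrM; have /andP[h1 _] := truncn_itv (Mr0 n).
  by rewrite (le_lt_trans h1)// ltr_pM2l//; case/andP: (r0 n).
have M1 : M%:R^-1 <= 1 :> R by rewrite invf_le1// ler1n.
(* Both offsets lie in the same interval of length 1 / M <= 1, so the two integers differ by less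
   than 1. *)
have inj i j : ii i = ii j -> kk i = kk j -> i = j.
  move=> iij kij; have [i1 i2] := iiP i; have [j1 j2] := iiP j.
  have /andP[hi1 hi2] := truncn_itv (Mr0 i); have /andP[hj1 hj2] := truncn_itv (Mr0 j).
  rewrite -/(ii i) in hi1 hi2; rewrite -/(ii j) -iij in hj1 hj2.
  have d1 : M%:R * (r i - r j) < 1. by move: hi2; rewrite -natr1; lra.
  have d2 : M%:R * (r j - r i) < 1. by move: hj2; rewrite -natr1; lra.
  have rij : r i - r j = i%:R - j%:R by rewrite /r kij -!natr1; ring.
  have Mge : 1 <= M%:R :> R by rewrite ler1n.
  apply/eqP; rewrite eqn_leq; apply/andP; split; rewrite leqNgt; apply/negP => lt.
    have : j%:R + 1 <= i%:R :> R by rewrite natr1 ler_nat.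
    by move: d1; rewrite rij; nra.
  have : i%:R + 1 <= j%:R :> R by rewrite natr1 ler_nat.
  by move: d2; rewrite -opprB rij; nra.
pose P i k := [set n | ii n = i /\ kk n = k].
(* [N] inverts n |-> (ii n, kk n). On pairs that are not attained its value is arbitrary and [del]
   is 0, as [obs_perturbation] asks for a perturbation at every index k. *)
pose N i k := xget 0%N (P i k).
pose del i k := if `[< P i k (N i k) >] then r (N i k) - i%:R / M%:R else 0.
have NE n : N (ii n) (kk n) = n.
  rewrite /N; case: xgetP => [j _ [ij kj]|/(_ n)]; first exact: inj.
  by case.
have delE n : del (ii n) (kk n) = r n - (ii n)%:R / M%:R.
  by rewrite /del NE asboolT.
have del01 i k : 0 <= del i k <= M%:R^-1.
  rewrite /del; case: asboolP => [[Ni _]|_]; last by rewrite lexx invr_ge0 ltW.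
  have [h1 h2] := iiP (N i k); move: h1 h2; rewrite Ni => h1 h2.
  apply/andP; split; [by rewrite subr_ge0|exact: h2].
pose z i x := E (i%:R / M%:R) x.
pose v x i k := obs (t k) (E (1 + del i k) (z i x)) ^+ 2.
have iM i : 0 <= i%:R / M%:R :> R by rewrite divr_ge0.
have vE x n : rnorm (C (iter n.+1 A x)) ^+ 2 = v x (ii n) (kk n).
  rewrite /v /z; have /andP[d0 _] := del01 (ii n) (kk n).
  have d1 : 0 <= 1 + del (ii n) (kk n) by exact: addr_ge0.
  rewrite (op_powerD Apc x d1 (iM _)) (obsD x (times_ge0 _) (addr_ge0 d1 (iM _))).
  have -> : t (kk n) + (1 + del (ii n) (kk n) + (ii n)%:R / M%:R) = n.+1%:R.
    by rewrite delE /r; ring.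
  by rewrite /obs (op_power_nat Apc).
exists (fun x L => obs 0 x ^+ 2 +
    \sum_(i < M * G) 2 * shifted_obs (1 + i%:R / M%:R) x L).
  apply: dominatedD; first exact: dominated_obs.
  apply: (@dominated_sum (M * G) (fun i x L => 2 * shifted_obs (1 + i%:R / M%:R) x L)) => i.
  by apply: dominatedZ => //; apply: dominated_shifted; exact: addr_ge0.
move=> x L; exists L.
apply: le_trans (sum_widen_le (fun n => sqr_ge0 (rnorm (C (iter n A x)))) (leqnSn L)) _.
rewrite big_ord_recl -addrA lerD//.
  by have := op_power_nat Apc 0 x; rewrite /obs => ->.
apply: (@le_trans _ _ (\sum_(i < M * G) \sum_(k < L) v x i k)).
  apply: (sum_injective_le (h1 := ii) (h2 := kk) (u := fun n => rnorm (C (iter n.+1 A x)) ^+ 2)) => //.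
  - move=> k kL; split=> //; apply: leq_ltn_trans kL; exact: (kkP k).1.
  - by move=> i k; exact: sqr_ge0.
apply: (@le_trans _ _ (\sum_(i < M * G) (2 * shifted_obs (1 + i%:R / M%:R) x L +
    36 * M%:R^-1 ^+ 2 * beta * rnorm x ^+ 2))).
  apply: ler_sum => i _.
  apply: (@le_trans _ _ (\sum_(k < L) (2 * obs (t k) (E 1 (z i x)) ^+ 2 +
      2 * obs (t k) (E (1 + del i k) (z i x) - E 1 (z i x)) ^+ 2))).
    by apply: ler_sum => k _; apply: obs_sqr_le; exact: times_ge0.
  rewrite big_split /= -!mulr_sumr lerD//.
    rewrite ler_wpM2l//; apply: ler_sum => k _.
    by rewrite /z op_powerD// obsD ?times_ge0// addr_ge0.
  have := @obs_perturbation t (del i) beta M%:R^-1 (z i x) L times_ge0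
    (fun y => times_bessel b0 y L) beta0 M1 (del01 i).
  move=> /(ler_wpM2l (ler0n R 2)) /le_trans; apply.
  have zx : rnorm (z i x) ^+ 2 <= rnorm x ^+ 2.
    by apply: sqr_mono (rnorm_ge0 _) _; exact: op_power_norm_le.
  have -> : 2 * (18 * M%:R^-1 ^+ 2 * beta * rnorm (z i x) ^+ 2) =
    36 * M%:R^-1 ^+ 2 * beta * rnorm (z i x) ^+ 2 by ring.
  by rewrite ler_wpM2l// !mulr_ge0 ?sqr_ge0.
rewrite big_split /= lerD2l sumr_const card_ord -[_ *+ _]mulr_natl.
have -> : (M * G)%:R * (36 * M%:R^-1 ^+ 2 * beta * rnorm x ^+ 2) =
    (36 * G%:R * beta) * M%:R^-1 * rnorm x ^+ 2.
  by rewrite natrM; field; rewrite lt0r_neq0.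
rewrite ler_wpM2r ?sqr_ge0//.
apply: (@le_trans _ _ ((36 * G%:R * beta) * (e / (36 * G%:R * beta + 1)))).
  by rewrite ler_wpM2l.
by rewrite mulrCA ler_piMr ?(ltW e0)// ler_pdivrMr// mul1r lerDl.
Qed.

(** Domination of the orbit with e = a / 2 leaves an error that the left-hand side absorbs. *)
Lemma times_lower_bound (a : R) : 0 < a ->
  (forall x q, (forall L, \sum_(n < L) rnorm (C (iter n A x)) ^+ 2 <= q) ->
     a * rnorm x ^+ 2 <= q) ->
  exists2 a', 0 < a' & forall x q, (forall L, \sum_(k < L) obs (t k) x ^+ 2 <= q) ->
     a' * rnorm x ^+ 2 <= q.
Proof.
move=> a0 lower; have a2 : 0 < a / 2 by rewrite divr_gt0.
have [K K0 KP] := dominated_orbit a2.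
have K1 : 0 < K + 1 by rewrite ltr_wpDl.
exists (a / 2 / (K + 1)) => [|x q xq]; first by rewrite divr_gt0.
have q0 : 0 <= q by have := xq 0%N; rewrite big_ord0.
have := lower x _ (KP x q xq).
rewrite {1}[a]splitr mulrDl lerD2r => h.
rewrite mulrAC ler_pdivrMr// (le_trans h)// mulrC ler_wpM2l// lerDl//.
Qed.

End Times.

End Bessel.

(** * Exact observability through partial sums *)

Lemma esum_nat_le (R : realType) (u : nat -> R) (q : R) : (forall k, 0 <= u k) ->
  (\esum_(j in [set: nat]) (u j)%:E <= q%:E)%E <->
  forall L, \sum_(k < L) u k <= q.
Proof.
move=> u0; rewrite -nneseries_esumT; last by move=> n; rewrite lee_fin.
split=> [uq L|uq].
  rewrite -lee_fin -sumEFin -(big_mkord xpredT (fun k => (u k)%:E)).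
  by apply: le_trans uq; apply: nneseries_lim_ge => n _ _; rewrite lee_fin.
apply: lime_le; first by apply: is_cvg_nneseries => n _ _; rewrite lee_fin.
by apply: nearW => n; rewrite big_mkord sumEFin lee_fin.
Qed.

(** The lower bound is tested against every upper bound q of the partial sums, which keeps infinite
    sums out of the estimates. *)
Lemma exactly_observable_nat (R : realType) (H Y : hilbertType R)
    (F : nat -> H -> Y) : exactly_observable [set: nat] F <->
  exists a b : R, [/\ 0 < a, a <= b,
    forall x L, \sum_(k < L) rnorm (F k x) ^+ 2 <= b * rnorm x ^+ 2 &
    forall x q, (forall L, \sum_(k < L) rnorm (F k x) ^+ 2 <= q) ->
      a * rnorm x ^+ 2 <= q].
Proof.
have u0 x k : 0 <= rnorm (F k x) ^+ 2 by exact: sqr_ge0.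
split=> -[a [b]].
  move=> [a0 ab obs]; exists a, b; split=> // x.
    by apply/(esum_nat_le _ (u0 x)); case/andP: (obs x).
  move=> q /(esum_nat_le _ (u0 x)) h; case/andP: (obs x) => + _.
  by move=> /le_trans/(_ h); rewrite lee_fin.
move=> [a0 ab up low]; exists a, b; split=> // x.
have upx : (\esum_(j in [set: nat]) (rnorm (F j x) ^+ 2)%:E <= (b * rnorm x ^+ 2)%:E)%E.
  by apply/(esum_nat_le _ (u0 x)) => L; exact: up.
rewrite upx andbT.
have ge0 : (0 <= \esum_(j in [set: nat]) (rnorm (F j x) ^+ 2)%:E)%E.
  by apply: esum_ge0 => j _; rewrite lee_fin.
move: (upx) ge0; case E : (\esum_(j in _) _)%E => [q| |] //= _ _.
rewrite lee_fin; apply: low => L.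
by move: L; apply/(esum_nat_le _ (u0 x)); rewrite E.
Qed.

Lemma bernoulli_le (R : realType) (r : R) n : 1 <= r -> 1 + n%:R * (r - 1) <= r ^+ n.
Proof.
move=> r1; elim: n => [|n IH]; first by rewrite mul0r addr0 expr0.
have n0 : 0 <= n%:R :> R by [].
have h : 0 <= n%:R * (r - 1) * (r - 1) by rewrite !mulr_ge0// subr_ge0.
apply: (@le_trans _ _ (r * (1 + n%:R * (r - 1)))).
  by rewrite -natr1; lra.
by rewrite exprS ler_wpM2l// (le_trans _ r1).
Qed.

(** For symmetric A, |A y|^2 <= |A^2 y| |y|, so |A^n x| is logarithmically convex in n. An initial
    ratio above 1 persists and makes the orbit grow geometrically. *)
Lemma power_bounded_contraction (R : realType) (H : hilbertType R)
    (A : {linear H -> H}) (M : R) : symmetric_op A ->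
  (forall n x, rnorm (iter n A x) <= M * rnorm x) ->
  forall x, rnorm (A x) <= rnorm x.
Proof.
move=> Asym AM x; rewrite leNgt; apply/negP => xA.
have x0 : 0 < rnorm x.
  rewrite lt0r rnorm_ge0 andbT; apply: contraTneq xA => /rnorm_eq0 ->.
  by rewrite linear0 rnorm0 ltxx.
pose r := rnorm (A x) / rnorm x.
have r1 : 1 < r by rewrite ltr_pdivlMr// mul1r.
have r0 : 0 < r by exact: lt_trans r1.
have step y : rnorm (A y) ^+ 2 <= rnorm (A (A y)) * rnorm y.
  by rewrite sqr_rnorm -sym_rip// ripC (le_trans (Cauchy_Schwarz _ _))// mulrC.
have grow n : 0 < rnorm (iter n A x) /\ r * rnorm (iter n A x) <= rnorm (iter n.+1 A x).
  elim: n => [|n [n0 IH]]; first by rewrite /r divfK ?lt0r_neq0.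
  have n1 : 0 < rnorm (iter n.+1 A x) by rewrite (lt_le_trans _ IH)// mulr_gt0.
  split=> //; rewrite -(ler_pM2r n0).
  apply: le_trans (step (iter n A x)).
  rewrite mulrAC expr2 ler_wpM2r// ltW//.
have pw n : r ^+ n * rnorm x <= rnorm (iter n A x).
  elim: n => [|n IH]; first by rewrite expr0 mul1r.
  rewrite exprS -mulrA; apply: le_trans (grow n).2.
  by rewrite ler_wpM2l// ltW.
have rM n : r ^+ n <= M by rewrite -(ler_pM2r x0) (le_trans (pw n)).
pose n := Num.truncn (M / (r - 1)).
have := le_trans (bernoulli_le n.+1 (ltW r1)) (rM n.+1).
have r10 : 0 < r - 1 by rewrite subr_gt0.
have M0 : 0 <= M by apply: le_trans (rM 0%N); rewrite expr0.
have /andP[_ h] : n%:R <= M / (r - 1) < n.+1%:R.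
  by apply: truncn_itv; rewrite divr_ge0// ltW.
move: h; rewrite ltr_pdivrMr// => h1 h2.
by have := le_lt_trans h2 h1; rewrite gtrDr ltNge ler01.
Qed.

Lemma well_spaced_observable (R : realType) (t : nat -> R) (tau : R) (G : nat) :
  t 0%N = 0 -> 1 <= tau -> (forall k, 0 <= t k.+1 - t k - tau) ->
  (forall e, 0 < e -> exists K, forall k, (K <= k)%N -> t k.+1 - t k - tau <= e) ->
  (forall k, t k.+1 - t k <= G%:R) ->
  forall (H Y : hilbertType R) (A : {linear H -> H}) (C : {linear H -> Y}),
    continuous A -> positive_op A -> continuous C ->
    exactly_observable [set: nat] (fun n x => C (iter n A x)) ->
    exactly_observable (range t) (fun s x => C (op_power A s x)).
Proof.
move=> t0 tau1 gap0 gapl gapG H Y A C Ac Apos Cc.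
move=> /exactly_observable_nat[a [b [a0 ab up low]]].
have b0 : 0 <= b by rewrite (le_trans _ ab)// ltW.
have Asym := positive_symmetric Apos.
have Abd := continuous_rbounded Ac.
have [kappa kappa0 Ck] := continuous_rbounded Cc.
(* The observation of A^n x is a tail of that of x, so observability itself makes A power
   bounded. *)
have pb n x : a * rnorm (iter n A x) ^+ 2 <= b * rnorm x ^+ 2.
  apply: low => L; apply: le_trans (up x (n + L)%N).
  rewrite big_split_ord /= -[leLHS]add0r lerD//; first by apply: sumr_ge0 => i _; exact: sqr_ge0.
  by apply: ler_sum => k _; rewrite addnC iterD.
have contr : forall x, rnorm (A x) <= rnorm x.
  (* As b / a <= (b / a + 1)^2, this constant avoids a square root. *)
  apply: (power_bounded_contraction (M := b / a + 1) Asym) => n x.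
  have ba : 0 <= b / a by rewrite divr_ge0// ltW.
  rewrite -(@ler_pXn2r _ 2)// ?nnegrE ?rnorm_ge0 ?mulr_ge0 ?addr_ge0 ?rnorm_ge0//.
  apply: (@le_trans _ _ (b / a * rnorm x ^+ 2)).
    by rewrite mulrAC ler_pdivlMr// mulrC.
  rewrite exprMn ler_wpM2r ?sqr_ge0// expr2; nra.
have Apc : positive_contraction A.
  split=> // x; have := Apos x; rewrite lecE => /andP[_ ->] /=.
  by rewrite expr2 (le_trans (Cauchy_Schwarz _ _))// ler_wpM2r ?rnorm_ge0.
have tS k : t k + 1 <= t k.+1 by have := gap0 k; lra.
have tinj := times_inj tS.
pose b' := 38 * b + kappa ^+ 2.
have [a' a'0 low'] := times_lower_bound Apc kappa0 Ck up t0 tS b0 tau1 gap0 gapl gapG a0 low.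
have up' := times_bessel Apc kappa0 Ck up t0 tS b0.
suff : exactly_observable [set: nat] (fun k x => C (op_power A (t k) x)).
  move=> [c [d [c0 cd obs]]]; exists c, d; split=> // x.
  rewrite (esum_image [set: nat] t (fun s => (rnorm (C (op_power A s x)) ^+ 2)%:E)) ?obs//.
  by move=> i j _ _; exact: tinj.
apply/exactly_observable_nat; exists (Num.min a' b'), b'.
have b'0 : 0 < b'.
  rewrite ltr_wpDr ?sqr_ge0// mulr_gt0//; exact: lt_le_trans ab.
split=> [| |x L|x q xq]; [by rewrite lt_min a'0|by rewrite ge_min lexx orbT|exact: up'|].
apply: le_trans (low' x q xq); rewrite ler_wpM2r ?sqr_ge0//.
by rewrite ge_min lexx.
Qed.

(** * The times N k + c k^gamma *)

Section TimeSequence.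
Context {R : realType}.
Variables (N : nat) (c gamma : R).
Hypotheses (N0 : (0 < N)%N) (c0 : 0 < c) (gamma0 : 0 < gamma).

Lemma time_seqE k : time_seq N c gamma k = N%:R * k%:R + c * k%:R `^ gamma.
Proof. by case: k => //=; rewrite powR0 ?gt_eqF// !mulr0 addr0. Qed.

Lemma time_seq_ge k : k%:R <= time_seq N c gamma k.
Proof.
rewrite time_seqE; apply: (@le_trans _ _ (N%:R * k%:R)).
  by rewrite ler_peMl// ler1n.
by rewrite lerDl mulr_ge0 ?powR_ge0// ltW.
Qed.

Lemma locally_finite_time_seq : locally_finite (range (time_seq N c gamma)).
Proof.
move=> r r0; pose n := (Num.truncn r).+1.
apply: (sub_finite_set _ (finite_image (time_seq N c gamma) (finite_II n))).
move=> _ [[k _ <-]] /=; rewrite in_itv /= => /andP[_ kr]; exists k => //=.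
rewrite -(ltr_nat R); apply: le_lt_trans (le_trans (time_seq_ge k) kr) _.
by case/andP: (truncn_itv (ltW r0)).
Qed.

Lemma powR_increment_ge0 k : 0 <= k.+1%:R `^ gamma - k%:R `^ gamma.
Proof. by rewrite subr_ge0 ge0_ler_powR ?nnegrE ?(ltW gamma0)// ler_nat. Qed.

(** A mean value estimate without derivatives: k^gamma k^(1 - gamma) = k, and replacing the second k
    by k + 1 in (k + 1)^gamma k^(1 - gamma) gives at most k + 1. *)
Lemma powR_increment_le k : gamma <= 1 ->
  (k.+1%:R `^ gamma - k%:R `^ gamma) * k%:R `^ (1 - gamma) <= 1.
Proof.
move=> g1; rewrite mulrBl.
have E (l : nat) : l%:R `^ gamma * l%:R `^ (1 - gamma) = l%:R.
  by rewrite -powRD subrKC ?oner_eq0// powRr1.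
rewrite E lerBlDr nat1r -[leRHS]E ler_wpM2l ?powR_ge0//.
by rewrite ge0_ler_powR ?nnegrE ?subr_ge0// ler_nat.
Qed.

Lemma powR_increment_le1 k : gamma <= 1 -> k.+1%:R `^ gamma - k%:R `^ gamma <= 1.
Proof.
move=> g1; case: k => [|k].
  by rewrite powR0 ?gt_eqF// subr0 powR1.
apply: le_trans (powR_increment_le k.+1 g1); rewrite ler_peMr ?powR_increment_ge0//.
apply: (@le_trans _ _ (1 `^ (1 - gamma))); first by rewrite powR1.
by rewrite ge0_ler_powR ?nnegrE ?subr_ge0// ler1n.
Qed.

Lemma powR_increment_lim e : gamma < 1 -> 0 < e ->
  exists K, forall k, (K <= k)%N -> k.+1%:R `^ gamma - k%:R `^ gamma <= e.
Proof.
move=> g1 e0; have g0 : 0 < 1 - gamma by rewrite subr_gt0.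
pose K := (Num.truncn (e^-1 `^ (1 - gamma)^-1)).+1.
exists K => k Kk.
have ek : e^-1 <= k%:R `^ (1 - gamma).
  have -> : e^-1 = (e^-1 `^ (1 - gamma)^-1) `^ (1 - gamma).
    by rewrite -powRrM mulVf ?gt_eqF// powRr1// invr_ge0 ltW.
  rewrite ge0_ler_powR ?nnegrE ?powR_ge0 ?(ltW g0)//.
  apply: (@le_trans _ _ K%:R); last by rewrite ler_nat.
  by case/andP: (truncn_itv (powR_ge0 e^-1 (1 - gamma)^-1)) => _ /ltW.
have := powR_increment_le k (ltW g1).
have k0 : 0 < k%:R `^ (1 - gamma) by rewrite (lt_le_trans _ ek)// invr_gt0.
rewrite -ler_pdivlMr// mul1r => /le_trans; apply.
by rewrite -[leRHS]invrK lef_pV2 ?posrE ?invr_gt0.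
Qed.

(** The limiting gap jumps: it is N + c for gamma = 1, where all gaps are equal, and N for gamma <
    1, where the gaps decrease to N from above or stay near it. In both cases N + c bounds the
    gaps. *)
Lemma time_seq_universal : gamma <= 1 ->
  universal_time_set (range (time_seq N c gamma)).
Proof.
move=> g1; split.
- move=> _ [k _ <-] /=; rewrite in_itv /= andbT.
  by rewrite (le_trans _ (time_seq_ge k)).
- exact: locally_finite_time_seq.
have dE k : time_seq N c gamma k.+1 - time_seq N c gamma k =
    N%:R + c * (k.+1%:R `^ gamma - k%:R `^ gamma).
  by rewrite !time_seqE -natr1; ring.
have N1 : 1 <= N%:R :> R by rewrite ler1n.
pose G := (N + (Num.truncn c).+1)%N.
have gapG k : time_seq N c gamma k.+1 - time_seq N c gamma k <= G%:R.
  rewrite dE natrD lerD2l; apply: (@le_trans _ _ c).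
    by rewrite ler_piMr ?(ltW c0)// powR_increment_le1.
  by case/andP: (truncn_itv (ltW c0)) => _ /ltW.
move=> H Y A C _ _.
have [gE|gn1] := eqVneq gamma 1.
  have gE' k : time_seq N c gamma k.+1 - time_seq N c gamma k - (N%:R + c) = 0.
    by rewrite dE gE !powRr1// -natr1; ring.
  apply: (@well_spaced_observable _ _ (N%:R + c) G) => //.
  - by rewrite ler_wpDr// ltW.
  - by move=> k; rewrite gE'.
  - by move=> e e0; exists 0%N => k _; rewrite gE' ltW.
have gl : gamma < 1 by rewrite lt_neqAle gn1.
apply: (@well_spaced_observable _ _ N%:R G) => //.
  by move=> k; rewrite dE addrAC subrr add0r mulr_ge0 ?(ltW c0) ?powR_increment_ge0.
move=> e e0; have [K KP] := powR_increment_lim gl (divr_gt0 e0 c0).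
exists K => k Kk; rewrite dE addrAC subrr add0r mulrC -ler_pdivlMr//.
exact: KP.
Qed.

End TimeSequence.

(** * The Hilbert space of square-summable sequences *)

Section SquareSummable.
Context {R : realType}.
Implicit Types (u v : nat -> R) (f g h : nat -> R[i]) (z w : R[i]).

Definition ssum u : R := limn (series u).

Lemma series_ord u L : series u L = \sum_(k < L) u k.
Proof. by rewrite /series /= big_mkord. Qed.

Lemma cvg_nonneg_series u (M : R) : (forall k, 0 <= u k) ->
  (forall L, \sum_(k < L) u k <= M) -> cvgn (series u).
Proof.
move=> u0 uM; apply: nondecreasing_is_cvgn.
  by apply/nondecreasing_seqP => n; rewrite !series_ord big_ord_recr lerDl.
by exists M => _ [L _ <-]; rewrite series_ord.
Qed.

Lemma le_ssum u L : (forall k, 0 <= u k) -> cvgn (series u) ->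
  \sum_(k < L) u k <= ssum u.
Proof.
move=> u0 cu; rewrite -series_ord; apply: nondecreasing_cvgn_le => //.
by apply/nondecreasing_seqP => n; rewrite !series_ord big_ord_recr lerDl.
Qed.

Lemma ssum_le u (M : R) : cvgn (series u) ->
  (forall L, \sum_(k < L) u k <= M) -> ssum u <= M.
Proof.
by move=> cu uM; apply: limr_le => //; apply: nearW => L; rewrite series_ord.
Qed.

Lemma ssumD u v : cvgn (series u) -> cvgn (series v) ->
  ssum (fun k => u k + v k) = ssum u + ssum v.
Proof. by move=> cu cv; rewrite /ssum -lim_seriesD. Qed.

Lemma ssumZ (a : R) u : cvgn (series u) -> ssum (fun k => a * u k) = a * ssum u.
Proof. by move=> cu; exact: (lim_seriesZ a cu). Qed.

(** This is Re (z conj w). With it all series remain real; the complex inner product is reassembled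
    only in [l2inner]. *)
Definition rdot z w : R := complex.Re z * complex.Re w + complex.Im z * complex.Im w.

Lemma rdot_ge0 z : 0 <= rdot z z.
Proof. by rewrite addr_ge0// -expr2 sqr_ge0. Qed.

Lemma rdotC z w : rdot z w = rdot w z.
Proof. by rewrite /rdot; ring. Qed.

Lemma rdotDl z z' w : rdot (z + z') w = rdot z w + rdot z' w.
Proof. by case: z z' w => [a b] [c d] [e f]; rewrite /rdot /=; ring. Qed.

Lemma rdotM (a z w : R[i]) :
  rdot (a * z) w = complex.Re a * rdot z w - complex.Im a * rdot z ('i * w).
Proof. by case: a z w => [a b] [c d] [e f]; rewrite /rdot /=; ring. Qed.

Lemma rdot_sqr z : `|z| ^+ 2 = (rdot z z)%:C.
Proof. by rewrite -add_Re2_Im2 /rdot -!expr2. Qed.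

Definition sq_summable f : Prop := exists M, forall L, \sum_(k < L) rdot (f k) (f k) <= M.

Lemma cvg_rdot_series f g : sq_summable f -> sq_summable g ->
  cvgn (series (fun k => rdot (f k) (g k))).
Proof.
move=> [M fM] [N gN]; apply: normed_cvg.
apply: (@cvg_nonneg_series (fun k => `|rdot (f k) (g k)|) (M + N)) => // L.
apply: (le_trans _ (lerD (fM L) (gN L))); rewrite -big_split /=; apply: ler_sum => k _.
case: (f k) (g k) => [a b] [c d]; rewrite /rdot /= ler_norml; apply/andP.
have := sqr_ge0 (a + c); have := sqr_ge0 (a - c).
have := sqr_ge0 (b + d); have := sqr_ge0 (b - d).
have := sqr_ge0 a; have := sqr_ge0 b; have := sqr_ge0 c; have := sqr_ge0 d.
by move=> ? ? ? ? ? ? ? ?; split; nra.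
Qed.

Definition l2_pred : {pred nat -> R[i]} := fun f => `[< sq_summable f >].

Lemma l2_submod : submod_closed l2_pred.
Proof.
split.
  by apply/asboolP; exists 0 => L; rewrite big1// => k _; rewrite /rdot /= mulr0 addr0.
move=> a f g /asboolP[M fM] /asboolP[N gN]; apply/asboolP.
exists (2 * (rdot a a * M + N)) => L.
apply: (@le_trans _ _ (2 * (rdot a a * \sum_(k < L) rdot (f k) (f k) + \sum_(k < L) rdot (g k) (g k)))).
  rewrite !mulr_sumr -big_split /= mulr_sumr; apply: ler_sum => k _.
  rewrite fctE /=; change ((a *: f) k) with (a * f k).
  case: a (f k) (g k) => [a b] [c d] [e h]; rewrite /rdot /=.
  have := sqr_ge0 ((a * c - b * d) - e); have := sqr_ge0 ((a * d + b * c) - h).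
  by nra.
by rewrite ler_wpM2l// lerD// ler_wpM2l// rdot_ge0.
Qed.

HB.instance Definition _ := GRing.isSubmodClosed.Build _ _ l2_pred l2_submod.

Record ell2 : Type := Ell2 { ell2_fun :> nat -> R[i]; _ : ell2_fun \in l2_pred }.

HB.instance Definition _ := [isSub for ell2_fun].
HB.instance Definition _ := [Choice of ell2 by <:].
HB.instance Definition _ := [SubChoice_isSubLmodule of ell2 by <:].

Lemma ell2_sq_summable (x : ell2) : sq_summable x.
Proof. by case: x => f /= /asboolP. Qed.

Lemma ell2D (x y : ell2) k : (x + y) k = x k + y k. Proof. by []. Qed.
Lemma ell2N (x : ell2) k : (- x) k = - x k. Proof. by []. Qed.
Lemma ell20 k : (0 : ell2) k = 0. Proof. by []. Qed.

Lemma ell2P (x y : ell2) : (forall k, x k = y k) -> x = y.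
Proof. by move=> xy; apply/val_inj/funext. Qed.

Definition l2dot (x y : ell2) : R := ssum (fun k => rdot (x k) (y k)).

Let cvg_dot (x y : ell2) : cvgn (series (fun k => rdot (x k) (y k))).
Proof. by apply: cvg_rdot_series; exact: ell2_sq_summable. Qed.

Lemma l2dotC x y : l2dot x y = l2dot y x.
Proof. by rewrite /l2dot; congr ssum; apply/funext => k; rewrite rdotC. Qed.

Lemma l2dotDl (x y z : ell2) : l2dot (x + y) z = l2dot x z + l2dot y z.
Proof.
rewrite /l2dot -ssumD//; congr ssum.
by apply/funext => k /=; rewrite rdotDl.
Qed.

Lemma l2dotZl (a : R[i]) x y :
  l2dot (a *: x) y = complex.Re a * l2dot x y - complex.Im a * l2dot x ('i *: y).
Proof.
rewrite /l2dot -mulNr -!ssumZ// -ssumD; first last.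
- exact: is_cvg_seriesZ.
- exact: is_cvg_seriesZ.
by congr ssum; apply/funext => k /=; rewrite rdotM mulNr.
Qed.

Lemma l2dot_partial_le (x : ell2) L : \sum_(k < L) rdot (x k) (x k) <= l2dot x x.
Proof. by apply: (@le_ssum (fun k => rdot (x k) (x k))) => // k; exact: rdot_ge0. Qed.

Lemma l2dot_le (x : ell2) M : (forall L, \sum_(k < L) rdot (x k) (x k) <= M) ->
  l2dot x x <= M.
Proof. exact: (@ssum_le (fun k => rdot (x k) (x k))). Qed.

Lemma l2dot_ge0 x : 0 <= l2dot x x.
Proof. by have := l2dot_partial_le x 0; rewrite big_ord0. Qed.

Lemma l2dot_eq0 x : l2dot x x = 0 -> x = 0.
Proof.
move=> x0; apply: ell2P => k; rewrite ell20.
have := l2dot_partial_le x k.+1; rewrite x0 big_ord_recr /= => h.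
have : rdot (x k) (x k) <= 0.
  apply: le_trans h; rewrite lerDr; apply: sumr_ge0 => i _; exact: rdot_ge0.
by rewrite le_eqVlt ltNge rdot_ge0 orbF => /eqP xk;
  apply/eqP; rewrite -normr_eq0 -sqrf_eq0 rdot_sqr xk.
Qed.

Lemma l2dot_norm_scale (a : R[i]) x : l2dot (a *: x) (a *: x) = rdot a a * l2dot x x.
Proof.
have aE (z w : R[i]) : rdot (a * z) (a * w) = rdot a a * rdot z w.
  by case: a z w => [a b] [c d] [e f]; rewrite /rdot /=; ring.
rewrite /l2dot -ssumZ//; congr ssum.
by apply/funext => k /=; rewrite aE.
Qed.

Lemma l2_Cauchy_Schwarz x y : l2dot x y <= Num.sqrt (l2dot x x) * Num.sqrt (l2dot y y).
Proof.
have q t : 0 <= l2dot x x + 2 * l2dot x y * t + l2dot y y * t ^+ 2.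
  have := l2dot_ge0 (x + t%:C *: y).
  rewrite l2dotDl ![l2dot _ (_ + _)]l2dotC !l2dotDl (l2dotC _ (t%:C *: y)).
  rewrite !l2dot_norm_scale l2dotZl /= mul0r subr0 [l2dot y x]l2dotC /rdot /=.
  by congr (0 <= _); ring.
rewrite -sqrtrM ?l2dot_ge0//; apply: (@le_trans _ _ `|l2dot x y|); first exact: ler_norm.
by rewrite -sqrtr_sqr ler_wsqrtr// quadratic_ge0_discr.
Qed.

Definition l2norm (x : ell2) : R[i] := (Num.sqrt (l2dot x x))%:C.

Lemma l2normD x y : l2norm (x + y) <= l2norm x + l2norm y.
Proof.
rewrite /l2norm -rmorphD lecR.
rewrite -(@ler_pXn2r _ 2)// ?nnegrE ?addr_ge0 ?sqrtr_ge0// sqr_sqrtr ?l2dot_ge0//.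
rewrite sqrrD !sqr_sqrtr ?l2dot_ge0// l2dotDl ![l2dot _ (_ + _)]l2dotC !l2dotDl.
rewrite (l2dotC y x); have := l2_Cauchy_Schwarz x y.
set r := Num.sqrt _ * _; rewrite mulr2n; lra.
Qed.

Lemma l2normZ (a : R[i]) x : l2norm (a *: x) = `|a| * l2norm x.
Proof.
rewrite /l2norm l2dot_norm_scale sqrtrM ?rdot_ge0// rmorphM /= normc_def.
by rewrite /rdot -!expr2.
Qed.

Lemma l2norm0_eq0 x : l2norm x = 0 -> x = 0.
Proof.
move=> /complexI/eqP; rewrite sqrtr_eq0 => h; apply: l2dot_eq0.
by apply/eqP; rewrite eq_le h l2dot_ge0.
Qed.

HB.instance Definition _ := Lmodule_isNormed.Build R[i] ell2 l2normD l2normZ l2norm0_eq0.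

Lemma ell2_normE (x : ell2) : `|x| = (Num.sqrt (l2dot x x))%:C. Proof. by []. Qed.

End SquareSummable.
Arguments ell2 : clear implicits.

Section Ell2Hilbert.
Context {R : realType}.
Implicit Types x y : ell2 R.

Lemma ell2_norm_le x (e : R) : 0 <= e ->
  `|x| <= e%:C <-> forall L, \sum_(k < L) rdot (x k) (x k) <= e ^+ 2.
Proof.
move=> e0; rewrite ell2_normE lecR -{1}(ger0_norm e0) -sqrtr_sqr.
rewrite ler_psqrt ?nnegrE ?l2dot_ge0 ?sqr_ge0//; split=> [h L|h].
  by apply: le_trans h; exact: l2dot_partial_le.
exact: l2dot_le.
Qed.

Lemma rdot_le_norm x k : rdot (x k) (x k) <= l2dot x x.
Proof.
apply: le_trans (l2dot_partial_le x k.+1); rewrite big_ord_recr /= lerDr.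
by apply: sumr_ge0 => i _; exact: rdot_ge0.
Qed.

Lemma ell2_coord_lt x k (e : R) : 0 < e -> `|x| < e%:C ->
  `|complex.Re (x k)| < e /\ `|complex.Im (x k)| < e.
Proof.
move=> e0; rewrite ell2_normE ltcR => xe.
have sq : Num.sqrt (l2dot x x) ^+ 2 = l2dot x x by rewrite sqr_sqrtr ?l2dot_ge0.
have xk : rdot (x k) (x k) < e ^+ 2.
  rewrite (le_lt_trans (rdot_le_norm x k))// -sq ltr_pXn2r// ?nnegrE ?sqrtr_ge0//.
  exact: ltW.
move: xk; rewrite /rdot -!expr2 => xk.
by split; rewrite -(@ltr_pXn2r _ 2)// ?nnegrE// ?(ltW e0)// real_normK ?num_real//;
  apply: le_lt_trans xk; rewrite ?lerDl ?lerDr sqr_ge0.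
Qed.

Lemma cauchy_coord (F : set_system (ell2 R)) (phi : R[i] -> R) k : ProperFilter F ->
  (forall z w, phi (z - w) = phi z - phi w) ->
  (forall x (e : R), 0 < e -> `|x| < e%:C -> `|phi (x k)| < e) ->
  cauchy F -> cvg ((fun y : ell2 R => phi (y k)) @ F).
Proof.
move=> FF phiB phile /cauchyP cF; apply: cauchy_cvg; apply: cauchy_exP => e e0.
have e0' : 0 < e%:C by rewrite ltcR.
have [x Fx] := cF _ e0'; exists (phi (x k)).
suff : F (fun y : ell2 R => `|phi (x k) - phi (y k)| < e) by [].
apply: filterS Fx => y; rewrite -ball_normE /= => xy.
by rewrite -phiB; apply: (phile (x - y)).
Qed.

(** The limit is formed coordinatewise. A ball belonging to [F] bounds every finite section of the
    differences, and this bound survives the passage to the limit in finitely many coordinates. *)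
Lemma ell2_complete (F : set_system (ell2 R)) : ProperFilter F -> cauchy F -> cvg F.
Proof.
move=> FF cF.
have cRe k : cvg ((fun y : ell2 R => complex.Re (y k)) @ F).
  apply: cauchy_coord => //; first by move=> [a b] [c d].
  by move=> x e e0 /(ell2_coord_lt k e0)[].
have cIm k : cvg ((fun y : ell2 R => complex.Im (y k)) @ F).
  apply: cauchy_coord => //; first by move=> [a b] [c d].
  by move=> x e e0 /(ell2_coord_lt k e0)[].
pose zr k : R := lim ((fun y : ell2 R => complex.Re (y k)) @ F).
pose zi k : R := lim ((fun y : ell2 R => complex.Im (y k)) @ F).
pose z k := zr k +i* zi k.
have near_z x (e : R) : 0 < e -> F (ball x e%:C) ->
    forall L, \sum_(k < L) rdot (x k - z k) (x k - z k) <= e ^+ 2.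
  move=> e0 Fx L.
  pose q (y : nat -> R[i]) k := (complex.Re (x k) - complex.Re (y k)) *
    (complex.Re (x k) - complex.Re (y k)) +
    (complex.Im (x k) - complex.Im (y k)) * (complex.Im (x k) - complex.Im (y k)).
  have qE (y : nat -> R[i]) k : rdot (x k - y k) (x k - y k) = q y k.
    by rewrite /q; case: (x k) (y k) => [a b] [c d].
  pose g (y : ell2 R) := \sum_(k < L) q y k.
  have cg : g y @[y --> F] --> \sum_(k < L) q z k.
    rewrite /g; elim: L {g} => [|L IH].
      under eq_fun do rewrite big_ord0.
      by rewrite big_ord0; exact: cvg_cst.
    under eq_fun do rewrite big_ord_recr /=.
    rewrite big_ord_recr /=; apply: cvgD => //.
    have cR : complex.Re (x L) - complex.Re (y L) @[y --> F] --> complex.Re (x L) - zr L.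
      by apply: cvgB; [exact: cvg_cst|exact: cRe].
    have cI : complex.Im (x L) - complex.Im (y L) @[y --> F] --> complex.Im (x L) - zi L.
      by apply: cvgB; [exact: cvg_cst|exact: cIm].
    by apply: cvgD; [exact: (cvgM cR cR)|exact: (cvgM cI cI)].
  under eq_bigr do rewrite qE.
  rewrite -(cvg_lim _ cg)//; apply: limr_le; first by apply/cvg_ex; eexists; exact: cg.
  apply: filterS Fx => y; rewrite -ball_normE /= => /ltW xy.
  rewrite /g; under eq_bigr do rewrite -qE.
  exact: ((ell2_norm_le (x - y) (ltW e0)).1 xy L).
have /cauchyP cF' := cF.
have e1 : 0 < (1 : R)%:C by rewrite ltcR.
have [x1 Fx1] := cF' _ e1.
(* z is square-summable as the difference of x1 and x1 - z, the latter being bounded by [near_z]. *)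
have z2 : z \in @l2_pred R.
  have xz : (fun k => x1 k - z k) \in @l2_pred R.
    by apply/asboolP; exists (1 ^+ 2); exact: near_z.
  have -> : z = (x1 : nat -> R[i]) - (fun k => x1 k - z k).
    by apply/funext => k; rewrite !fctE subKr.
  by apply: rpredB => //; exact: (valP x1).
apply/cvg_ex; exists (Ell2 z2); apply/cvgrPdist_le => e e0.
have re0 : 0 < complex.Re e by move: e0; rewrite ltcE => /andP[].
have eE : e = (complex.Re e)%:C by rewrite RRe_real// gtr0_real.
have r2 : 0 < complex.Re e / 2 by rewrite divr_gt0.
have r2' : 0 < (complex.Re e / 2)%:C by rewrite ltcR.
have [x Fx] := cF' _ r2'.
have xz : `|x - Ell2 z2| <= (complex.Re e / 2)%:C.
  by apply/(ell2_norm_le _ (ltW r2)) => L; exact: near_z.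
apply: filterS Fx => y; rewrite -ball_normE /= => xy.
rewrite -(subrKA x) (le_trans (ler_normD _ _))// eE [complex.Re e]splitr rmorphD /=.
by rewrite lerD ?(ltW xy)// distrC.
Qed.

HB.instance Definition _ := Uniform_isComplete.Build (ell2 R) ell2_complete.

(* The imaginary part of <x, y> is Re <x, i y>. *)
Definition l2inner (x y : ell2 R) : R[i] := l2dot x y +i* l2dot x ('i *: y).

Lemma l2dotN_i x y : l2dot ('i *: x) y = - l2dot x ('i *: y).
Proof. by rewrite l2dotZl /= mul0r sub0r mul1r. Qed.

Lemma l2inner_linearl (y : ell2 R) : GRing.linear_for *%R (l2inner ^~ y).
Proof.
move=> a x x'; rewrite /l2inner !l2dotDl !l2dotZl scalerA -expr2 sqr_i.
have -> : l2dot x (-1 *: y) = - l2dot x y.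
  by rewrite l2dotC scaleN1r -scaleN1r l2dotZl /= oppr0 mul0r subr0 mulN1r l2dotC.
by case: a => a b /=; congr Complex; ring.
Qed.

Lemma l2inner_conj x y : l2inner x y = (-1) ^+ false * Num.conj (l2inner y x).
Proof.
rewrite expr0 mul1r; change (l2inner x y = conjc (l2inner y x)).
by rewrite /l2inner /= (l2dotC x y) (l2dotC x) l2dotN_i.
Qed.

Lemma l2inner_linearr (x : ell2 R) : GRing.linear_for (Num.conj \; *%R) (l2inner x).
Proof.
move=> a y y'; rewrite !(l2inner_conj x) !expr0 !mul1r l2inner_linearl.
by rewrite rmorphD rmorphM.
Qed.

HB.instance Definition _ := bilinear_isBilinear.Build R[i] (ell2 R) (ell2 R) R[i]
  *%R (Num.conj \; *%R) l2inner (l2inner_linearl, l2inner_linearr).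
HB.instance Definition _ := isHermitianSesquilinear.Build R[i] (ell2 R) false
  Num.conj l2inner l2inner_conj.

Lemma l2inner_self x : l2inner x x = `|x| ^+ 2.
Proof.
have xix : l2dot x ('i *: x) = 0.
  by have := l2dotN_i x x; rewrite l2dotC; lra.
rewrite /l2inner xix ell2_normE -rmorphXn /= sqr_sqrtr ?l2dot_ge0//.
Qed.

Lemma l2inner_gt0 x : x != 0 -> 0 < l2inner x x.
Proof. by move=> x0; rewrite l2inner_self exprn_gt0// normr_gt0. Qed.

HB.instance Definition _ := isDotProduct.Build R[i] (ell2 R) l2inner l2inner_gt0.

HB.instance Definition _ := isHilbert.Build R (ell2 R) l2inner_self.


End Ell2Hilbert.

(** * Separability of l2 and diagonal operators *)

Section Diagonal.
Context {R : realType}.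
Implicit Types x y : ell2 R.

Lemma ell2_sqr_rnorm x : rnorm x ^+ 2 = l2dot x x.
Proof. by rewrite /rnorm ell2_normE /= sqr_sqrtr ?l2dot_ge0. Qed.

Lemma finite_support_l2 (f : nat -> R[i]) n : (forall k, (n <= k)%N -> f k = 0) ->
  f \in @l2_pred R.
Proof.
move=> fn; apply/asboolP; exists (\sum_(k < n) rdot (f k) (f k)) => L.
have r0 k : 0 <= rdot (f k) (f k) := rdot_ge0 (f k).
apply: le_trans (sum_widen_le r0 (leq_addl n L)) _.
rewrite big_split_ord /= [X in _ + X]big1 ?addr0// => k _.
by rewrite fn ?leq_addr// /rdot /= mulr0 addr0.
Qed.

Definition rational_seq (s : seq (rat * rat)) (k : nat) : R[i] :=
  let q := nth (0, 0) s k in ratr q.1 +i* ratr q.2.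

Lemma rational_seq_l2 s : rational_seq s \in @l2_pred R.
Proof.
by apply: (@finite_support_l2 _ (size s)) => k sk; rewrite /rational_seq nth_default//= rmorph0.
Qed.

Lemma rat_approx (a d : R) : 0 < d -> exists q : rat, (a - ratr q) ^+ 2 <= d ^+ 2.
Proof.
move=> d0; have /rat_in_itvoo[q] : a < a + d by rewrite ltrDl.
rewrite in_itv /= => /andP[q1 q2]; exists q; rewrite -sqrrN opprB.
by apply: sqr_mono; lra.
Qed.

Lemma countable_rational : countable (range (fun s => Ell2 (rational_seq_l2 s))).
Proof. by apply: (card_le_trans (card_image_le _ _)); exact: countableP. Qed.

Lemma ell2_separable : separable (ell2 R).
Proof.
exists (range (fun s => Ell2 (rational_seq_l2 s))).
  exact: countable_rational.
move=> O [x Ox] Oopen.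
have : nbhs x O by apply: open_nbhs_nbhs; split.
move=> /nbhs_ballP[ec ec0 ballO].
pose e := complex.Re ec.
have e0 : 0 < e by move: ec0; rewrite /= ltcE => /andP[].
have ecE : ec = e%:C by rewrite /e RRe_real// gtr0_real.
(* Head and tail of x - y receive e^2 / 8 each, which add up to (e / 2)^2. *)
have f0 : 0 < e ^+ 2 / 8 by rewrite divr_gt0// exprn_gt0.
have [L xL] : exists L, l2dot x x - e ^+ 2 / 8 < \sum_(k < L) rdot (x k) (x k).
  apply: contrapT => /forallNP h.
  have : l2dot x x <= l2dot x x - e ^+ 2 / 8.
    by apply: l2dot_le => L; rewrite leNgt; apply/negP.
  by rewrite leNgt gtrBl f0.
have [d [d0 _ de]] := sqr_small (ler0n R (2 * L)) f0.
have /choice[q qP] : forall k, exists q : rat * rat,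
    (complex.Re (x k) - ratr q.1) ^+ 2 <= d ^+ 2 /\ (complex.Im (x k) - ratr q.2) ^+ 2 <= d ^+ 2.
  move=> k; have [q1 h1] := rat_approx (complex.Re (x k)) d0.
  by have [q2 h2] := rat_approx (complex.Im (x k)) d0; exists (q1, q2).
pose s := mkseq q L.
pose y := Ell2 (rational_seq_l2 s).
exists y; split; last by exists s.
apply: ballO; rewrite -ball_normE /= ecE.
have near_head k : (k < L)%N -> rdot ((x - y) k) ((x - y) k) <= 2 * d ^+ 2.
  move=> kL; have [h1 h2] := qP k.
  rewrite ell2D ell2N /= /rational_seq nth_mkseq//.
  move: h1 h2; case: (x k) => a b /=; rewrite /rdot /=; nra.
have tail_eq k : ((x - y) (L + k)%N) = x (L + k)%N.
  rewrite ell2D ell2N /= /rational_seq nth_default ?size_mkseq ?leq_addr//=.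
  by rewrite rmorph0 subr0.
have xy : `|x - y| <= (e / 2)%:C.
  apply/ell2_norm_le => [|M]; first by rewrite divr_ge0// ltW.
  apply: (le_trans (@sum_widen_le _ (fun k => rdot ((x - y) k) ((x - y) k)) M (L + M)%N
    (fun k => rdot_ge0 _) (leq_addl L M))).
  rewrite big_split_ord /=.
  have head : \sum_(k < L) rdot ((x - y) k) ((x - y) k) <= e ^+ 2 / 8.
    apply: le_trans de; apply: (@le_trans _ _ (\sum_(k < L) 2 * d ^+ 2)).
      by apply: ler_sum => k _; exact: near_head.
    by rewrite sumr_const card_ord -[_ *+ L]mulr_natl mulrA natrM [L%:R * _]mulrC.
  have tail : \sum_(k < M) rdot ((x - y) (L + k)%N) ((x - y) (L + k)%N) <= e ^+ 2 / 8.
    under eq_bigr do rewrite tail_eq.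
    have := l2dot_partial_le x (L + M); rewrite big_split_ord /=; move: xL; lra.
  by apply: le_trans (lerD head tail) _; rewrite expr_div_n; lra.
by apply: le_lt_trans xy _; rewrite ltcR ltr_pdivrMr// ltr_pMr// ltr1n.
Qed.

Definition diag_seq (d : nat -> R) x k : R[i] := (d k)%:C * x k.

Lemma rdot_scale (a : R) (z : R[i]) : rdot (a%:C * z) (a%:C * z) = a ^+ 2 * rdot z z.
Proof. by case: z => b c; rewrite /rdot /=; ring. Qed.

Lemma diag_l2 (d : nat -> R) x : (forall k, `|d k| <= 1) -> diag_seq d x \in @l2_pred R.
Proof.
move=> d1; apply/asboolP; exists (l2dot x x) => L.
apply: le_trans (l2dot_partial_le x L); apply: ler_sum => k _.
rewrite rdot_scale ler_piMl ?rdot_ge0// -real_normK ?num_real//.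
by rewrite exprn_ile1.
Qed.

Section Operator.
Variables (d : nat -> R) (d1 : forall k, `|d k| <= 1).

Definition diag x : ell2 R := Ell2 (diag_l2 x d1).

Lemma diag_linear : linear diag.
Proof.
by move=> a x y; apply: ell2P => k; rewrite /= /diag_seq mulrDr mulrCA.
Qed.

HB.instance Definition _ := GRing.isLinear.Build _ _ _ _ diag diag_linear.

Lemma diag_sqr_rnorm x : rnorm (diag x) ^+ 2 = ssum (fun k => d k ^+ 2 * rdot (x k) (x k)).
Proof.
by rewrite ell2_sqr_rnorm /l2dot; congr ssum; apply/funext => k; rewrite rdot_scale.
Qed.

Lemma diag_norm_le x : rnorm (diag x) <= rnorm x.
Proof.
rewrite -(@ler_pXn2r _ 2)// ?nnegrE ?rnorm_ge0// !ell2_sqr_rnorm; apply: l2dot_le => L.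
apply: le_trans (l2dot_partial_le x L); apply: ler_sum => k _.
rewrite rdot_scale ler_piMl ?rdot_ge0// -real_normK ?num_real//.
by rewrite exprn_ile1.
Qed.

Lemma diag_continuous : continuous diag.
Proof.
by apply: rbounded_continuous; exists 1 => // x; rewrite mul1r diag_norm_le.
Qed.

Lemma diag_positive : (forall k, 0 <= d k) -> positive_op diag.
Proof.
move=> d0 x; rewrite lecE; apply/andP; split.
  have E k : rdot (diag x k) (('i *: x) k) = 0.
    change (rdot ((d k)%:C * x k) ('i * x k) = 0).
    by case: (x k) => a b; rewrite /rdot /=; ring.
  apply/eqP; rewrite /= /l2dot; apply/eqP; rewrite eq_le.
  have cv := cvg_rdot_series (ell2_sq_summable (diag x)) (ell2_sq_summable ('i *: x)).
  apply/andP; split; first by apply: ssum_le => // L; rewrite big1.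
  by have := @le_ssum _ _ 0 _ cv; rewrite big_ord0; apply => k; rewrite E.
have cv := cvg_rdot_series (ell2_sq_summable (diag x)) (ell2_sq_summable x).
have := @le_ssum _ _ 0 _ cv; rewrite big_ord0; apply => k.
rewrite /= /diag_seq; case: (x k) => a b; rewrite /rdot /=.
have -> : (d k * a - 0 * b) * a + (d k * b + 0 * a) * b = d k * (a ^+ 2 + b ^+ 2) by ring.
by rewrite mulr_ge0// addr_ge0// sqr_ge0.
Qed.

Lemma iter_diag n x k : iter n diag x k = (d k ^+ n)%:C * x k.
Proof.
elim: n => [|n IH]; first by rewrite expr0 rmorph1 mul1r.
by rewrite iterS [LHS]/= /diag_seq IH exprS rmorphM mulrA.
Qed.

End Operator.

Definition unit_seq (j k : nat) : R[i] := (k == j)%:R.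

Lemma unit_seq_l2 j : unit_seq j \in @l2_pred R.
Proof.
by apply: (@finite_support_l2 _ j.+1) => k jk; rewrite /unit_seq gtn_eqF.
Qed.

Definition unit_vec j : ell2 R := Ell2 (unit_seq_l2 j).

Lemma diag_unit d (d1 : forall k, `|d k| <= 1) j :
  diag d1 (unit_vec j) = (d j)%:C *: unit_vec j.
Proof.
apply: ell2P => k; change ((d k)%:C * unit_seq j k = (d j)%:C * unit_seq j k).
rewrite /unit_seq.
by case: eqVneq => [->|]; rewrite ?mulr0.
Qed.

Lemma unit_vec_norm j : rnorm (unit_vec j) = 1.
Proof.
apply/eqP; rewrite -(@eqrXn2 _ 2)// ?rnorm_ge0// expr1n ell2_sqr_rnorm eq_le.
have E k : rdot (unit_seq j k) (unit_seq j k) = (k == j)%:R.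
  by rewrite /unit_seq; case: eqP; rewrite /rdot /= ?mulr0 ?mulr1 ?addr0.
apply/andP; split.
  apply: l2dot_le => L /=; under eq_bigr do rewrite E.
  have [jL|Lj] := ltnP j L.
    by rewrite (bigD1 (Ordinal jL))//= eqxx big1 ?addr0// => i /eqP ij;
      case: eqP => // ji; case: ij; apply: val_inj.
  by rewrite big1// => i _; rewrite ltn_eqF// (leq_trans (ltn_ord i)).
by apply: le_trans (rdot_le_norm (unit_vec j) j); rewrite /= E eqxx.
Qed.

End Diagonal.

(** * Powers on an eigenvector *)

Section Eigenvector.
Context {R : realType} {H : hilbertType R}.
Variables (A : {linear H -> H}) (l : R) (e : H).
Hypotheses (Ae : A e = l%:C *: e) (e1 : rnorm e = 1).

Lemma poly_op_eigenvector (p : {poly R[i]}) : poly_op p A e = p.[l%:C] *: e.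
Proof.
elim/poly_ind: p => [|p c IH].
  by rewrite /poly_op size_poly0 big_ord0 horner0 scale0r.
rewrite poly_opD poly_opXM poly_opC IH linearZZ Ae scalerA -scalerDl.
by rewrite hornerMXaddC.
Qed.

Lemma eigenvalue_spectrum : spectrum A l%:C.
Proof.
move=> [B [_ AB _]]; have := AB e; rewrite Ae subrr linear0 => e0.
by move: e1; rewrite -e0 rnorm0 => /eqP; rewrite eq_sym oner_eq0.
Qed.

(** The eigenvalue is in the spectrum, so the polynomials of [cfc] converge to l^t at it. The second
    alternative is the default value of [xget]; the upper bound sought in [sparse_not_universal]
    holds in both. *)
Lemma op_power_eigenvector t : 0 <= l ->
  op_power A t e = (l `^ t)%:C *: e \/ op_power A t e = 0.
Proof.
move=> l0; rewrite /op_power; case: eqVneq => [->|_].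
  by left; rewrite powRr0 scale1r.
case: xgetP => [B _ [p [pf pB]]|]; last by right.
left; apply: (@eq_rnorm_le _ _ _ _ 2) => // d d0.
have [n1 _ P1] := pf d d0; have [n2 _ P2] := pB d d0.
have := P1 (maxn n1 n2) (leq_maxl _ _) _ eigenvalue_spectrum.
have := P2 (maxn n1 n2) (leq_maxr _ _) e.
rewrite poly_op_eigenvector e1 mulr1 => h2 h1.
rewrite mulrC mulr_natl mulr2n.
apply: (@rnorm_le_trans _ _ _ ((p (maxn n1 n2)).[l%:C] *: e)); first by rewrite rnormB.
by rewrite -scalerBl rnormZ e1 mulr1; move: h1; rewrite normc_def lecR.
Qed.

End Eigenvector.

(** * Sparse times *)

Section Counterexample.
Context {R : realType}.

(** 1 - l^n is 1 - l times the sum of the l^i for i < n, and by Bernoulli each l^i is at least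
    1/2. *)
Lemma one_sub_expr_ge (l : R) n : 0 <= l <= 1 -> n%:R * (1 - l) <= 2^-1 ->
  n%:R / 2 * (1 - l) <= 1 - l ^+ n.
Proof.
move=> /andP[l0 l1] nl; have l2 : 0 <= 1 - l by rewrite subr_ge0.
have pw m : 1 - m%:R * (1 - l) <= l ^+ m.
  elim: m => [|m IH]; first by rewrite mul0r subr0 expr0.
  have m0 : 0 <= m%:R * (1 - l) * (1 - l) by rewrite !mulr_ge0.
  rewrite exprS; apply: le_trans (ler_wpM2l l0 IH).
  by rewrite -natr1; lra.
rewrite -[leRHS]opprB subrX1 -mulNr opprB mulrC ler_wpM2l//.
apply: (@le_trans _ _ (\sum_(i < n) (2^-1 : R))).
  by rewrite sumr_const card_ord -[leRHS]mulr_natl.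
apply: ler_sum => i _; apply: le_trans (pw i).
rewrite lerBrDr -lerBrDl; apply: le_trans (_ : 2^-1 <= _); last by lra.
apply: le_trans nl; rewrite ler_wpM2r// ler_nat; exact: ltnW.
Qed.

Definition near_one (j : nat) : R := j%:R / j.+1%:R.

Lemma near_oneE j : near_one j = 1 - j.+1%:R^-1.
Proof. by rewrite /near_one; field; rewrite nat1r pnatr_eq0. Qed.

Lemma near_one_ge0 j : 0 <= near_one j.
Proof. by rewrite divr_ge0. Qed.

Lemma near_one_lt1 j : near_one j < 1.
Proof. by rewrite near_oneE gtrBl invr_gt0. Qed.

Lemma near_one_mono i j : (i <= j)%N -> near_one i <= near_one j.
Proof. by move=> ij; rewrite !near_oneE lerD2l lerN2 lef_pV2 ?posrE// ler_nat. Qed.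

Lemma near_one_norm j : `|near_one j| <= 1.
Proof. by rewrite ger0_norm ?near_one_ge0// ltW// near_one_lt1. Qed.

Definition defect_weight (j : nat) : R := Num.sqrt (1 - near_one j ^+ 2).

Lemma near_one_sqr_le1 j : near_one j ^+ 2 <= 1.
Proof. by rewrite exprn_ile1 ?near_one_ge0// ltW// near_one_lt1. Qed.

Lemma sqr_defect_weight j : defect_weight j ^+ 2 = 1 - near_one j ^+ 2.
Proof. by rewrite sqr_sqrtr// subr_ge0 near_one_sqr_le1. Qed.

Lemma defect_weight_norm j : `|defect_weight j| <= 1.
Proof.
rewrite ger0_norm ?sqrtr_ge0// -[leRHS]sqrtr1 ler_wsqrtr//.
by rewrite gerBl sqr_ge0.
Qed.

Definition contraction_op : {linear ell2 R -> ell2 R} := diag near_one_norm.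
Definition defect_obs : {linear ell2 R -> ell2 R} := diag defect_weight_norm.

Lemma defect_identity x :
  rnorm (defect_obs x) ^+ 2 = rnorm x ^+ 2 - rnorm (contraction_op x) ^+ 2.
Proof.
have cv d (d1 : forall k, `|d k| <= 1) :
    cvgn (series (fun k => d k ^+ 2 * rdot (x k) (x k))).
  have := cvg_rdot_series (ell2_sq_summable (diag d1 x)) (ell2_sq_summable (diag d1 x)).
  by under eq_fun do rewrite rdot_scale.
have cE : rnorm (defect_obs x) ^+ 2 = ssum (fun k => defect_weight k ^+ 2 * rdot (x k) (x k)).
  exact: diag_sqr_rnorm defect_weight_norm x.
have aE : rnorm (contraction_op x) ^+ 2 = ssum (fun k => near_one k ^+ 2 * rdot (x k) (x k)).
  exact: diag_sqr_rnorm near_one_norm x.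
rewrite cE aE; apply/eqP; rewrite eq_sym subr_eq eq_sym; apply/eqP.
rewrite -(ssumD (cv _ defect_weight_norm) (cv _ near_one_norm)).
rewrite ell2_sqr_rnorm /l2dot; congr ssum; apply/funext => k.
by rewrite sqr_defect_weight -mulrDl subrK mul1r.
Qed.

Lemma sum_defect_obs x L :
  \sum_(n < L) rnorm (defect_obs (iter n contraction_op x)) ^+ 2 =
  rnorm x ^+ 2 - rnorm (iter L contraction_op x) ^+ 2.
Proof.
under eq_bigr do rewrite defect_identity.
pose G n := rnorm (iter n contraction_op x) ^+ 2.
suff : \sum_(n < L) (G n - G n.+1) = G 0%N - G L by [].
move: G => G; elim: L => [|L IH]; first by rewrite big_ord0 subrr.
by rewrite big_ord_recr /= IH subrKA.
Qed.

(** After telescoping, the lower bound amounts to A^L x -> 0 for each x. No rate is uniform in x,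
    since the eigenvalues tend to 1. *)
Lemma contraction_op_observable :
  exactly_observable [set: nat] (fun n x => defect_obs (iter n contraction_op x)).
Proof.
apply/exactly_observable_nat; exists 1, 1; split=> // [x L|x q xq].
  by rewrite sum_defect_obs mul1r gerBl sqr_ge0.
rewrite mul1r ell2_sqr_rnorm; apply: l2dot_le => m.
set Sm := \sum_(k < m) _.
have Sm0 : 0 <= Sm by apply: sumr_ge0 => k _; exact: rdot_ge0.
apply/ler_addgt0Pr => e e0.
have Sm1 : 0 < Sm + 1 by rewrite ltr_wpDl.
have r01 : 0 <= near_one m ^+ 2 < 1.
  by rewrite sqr_ge0 /= exprn_ilt1// ?near_one_ge0// near_one_lt1.
have [L rL] := expr_small r01 (divr_gt0 e0 Sm1).
have termE k : rdot (iter L contraction_op x k) (iter L contraction_op x k) =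
    (near_one k ^+ 2) ^+ L * rdot (x k) (x k).
  by rewrite /contraction_op iter_diag rdot_scale -!exprM mulnC.
(* On the first m coordinates the eigenvalues stay below [near_one m] < 1, and L makes their share
   at most e; the others contribute at most the tail of x. *)
have AL : l2dot (iter L contraction_op x) (iter L contraction_op x) <= e + (l2dot x x - Sm).
  apply: l2dot_le => M; under eq_bigr do rewrite termE.
  have p0 k : 0 <= (near_one k ^+ 2) ^+ L * rdot (x k) (x k).
    by rewrite mulr_ge0 ?rdot_ge0// exprn_ge0// sqr_ge0.
  apply: (le_trans (sum_widen_le p0 (leq_addl m M))).
  rewrite big_split_ord /= lerD//.
    apply: (@le_trans _ _ (e / (Sm + 1) * Sm)).
      rewrite mulr_sumr; apply: ler_sum => k _; rewrite ler_wpM2r ?rdot_ge0//.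
      apply: le_trans rL; apply: lerXn2r; rewrite ?nnegrE ?sqr_ge0//.
      by apply: sqr_mono (near_one_ge0 _) _; apply: near_one_mono; exact: ltnW.
    by rewrite mulrAC ler_pdivrMr// ler_wpM2l ?(ltW e0)// lerDl.
  rewrite lerBrDl; apply: le_trans (l2dot_partial_le x (m + M)).
  rewrite big_split_ord /= lerD2l; apply: ler_sum => k _.
  by rewrite ler_piMl ?rdot_ge0// exprn_ile1 ?sqr_ge0// near_one_sqr_le1.
have := xq L; rewrite sum_defect_obs !ell2_sqr_rnorm; lra.
Qed.

(** On e_j the first K times count at most 1 - l^2 each, and t_k >= M k bounds the rest by a
    geometric series of sum (1 - l^2) / (1 - l^M), which is about 2 / M for l near 1. So M is chosen
    first, then K, then j. *)
Lemma sparse_not_universal (t : nat -> R) : injective t -> (forall k, 0 <= t k) ->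
  (forall M : nat, exists K, forall k, (K <= k)%N -> M%:R * k%:R <= t k) ->
  ~ universal_time_set (range t).
Proof.
move=> tinj t0 tM [_ _ univ].
have := univ (ell2 R) (ell2 R) contraction_op defect_obs ell2_separable ell2_separable
  (@diag_continuous _ _ near_one_norm) (diag_positive near_one_norm near_one_ge0)
  (@diag_continuous _ _ defect_weight_norm) contraction_op_observable.
move=> [a [b [a0 _ obs]]].
(* The geometric part is at most 4 / M, hence at most a / 4. *)
pose M := (Num.truncn (16 / a)).+1.
have Ma : 16 / a < M%:R.
  by case/andP: (@truncn_itv _ (16 / a) (divr_ge0 (ler0n _ _) (ltW a0))).
have [K KP] := tM M.
(* The summand 2 M ensures M (1 - l) <= 1/2 for [one_sub_expr_ge]; the other one makes 2 K (1 - l)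
   at most a / 4. *)
pose j := (2 * M + Num.truncn (8 * K%:R / a))%N.
have jK : 8 * K%:R / a < j.+1%:R.
  have h0 : 0 <= 8 * K%:R / a by rewrite divr_ge0 ?mulr_ge0// ltW.
  have /andP[_] := truncn_itv h0; move=> /lt_le_trans; apply.
  by rewrite ler_nat ltnS leq_addl.
pose l := near_one j; pose e := unit_vec j : ell2 R.
have l0 : 0 <= l := near_one_ge0 j.
have l1 : l < 1 := near_one_lt1 j.
have lj : 1 - l = j.+1%:R^-1 by rewrite /l near_oneE subKr.
have lp : 0 < l by rewrite /l /near_one divr_gt0// ltr0n /j /M; lia.
have Mpos : 0 < M%:R :> R by rewrite ltr0n.
have jpos : 0 < j.+1%:R :> R by rewrite ltr0n.
have Ml : M%:R * (1 - l) <= 2^-1.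
  rewrite lj ler_pdivrMr// mulrC ler_pdivlMr// -natrM ler_nat /j; lia.
have gap := @one_sub_expr_ge l M (introT andP (conj l0 (ltW l1))) Ml.
have l2 : 0 < 1 - l by rewrite subr_gt0.
have gap0 : 0 < 1 - l ^+ M.
  by apply: lt_le_trans gap; rewrite mulr_gt0// divr_gt0.
pose q := (1 - l ^+ 2) * (K%:R + (1 - l ^+ M)^-1).
have w0 : 0 <= 1 - l ^+ 2 by rewrite subr_ge0 near_one_sqr_le1.
have term k : rnorm (defect_obs (op_power contraction_op (t k) e)) ^+ 2 <=
    (1 - l ^+ 2) * ((k < K)%:R + (l ^+ M) ^+ k).
  have lM0 : 0 <= (l ^+ M) ^+ k by rewrite !exprn_ge0.
  have [->|->] := op_power_eigenvector (diag_unit near_one_norm j) (unit_vec_norm j) (t k) l0;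
      last first.
    by rewrite linear0 rnorm0 expr0n mulr_ge0// addr_ge0.
  rewrite linearZZ rnormZr ger0_norm ?powR_ge0// exprMn.
  have -> : defect_obs e = (defect_weight j)%:C *: e := diag_unit defect_weight_norm j.
  rewrite rnormZr unit_vec_norm mulr1 real_normK ?num_real//.
  rewrite sqr_defect_weight mulrC ler_wpM2l//.
  have p1 : l `^ t k <= 1 by rewrite powR_le1// l0 ltW.
  have p0 := powR_ge0 l (t k).
  apply: (@le_trans _ _ (l `^ t k)); first by rewrite expr2 ler_piMr.
  have [kK|Kk] := ltnP k K.
    by apply: le_trans p1 _; rewrite lerDl.
  rewrite add0r -exprM -powR_mulrn// natrM; apply: ger_powR; first by rewrite lp ltW.
  exact: KP.
have upper : (\esum_(s in range t) (rnorm (defect_obs (op_power contraction_op s e)) ^+ 2)%:E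
    <= q%:E)%E.
  rewrite (esum_image [set: nat] t (fun s =>
    (rnorm (defect_obs (op_power contraction_op s e)) ^+ 2)%:E)); last first.
    by move=> i k _ _; exact: tinj.
  apply/esum_nat_le => [k|L]; first exact: sqr_ge0.
  apply: (@le_trans _ _ (\sum_(k < L) (1 - l ^+ 2) * ((k < K)%:R + (l ^+ M) ^+ k))).
    by apply: ler_sum => k _; exact: term.
  rewrite -mulr_sumr ler_wpM2l// big_split /= lerD//.
    have i0 k : 0 <= (k < K)%:R :> R by [].
    apply: le_trans (sum_widen_le i0 (leq_addl K L)) _.
    rewrite big_split_ord /= [X in _ + X]big1 ?addr0; last first.
      by move=> k _; rewrite ltnNge leq_addr.
    under eq_bigr do rewrite ltn_ord.
    by rewrite sumr_const card_ord.
  by apply: geometric_sum_le; rewrite exprn_ge0//= -subr_gt0.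
have qa : q <= a / 2.
  have w2 : 1 - l ^+ 2 <= 2 * (1 - l) by nra.
  have h1 : (1 - l ^+ 2) * K%:R <= a / 4.
    apply: (@le_trans _ _ (2 * (1 - l) * K%:R)); first by rewrite ler_wpM2r.
    rewrite lj mulrAC ler_pdivrMr//.
    by move: jK; rewrite ltr_pdivrMr//; lra.
  have h2 : (1 - l ^+ 2) * (1 - l ^+ M)^-1 <= a / 4.
    rewrite ler_pdivrMr//; apply: le_trans w2 _.
    apply: (@le_trans _ _ (a / 4 * (M%:R / 2 * (1 - l)))).
      rewrite !mulrA ler_wpM2r ?(ltW l2)//.
      by move: Ma; rewrite ltr_pdivrMr//; lra.
    by rewrite ler_wpM2l// divr_ge0// ltW.
  by rewrite /q mulrDr; lra.
have /andP[low _] := obs e.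
have := le_trans low upper; rewrite unit_vec_norm expr1n mulr1 lee_fin => aq.
by have := le_trans aq qa; rewrite leNgt ltr_pdivrMr// ltr_pMr// ltr1n.
Qed.

End Counterexample.

Lemma time_seq_superlinear (R : realType) (N : nat) (c gamma : R) (M : nat) :
  0 < c -> 1 < gamma ->
  exists K, forall k, (K <= k)%N -> M%:R * k%:R <= time_seq N c gamma k.
Proof.
move=> c0 g1; have g0 : 0 < gamma - 1 by rewrite subr_gt0.
have gp : 0 < gamma by exact: lt_trans g1.
have Mc : 0 <= M%:R / c by rewrite divr_ge0// ltW.
pose K := (Num.truncn ((M%:R / c) `^ (gamma - 1)^-1)).+1.
exists K => k Kk; rewrite time_seqE//.
have Mk : M%:R / c <= k%:R `^ (gamma - 1).
  have -> : M%:R / c = ((M%:R / c) `^ (gamma - 1)^-1) `^ (gamma - 1).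
    by rewrite -powRrM mulVf ?gt_eqF// powRr1.
  rewrite ge0_ler_powR ?nnegrE ?powR_ge0 ?(ltW g0)//.
  apply: (@le_trans _ _ K%:R); last by rewrite ler_nat.
  by case/andP: (truncn_itv (powR_ge0 (M%:R / c) (gamma - 1)^-1)) => _ /ltW.
apply: (@le_trans _ _ (c * k%:R `^ gamma)); last by rewrite lerDr mulr_ge0.
rewrite -mulr_powRB1// [k%:R * _]mulrC mulrA ler_wpM2r//.
by rewrite -ler_pdivrMl// mulrC.
Qed.

Theorem corollary5p9 (R : realType) (N : nat) (c gamma : R) :
  (0 < N)%N -> 0 < c -> 0 < gamma ->
  universal_time_set (range (time_seq N c gamma)) <-> 0 < gamma <= 1.
Proof.
move=> N0 c0 gamma0; rewrite gamma0 /=; split; last exact: time_seq_universal.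
move=> univ; rewrite leNgt; apply/negP => gamma1.
apply: sparse_not_universal univ => [|k|M].
(* For gamma > 1 too, every gap is at least N >= 1. *)
- apply: times_inj => k; rewrite !time_seqE// -lerBrDl.
  have := powR_increment_ge0 gamma0 k; have : 1 <= N%:R :> R by rewrite ler1n.
  move=> N1 d0; have := mulr_ge0 (ltW c0) d0; rewrite -natr1; lra.
- by rewrite (le_trans _ (time_seq_ge N0 c0 gamma0 k)).
- exact: time_seq_superlinear.
Qed.
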